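(* Let $(M,\mathcal{L},\varphi^t)$ be the geometrico-dynamical compactification of $(\mathrm{T}^1\Sigma,\mathcal{L}_\Sigma,g^t)$ constructed in the context. Then for any $t\neq0$, $\varphi^t$ is non-equicontinuous, non-conservative and not partially hyperbolic. Furthermore, $(\varphi^t)$ is a strongly essential automorphism flow of the path structure $(M,\mathcal{L})$.
   Context: Path structures: a path structure on a three-manifold is a pair $\mathcal{L}=(E^\alpha,E^\beta)$ of smooth one-dimensional distributions whose sum is a contact distribution; automorphisms are diffeomorphisms preserving both distributions. Definitions. A diffeomorphism $f$ of $M$ is non-equicontinuous if the group generated by $f$ is not relatively compact for the compact-open topology; non-conservative if it preserves no finite absolutely continuous Borel measure of total support; partially hyperbolic (standard sense) if there is a continuous $\mathrm{D}f$-invariant splitting $\mathrm{T}M=E^s\oplus E^c\oplus E^u$ into nonzero subbundles with $E^s$ uniformly contracted, $E^u$ uniformly expanded, and $E^c$ dominated by $E^u$ and dominating $E^s$. An automorphism flow of $(M,\mathcal{L})$ is strongly essential if it preserves no continuous one-dimensional distribution of $M$ transverse to $E^\alpha\oplus E^\beta$. Flag space: $\mathbf{X}=\{(p,D)\in\mathbb{R}\mathbf{P}^2\times\mathbb{R}\mathbf{P}^2_*: p\in D\}$, $\mathbb{R}\mathbf{P}^2_*$ being the space of projective lines, with action $g\cdot(p,D)=(g(p),g(D))$ of $\mathrm{PGL}_3(\mathbb{R})$. Put $\mathcal{C}_\alpha(p)=\{(p,D'):D'\ni p\}$, $\mathcal{C}_\beta(D)=\{(p',D):p'\in D\}$; the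 line fields $\mathcal{E}_\alpha,\mathcal{E}_\beta$ tangent to the circles $\mathcal{C}_\alpha(\cdot)$, $\mathcal{C}_\beta(\cdot)$ form a $\mathrm{PGL}_3(\mathbb{R})$-invariant path structure $\mathcal{L}_{\mathbf{X}}$. $(e_1,e_2,e_3)$ is the standard basis of $\mathbb{R}^3$, $[\cdot]$ denotes projective span. Construction. Let $\overline h_1,\dots,\overline h_d\in\mathrm{PSL}_2(\mathbb{R})$ be hyperbolic with pairwise distinct fixed points in $\partial\mathbf{H}^2$, $h_i\in\mathrm{SL}_2(\mathbb{R})$ their lifts with positive eigenvalues, $j(h)=\begin{bmatrix}h&0\\0&1\end{bmatrix}\in\mathrm{PGL}_3(\mathbb{R})$ for $h\in\mathrm{GL}_2(\mathbb{R})$, and $g_i=j(h_i)$. Each $h_i$ is assumed to have been replaced by a power such that $\Gamma=\langle g_1,\dots,g_d\rangle$ is a Schottky subgroup of $\mathrm{PGL}_3(\mathbb{R})$: there are pairwise disjoint compact genus two handlebodies $H_1^\pm,\dots,H_d^\pm$ in $\mathbf{X}$, with $H_i^\pm$ a neighbourhood of $B^\pm_{\alpha\beta}(g_i)$ and $H_i^+=\mathbf{X}\setminus\mathrm{Int}(g_i(H_i^-))$; here, $p_-,p_\pm,p_+$ being the eigenlines of $g_i$ in ascending order of absolute value of eigenvalue, $B^-_{\alpha\beta}(g_i)=\mathcal{C}_\alpha(p_-)\cup\mathcal{C}_\beta([p_-,p_\pm])$ and $B^+_{\alpha\beta}(g_i)=\mathcal{C}_\alpha(p_+)\cup\mathcal{C}_\beta([p_\pm,p_+])$.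 Let $\overline\Gamma_0=\langle\overline h_1,\dots,\overline h_d\rangle$ and $\Sigma=\overline\Gamma_0\backslash\mathbf{H}^2$, with geodesic flow $(g^t)$ on $\mathrm{T}^1\Sigma\simeq\overline\Gamma_0\backslash\mathrm{PSL}_2(\mathbb{R})$ given by right multiplication by $\mathrm{Diag}(e^{t/2},e^{-t/2})$, and $\mathcal{L}_\Sigma$ the path structure induced by the left-invariant line fields generated by $\begin{pmatrix}0&1\\0&0\end{pmatrix}$ and $\begin{pmatrix}0&0\\1&0\end{pmatrix}$. Let $L\subset[e_1,e_2]\simeq\mathbb{R}\mathbf{P}^1=\partial\mathbf{H}^2$ be the limit set of $\overline\Gamma_0$, $\Lambda=\bigcup_{q\in L}\left(\mathcal{C}_\alpha(q)\cup\mathcal{C}_\beta([q,e_3])\right)$ and $\Omega=\mathbf{X}\setminus\Lambda$. Let $\hat{\mathbf{X}}$ be the space of oriented flags $(d,P)$ of $\mathbb{R}^3$ ($d$ an oriented line contained in an oriented plane $P$), on which $\mathrm{PGL}_3(\mathbb{R})\simeq\mathrm{SL}_3(\mathbb{R})$ acts; $\pi\colon\hat{\mathbf{X}}\to\mathbf{X}$ is the four-sheeted covering forgetting orientations, and $\hat{\mathbf{X}}$ carries the path structure $\pi^*\mathcal{L}_{\mathbf{X}}$. Let $\hat\Omega=\pi^{-1}(\Omega)$, $g_0=[\mathrm{Diag}(-1,-1,1)]$, $\hat\Gamma=\Gamma\cup g_0\Gamma$ (it acts freely, properly and cocompactly on $\hat\Omega$). Then $M=\hat\Gamma\backslash\hat\Omega$,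 $\mathcal{L}$ is the path structure induced on $M$, and $(\varphi^t)$ is the flow induced on $M$ by $\psi^{t/2}$, where $\psi^t=[\mathrm{Diag}(e^t,e^t,1)]$. *)

(* Defs.v *)
From HB Require Import structures.
From mathcomp Require Import all_boot all_order all_algebra.
From mathcomp Require Import all_classical all_reals all_analysis.

Set Implicit Arguments.
Unset Strict Implicit.
Unset Printing Implicit Defensive.

Import Order.TTheory GRing.Theory Num.Theory.
Import numFieldNormedType.Exports.

Local Open Scope classical_set_scope.
Local Open Scope ring_scope.
Local Open Scope quotient_scope.

Section Smooth.
Context {R : realType}.

(* class C^k on the open set [U] *)
Fixpoint Cr (k : nat) {V W : normedModType R} (U : set V) (f : V -> W) : Prop :=
  match k with
  | 0 => forall x, U x -> {for x, continuous f}
  | k'.+1 => (forall x, U x -> differentiable f x) /\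
             (forall v : V, Cr k' U (fun x => 'D_v f x))
  end.

Definition smooth_near {V W : normedModType R} (f : V -> W) (x : V) : Prop :=
  exists U : set V, [/\ open U, U x & forall k, Cr k U f].

End Smooth.

(* The smooth structure of a three-manifold [M] is given by inverse charts, i.e.
   parametrizations [c.2 : R^3 -> M] which are only meaningful on the open set
   [c.1] of R^3. *)
Section Manifold.
Context {R : realType} {M : topologicalType}.

Local Notation R3 := 'rV[R]_3.
Definition chart : Type := (set 'rV[R]_3 * ('rV[R]_3 -> M))%type.

(* A field of subsets of the tangent spaces of M; [E c x v] means that the vector
   of components [v] in the chart [c] at the point [c.2 x] belongs to it. *)
Definition tfield : Type := chart -> R3 -> set R3.

Context (atlas : set chart).
Implicit Types (c : chart) (f : M -> M) (E : tfield) (x y v w : R3).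

Definition at_chart c x : Prop := atlas c /\ c.1 x.

Definition local_expr f c x c' y (F : R3 -> R3) : Prop :=
  [/\ at_chart c x, at_chart c' y, F x = y &
      \forall z \near x, c'.1 (F z) /\ c'.2 (F z) = f (c.2 z)].

Definition smooth_map f : Prop :=
  forall c x c' y, at_chart c x -> at_chart c' y -> f (c.2 x) = c'.2 y ->
  exists2 F, local_expr f c x c' y F & smooth_near F x.

Definition diffeomorphism f : Prop :=
  exists g, [/\ cancel f g, cancel g f, smooth_map f & smooth_map g].

(* [Df] sends the tangent vector of components [v] at [c.2 x] to the one of
   components [w] at [c'.2 y] *)
Definition tangent_map f c x v c' y w : Prop :=
  exists F, [/\ local_expr f c x c' y F, differentiable F x & 'd F x v = w].

Definition compatible E : Prop :=
  forall c x v c' y w, tangent_map id c x v c' y w -> (E c x v <-> E c' y w).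

Definition span_of k (X : 'I_k -> R3) : set R3 :=
  [set v | exists a : 'I_k -> R, v = \sum_i a i *: X i].

Definition independent k (X : 'I_k -> R3) : Prop :=
  forall a : 'I_k -> R, \sum_i a i *: X i = 0 -> forall i, a i = 0.

Definition local_frame k E c x (X : 'I_k -> R3 -> R3) : Prop :=
  \forall z \near x, independent (X^~ z) /\ E c z = span_of (X^~ z).

Definition continuous_distribution k E : Prop :=
  compatible E /\
  forall c x, at_chart c x -> exists2 X : 'I_k -> R3 -> R3, local_frame E c x X &
    forall i, \forall z \near x, {for z, continuous (X i)}.

Definition smooth_distribution k E : Prop :=
  compatible E /\
  forall c x, at_chart c x -> exists2 X : 'I_k -> R3 -> R3, local_frame E c x X &
    forall i, smooth_near (X i) x.

Definition sum_field E (F : tfield) : tfield :=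
  fun c x => [set v | exists a b : R3, [/\ E c x a, F c x b & v = a + b]].

Definition preserves f E : Prop :=
  forall c x v c' y w, tangent_map f c x v c' y w -> (E c x v <-> E c' y w).

Definition lie_bracket (X Y : R3 -> R3) : R3 -> R3 :=
  fun x => 'd Y x (X x) - 'd X x (Y x).

(* A plane field is contact if the bracket of the vector fields of a local
   frame is nowhere in it. *)
Definition contact_distribution E : Prop :=
  compatible E /\
  forall c x, at_chart c x -> exists X : 'I_2 -> R3 -> R3,
    [/\ local_frame E c x X, forall i, smooth_near (X i) x &
        ~ E c x (lie_bracket (X 0) (X 1) x)].

Definition path_structure E (F : tfield) : Prop :=
  [/\ smooth_distribution 1 E, smooth_distribution 1 F &
      contact_distribution (sum_field E F)].

Definition path_automorphism E (F : tfield) f : Prop :=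
  [/\ diffeomorphism f, preserves f E & preserves f F].

Definition smooth_flow (phi : R -> M -> M) : Prop :=
  [/\ phi 0 = id, forall s t, phi (s + t) = phi s \o phi t &
      forall (t : R) c x c' y, at_chart c x -> at_chart c' y ->
        phi t (c.2 x) = c'.2 y ->
        exists F : R * R3 -> R3,
          [/\ F (t, x) = y, smooth_near F (t, x) &
              \forall z \near (t, x),
                c'.1 (F z) /\ c'.2 (F z) = phi z.1 (c.2 z.2)]].

Definition automorphism_flow E (F : tfield) (phi : R -> M -> M) : Prop :=
  smooth_flow phi /\ forall t, path_automorphism E F (phi t).

Definition transverse E (F : tfield) : Prop :=
  forall c x, at_chart c x -> sum_field E F c x = setT.

Definition strongly_essential E (F : tfield) (phi : R -> M -> M) : Prop :=
  ~ exists T, [/\ continuous_distribution 1 T, transverse T (sum_field E F) &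
                  forall t, preserves (phi t) T].

Definition quad (G : 'M[R]_3) (v : R3) : R := (v *m G *m v^T) 0 0.

Definition riemannian_metric (G : chart -> R3 -> 'M[R]_3) : Prop :=
  [/\ forall c x, at_chart c x ->
        (G c x)^T = G c x /\ forall v, v != 0 -> 0 < quad (G c x) v,
      forall c x, at_chart c x -> {for x, continuous (G c)} &
      forall c x v c' y w, tangent_map id c x v c' y w ->
        quad (G c x) v = quad (G c' y) w].

Section Hyperbolicity.
Context (G : chart -> R3 -> 'M[R]_3) (f : M -> M).

Definition tnorm c x v : R := Num.sqrt (quad (G c x) v).

Definition uniformly_contracted E : Prop :=
  exists C r : R, [/\ 0 < C, 0 < r, r < 1 &
    forall n c x v c' y w, tangent_map (iter n f) c x v c' y w -> E c x v ->
      tnorm c' y w <= C * r ^+ n * tnorm c x v].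

Definition uniformly_expanded E : Prop :=
  exists C r : R, [/\ 0 < C, 0 < r, r < 1 &
    forall n c x v c' y w, tangent_map (iter n f) c x v c' y w -> E c x v ->
      tnorm c x v <= C * r ^+ n * tnorm c' y w].

(* [E] is dominated by [F] *)
Definition dominated E (F : tfield) : Prop :=
  exists C r : R, [/\ 0 < C, 0 < r, r < 1 &
    forall n c x c' y v v' w w',
      tangent_map (iter n f) c x v c' y v' -> E c x v ->
      tangent_map (iter n f) c x w c' y w' -> F c x w ->
      tnorm c' y v' * tnorm c x w <= C * r ^+ n * (tnorm c' y w' * tnorm c x v)].

End Hyperbolicity.

Definition tangent_splitting E1 E2 E3 : Prop :=
  forall c x, at_chart c x ->
  (forall v, exists v1 v2 v3,
     [/\ E1 c x v1, E2 c x v2, E3 c x v3 & v = v1 + v2 + v3]) /\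
  (forall v1 v2 v3, E1 c x v1 -> E2 c x v2 -> E3 c x v3 ->
     v1 + v2 + v3 = 0 -> [/\ v1 = 0, v2 = 0 & v3 = 0]).

(* On a closed manifold the choice of the metric is irrelevant. *)
Definition partially_hyperbolic f : Prop :=
  exists G, riemannian_metric G /\
  exists (Es Ec Eu : tfield) (ks kc ku : nat),
    [/\ [/\ (0 < ks)%N, (0 < kc)%N & (0 < ku)%N],
        [/\ continuous_distribution ks Es, continuous_distribution kc Ec &
            continuous_distribution ku Eu],
        tangent_splitting Es Ec Eu,
        [/\ preserves f Es, preserves f Ec & preserves f Eu] &
        [/\ uniformly_contracted G f Es, uniformly_expanded G f Eu,
            dominated G f Es Ec & dominated G f Ec Eu]].

Definition cyclic_group f : set (M -> M) :=
  [set k | exists n, k = iter n f \/ (cancel k (iter n f) /\ cancel (iter n f) k)].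

(* The set [K] is required to consist of continuous maps because the library
   puts the compact-open topology on the space of all maps. *)
Definition equicontinuous_map f : Prop :=
  exists K : set {compact-open, M -> M},
    [/\ compact K, cyclic_group f `<=` K & forall k : M -> M, K k -> continuous k].

(* Measurable types are pointed, whence the dependency on a point of [M]. *)
Definition pointed_at (p : M) : Type := M.
HB.instance Definition _ (p : M) := Choice.on (pointed_at p).
HB.instance Definition _ (p : M) := isPointed.Build (pointed_at p) p.

Definition borel (p : M) : Type :=
  g_sigma_algebraType (@open M : set (set (pointed_at p))).
HB.instance Definition _ (p : M) := Measurable.on (borel p).

Definition row3 (p : R * R * R) : R3 :=
  \row_(i < 3) [:: p.1.1; p.1.2; p.2]`_i.

Definition lebesgue_null (A : set R3) : Prop :=
  ((@lebesgue_measure R \x @lebesgue_measure R) \x @lebesgue_measure R)%E.-negligible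
    (row3 @^-1` A).

Definition null_set (A : set M) : Prop :=
  forall c, atlas c -> lebesgue_null (c.1 `&` c.2 @^-1` A).

Definition conservative f : Prop :=
  exists (p : M) (mu : {finite_measure set (borel p) -> \bar R}),
    [/\ forall A : set (borel p), measurable A -> null_set A -> mu A = 0%E,
        forall U : set M, open U -> U !=set0 -> (0 < mu U)%E &
        forall A : set (borel p), measurable A -> mu (f @^-1` A) = mu A].

End Manifold.

Section Flags.
Context {R : realType}.

Local Notation V := 'cV[R]_3.

Definition frame : Type := set_type [set F : 'M[R]_(3, 2) | \rank F = 2%N].
HB.instance Definition _ := Topological.on frame.

Definition flag : Type :=
  {x : {vspace V} * {vspace V} | [&& \dim x.1 == 1%N, \dim x.2 == 2%N & (x.1 <= x.2)%VS]}.

Definition vec1 (F : frame) : V := col 0 (val F).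
Definition vec2 (F : frame) : V := col 1 (val F).

Lemma frame_indep (F : frame) (a b : R) :
  a *: vec1 F + b *: vec2 F = 0 -> a = 0 /\ b = 0.
Proof.
have /row_fullP [B BF] : row_full (val F) by apply/eqP; exact: (set_mem (valP F)).
pose w : 'cV[R]_2 := \col_i (if i == 0 then a else b).
have -> : a *: vec1 F + b *: vec2 F = val F *m w.
  apply/matrixP => i k; rewrite !mxE !big_ord_recl big_ord0 addr0 !mxE /=.
  rewrite [a * _]mulrC [b * _]mulrC.
  by congr (val F _ _ * _ + val F _ _ * _); apply: val_inj.
move=> Fw0; have w0 : w = 0 by rewrite -[w]mul1mx -BF -mulmxA Fw0 mulmx0.
by split; [have := congr1 (fun M : 'cV[R]_2 => M 0 0) w0 | have := congr1 (fun M : 'cV[R]_2 => M 1 0) w0];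
  rewrite !mxE.
Qed.

Lemma frame_flagP (F : frame) :
  [&& \dim <[vec1 F]> == 1%N, \dim (<[vec1 F]> + <[vec2 F]>) == 2%N &
      (<[vec1 F]> <= <[vec1 F]> + <[vec2 F]>)%VS].
Proof.
have fr : free [:: vec2 F; vec1 F].
  rewrite free_cons seq1_free span_seq1; apply/andP; split.
    apply/vlineP => -[k e]; have /frame_indep [_ /eqP] : k *: vec1 F + (- 1) *: vec2 F = 0.
      by rewrite e scaleN1r subrr.
    by rewrite oppr_eq0 oner_eq0.
  apply/eqP => e; have /frame_indep [/eqP] : 1 *: vec1 F + 0 *: vec2 F = 0.
    by rewrite e scaler0 scale0r addr0.
  by rewrite oner_eq0.
rewrite addvSl andbT addvC -span_seq1 -span_cons; apply/andP; split; last exact: fr.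
by move: fr; rewrite free_cons => /andP [_].
Qed.

Definition flag_of_frame (F : frame) : flag := exist _ (_, _) (frame_flagP F).

HB.instance Definition _ := Choice.on flag.

(* The topology of X in RP^2 x RP^2_* is the quotient topology of the space of
   frames. *)
Definition flag_open (U : set flag) : Prop := open (flag_of_frame @^-1` U).
Lemma flag_openT : flag_open setT.
Proof. exact: openT. Qed.
Lemma flag_openI : setI_closed flag_open.
Proof. by move=> A B; exact: openI. Qed.
Lemma flag_open_bigU (I : Type) (f : I -> set flag) :
  (forall i, flag_open (f i)) -> flag_open (\bigcup_i f i).
Proof. by move=> fo; apply: bigcup_open => i _; exact: fo. Qed.
HB.instance Definition _ :=
  isOpenTopological.Build flag flag_openT flag_openI flag_open_bigU.

Definition circle_alpha (p : {vspace V}) : set flag := [set x | (val x).1 = p].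
Definition circle_beta (D : {vspace V}) : set flag := [set x | (val x).2 = D].

Definition flag_image (A : 'M[R]_3) (H : set flag) : set flag :=
  [set y | exists2 x, H x & (val y).1 = (linfun (mulmx A) @: (val x).1)%VS /\
                            (val y).2 = (linfun (mulmx A) @: (val x).2)%VS].

(* An oriented flag is seen as the class of its adapted frames: the first vector
   orients the line, and both of them orient the plane. *)
Definition same_oflag (F G : frame) : bool :=
  `[< exists a b c : R, [/\ 0 < a, 0 < b, vec1 G = a *: vec1 F &
        vec2 G = b *: vec2 F + c *: vec1 F] >].

Lemma same_oflag_refl : reflexive same_oflag.
Proof.
move=> F; apply/asboolP; exists 1, 1, 0.
by rewrite !scale1r scale0r addr0; split.
Qed.

Lemma same_oflag_trans : transitive same_oflag.
Proof.
move=> G F H /asboolP [a [b [c [a0 b0 e1 e2]]]] /asboolP [a' [b' [c' [a0' b0' e1' e2']]]].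
apply/asboolP; exists (a' * a), (b' * b), (b' * c + c' * a).
by split; rewrite ?mulr_gt0// ?e1' ?e2' ?e1 ?e2 ?scalerDr ?scalerA// -addrA -scalerDl.
Qed.

Lemma same_oflag_sym : symmetric same_oflag.
Proof.
suff H F G : same_oflag F G -> same_oflag G F by move=> F G; apply/idP/idP; exact: H.
move=> /asboolP [a [b [c [a0 b0 e1 e2]]]].
apply/asboolP; exists a^-1, b^-1, (- (b^-1 * c * a^-1)).
split; rewrite ?invr_gt0// ?e1 ?e2 ?scalerDr ?scalerA ?mulVf ?gt_eqF ?scale1r//.
by rewrite mulNr -!mulrA mulVf ?gt_eqF// mulr1 scaleNr addrK.
Qed.

Canonical same_oflag_equiv :=
  EquivRel same_oflag same_oflag_refl same_oflag_sym same_oflag_trans.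

Definition oflag : Type := quotient_topology {eq_quot same_oflag}.
HB.instance Definition _ := Topological.on oflag.
HB.instance Definition _ := Quotient.on oflag.

Lemma std_frameP : (pid_mx 2 : 'M[R]_(3, 2)) \in [set F : 'M[R]_(3, 2) | \rank F = 2%N].
Proof. by rewrite inE /= rank_pid_mx. Qed.

Definition std_frame : frame := SigSub std_frameP.

(* only meaningful when [F] has rank 2 *)
Definition oflag_of (F : 'M[R]_(3, 2)) : oflag := \pi_oflag (insubd std_frame F).

Definition forget (x : oflag) : flag := flag_of_frame (repr x).

(* The action of PGL_3(R) = SL_3(R) on oriented flags. It is only used for
   matrices of positive determinant, which are positive multiples of their
   representative in SL_3(R) and hence act as the latter. *)
Definition act (A : 'M[R]_3) (x : oflag) : oflag := oflag_of (A *m val (repr x)).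

Lemma col_mulmx n (k : 'I_n) (A : 'M[R]_3) (B : 'M[R]_(3, n)) :
  col k (A *m B) = A *m col k B.
Proof. by rewrite !colE mulmxA. Qed.

Lemma line_scale (a : R) (v : V) : a != 0 -> (<[a *: v]> = <[v]>)%VS.
Proof.
move=> a0; apply/subv_anti/andP; split; rewrite -memvE ?memvZ ?memv_line//.
by rewrite -[X in X \in _](scalerK a0) memvZ ?memv_line.
Qed.

Lemma rank_mul_frame (A : 'M[R]_3) (F : frame) :
  A \in unitmx -> (A *m val F) \in [set F : 'M[R]_(3, 2) | \rank F = 2%N].
Proof.
move=> uA; rewrite inE /= -[RHS](set_mem (valP F)) -[LHS]mxrank_tr trmx_mul.
by rewrite mxrankMfree ?mxrank_tr// row_free_unit unitmx_tr.
Qed.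

Definition mul_frame (A : 'M[R]_3) (uA : A \in unitmx) (F : frame) : frame :=
  SigSub (rank_mul_frame F uA).

Lemma actE (A : 'M[R]_3) (uA : A \in unitmx) (F : frame) :
  act A (\pi_oflag F) = \pi_oflag (mul_frame uA F).
Proof.
rewrite /act /oflag_of; apply/eqmodP => /=.
have -> : insubd std_frame (A *m val (repr (\pi_oflag F))) =
    mul_frame uA (repr (\pi_oflag F)).
  by apply: val_inj; rewrite val_insubd rank_mul_frame.
have : same_oflag (repr (\pi_oflag F)) F by apply/eqmodP; rewrite reprK.
move=> /asboolP [a [b [c [a0 b0 e1 e2]]]]; apply/asboolP; exists a, b, c.
rewrite /vec1 /vec2 /= !col_mulmx; split=> //.
  by rewrite scalemxAr; congr (_ *m _).
by rewrite !scalemxAr -mulmxDr; congr (_ *m _).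
Qed.

Lemma act1 (x : oflag) : act 1%:M x = x.
Proof.
rewrite -[x]reprK (actE (unitmx1 _ _)); congr (\pi_oflag _).
by apply: val_inj; rewrite /= mul1mx.
Qed.

Lemma actM (A B : 'M[R]_3) (x : oflag) : A \in unitmx -> B \in unitmx ->
  act (A *m B) x = act A (act B x).
Proof.
move=> uA uB; have uAB : A *m B \in unitmx by rewrite unitmx_mul uA.
rewrite -[x]reprK (actE uAB) (actE uB) (actE uA); congr (\pi_oflag _).
by apply: val_inj; rewrite /= mulmxA.
Qed.

Lemma forget_act (A : 'M[R]_3) (x : oflag) : A \in unitmx ->
  val (forget (act A x)) = ((linfun (mulmx A) @: (val (forget x)).1)%VS,
                            (linfun (mulmx A) @: (val (forget x)).2)%VS).
Proof.
move=> uA; rewrite -{1}[x]reprK (actE uA) /forget.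
set F := repr x; set G := mul_frame uA F.
have : same_oflag G (repr (\pi_oflag G)) by apply/eqmodP; rewrite reprK.
move=> /asboolP [a [b [c [a0 b0 e1 e2]]]]; rewrite /= limgD !limg_line !lfunE /=.
have l1 : <[vec1 (repr (\pi_oflag G))]>%VS = <[A *m vec1 F]>%VS.
  by rewrite e1 line_scale ?gt_eqF// /vec1 /= col_mulmx.
congr (_, _); first exact: l1.
apply/subv_anti; rewrite !subv_add l1 !addvSl /=; apply/andP; split.
  rewrite -memvE e2 /vec1 /vec2 /= !col_mulmx memvD// memvZ//.
    by rewrite (subvP (addvSr _ _)) ?memv_line.
  by rewrite (subvP (addvSl _ _)) ?memv_line.
have -> : A *m vec2 F =
    b^-1 *: vec2 (repr (\pi_oflag G)) - (b^-1 * c * a^-1) *: vec1 (repr (\pi_oflag G)).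
  rewrite e2 e1 /vec1 /vec2 /= !col_mulmx scalerDr !scalerA mulVf ?gt_eqF// scale1r.
  by rewrite -!mulrA mulVf ?gt_eqF// mulr1 addrK.
rewrite -memvE rpredB// memvZ//.
  by rewrite (subvP (addvSr _ _)) ?memv_line.
by rewrite -l1 (subvP (addvSl _ _)) ?memv_line.
Qed.

(* the affine chart centred at the oriented flag of the first two columns of [B] *)
Definition big_cell (B : 'M[R]_3) (v : 'rV[R]_3) : oflag :=
  oflag_of (B *m \matrix_(i < 3, j < 2)
    (if j == 0 then [:: 1; v 0 0; v 0 2]`_i else [:: 0; 1; v 0 1]`_i)).

End Flags.

Section Schottky.
Context {R : realType}.

Local Notation V := 'cV[R]_3.

Definition line (v : V) : {vspace V} := <[v]>%VS.
Definition plane (v w : V) : {vspace V} := (<[v]> + <[w]>)%VS.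

(* the model handlebody: a closed disc with two round holes, times an interval *)
Definition std_handlebody : set 'rV[R]_3 :=
  [set v | [/\ `|v 0 2| <= 1, v 0 0 ^+ 2 + v 0 1 ^+ 2 <= 16,
               1 <= (v 0 0 - 2) ^+ 2 + v 0 1 ^+ 2 &
               1 <= (v 0 0 + 2) ^+ 2 + v 0 1 ^+ 2]].

Definition genus_two_handlebody (H : set (@flag R)) : Prop :=
  exists (f : flag -> 'rV[R]_3) (g : 'rV[R]_3 -> flag),
    [/\ {within H, continuous f}, {within std_handlebody, continuous g},
        set_fun H std_handlebody f, set_fun std_handlebody H g &
        {in H, cancel f g} /\ {in std_handlebody, cancel g f}].

Definition ordered_eigenlines (A : 'M[R]_3) (p0 p1 p2 : V) : Prop :=
  [/\ p0 != 0, p1 != 0, p2 != 0 &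
      exists l0 l1 l2 : R, [/\ `|l0| < `|l1|, `|l1| < `|l2|, A *m p0 = l0 *: p0,
                               A *m p1 = l1 *: p1 & A *m p2 = l2 *: p2]].

(* [H i true] and [H i false] stand for H_i^+ and H_i^- *)
Definition schottky d (g : 'I_d -> 'M[R]_3) : Prop :=
  exists H : 'I_d -> bool -> set (@flag R),
  [/\ forall i b, compact (H i b) /\ genus_two_handlebody (H i b),
      forall i b j b', (i, b) != (j, b') -> H i b `&` H j b' = set0,
      forall i p0 p1 p2, ordered_eigenlines (g i) p0 p1 p2 ->
        circle_alpha (line p0) `|` circle_beta (plane p0 p1) `<=` interior (H i false) /\
        circle_alpha (line p2) `|` circle_beta (plane p1 p2) `<=` interior (H i true) &
      forall i, H i true = ~` interior (flag_image (g i) (H i false))].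

Inductive generated n (S : set 'M[R]_n) : set 'M[R]_n :=
| generated1 : generated S 1%:M
| generatedM A B : S A -> generated S B -> generated S (A *m B)
| generatedV A B : S A -> generated S B -> generated S (invmx A *m B).

Definition SL2 : Type := {A : 'M[R]_2 | \det A == 1}.

Definition j_mx (h : 'M[R]_2) : 'M[R]_3 := block_mx h 0 0 (1%:M : 'M[R]_1).

Definition diag3 (a b c : R) : 'M[R]_3 := diag_mx (\row_(i < 3) [:: a; b; c]`_i).

End Schottky.

Section Construction.
Context {R : realType} (d : nat) (h : 'I_d -> @SL2 R).

Local Notation V := 'cV[R]_3.

(* the class of [val (h i)] in PSL_2(R) is hyperbolic, and [val (h i)] is its
   lift with positive eigenvalues *)
Definition positive_hyperbolic : Prop :=
  forall i, 2 < `|\tr (val (h i))| /\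
            forall a, eigenvalue (val (h i)) a -> 0 < a.

Definition distinct_fixed_points : Prop :=
  forall i k (v : 'cV[R]_2) (a b : R), i != k -> v != 0 ->
    val (h i) *m v = a *: v -> val (h k) *m v = b *: v -> False.

Definition gen (i : 'I_d) : 'M[R]_3 := j_mx (val (h i)).

Definition Gamma0 : set 'M[R]_2 := generated (range (fun i => val (h i))).
Definition Gamma : set 'M[R]_3 := generated (range gen).
Definition g0 : 'M[R]_3 := diag3 (-1) (-1) 1.
Definition hatGamma : set 'M[R]_3 := Gamma `|` [set g0 *m A | A in Gamma].

(* The hyperbolic plane is seen as the set of positive definite symmetric 2x2
   matrices up to scaling, on which A acts by S |-> A S A^T, and a point [q] of
   its boundary RP^1 as the rank one matrix q q^T (Klein model). The limit set
   consists of the limits in RP^1 of the orbit of the identity matrix. *)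
Definition trace_one (S : 'M[R]_2) : 'M[R]_2 := (\tr S)^-1 *: S.

Definition limit_set : set 'cV[R]_2 :=
  [set q | q != 0 /\ exists A : nat -> 'M[R]_2, (forall n, Gamma0 (A n)) /\
    (fun n => trace_one (A n *m (A n)^T)) @ \oo --> trace_one (q *m q^T)].

Definition e3 : V := delta_mx 2 0.
Definition in_plane12 (q : 'cV[R]_2) : V := col_mx q (0 : 'cV[R]_1).

Definition Lambda : set (@flag R) :=
  [set x | exists2 q, limit_set q &
     (circle_alpha (line (in_plane12 q)) `|`
      circle_beta (plane (in_plane12 q) e3)) x].

Definition hatOmega : set (@oflag R) := forget @^-1` (~` Lambda).

Definition same_orbit (x y : set_type hatOmega) : bool :=
  `[< exists2 A, hatGamma A & val y = act A (val x) >].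

Lemma g0g0 : g0 *m g0 = 1%:M.
Proof.
rewrite mulmx_diag -diag_const_mx; congr diag_mx; apply/rowP => i; rewrite !mxE.
by case: i => -[|[|[|]]] // ? /=; rewrite ?mulrNN mulr1.
Qed.

Lemma g0_gen (i : 'I_d) : g0 *m gen i = gen i *m g0.
Proof.
have -> : g0 = block_mx ((-1)%:M : 'M[R]_2) 0 0 (1%:M : 'M[R]_1).
  apply/matrixP => a b; rewrite !mxE /=; case: splitP => a' ea; rewrite !mxE;
  case: splitP => b' eb; rewrite !mxE -!val_eqE /= ea eb ?ord1 /=.
  - by case: a' ea => -[|[|]] // ?.
  - by case: a' ea => -[|[|]] // ?.
  - by case: b' eb => -[|[|]] // ?.
  - by [].
rewrite /gen /j_mx.
rewrite [LHS](@mulmx_block _ 2 1 2 1 2 1) [RHS](@mulmx_block _ 2 1 2 1 2 1).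
by rewrite !mulmx0 !mul0mx !addr0 !add0r -(scalar_mxC _ (val (h i))).
Qed.

Lemma gen_unit (i : 'I_d) : gen i \in unitmx.
Proof.
rewrite unitmxE /gen /j_mx (@det_ublock _ 2 1) det1 mulr1 (eqP (valP (h i))).
exact: unitr1.
Qed.

Lemma invmxM (A B : 'M[R]_3) : A \in unitmx -> B \in unitmx ->
  invmx (A *m B) = invmx B *m invmx A.
Proof.
move=> uA uB; have uAB : A *m B \in unitmx by rewrite unitmx_mul uA.
apply: (can_inj (mulKmx uAB)); rewrite mulmxV// mulmxA -(mulmxA A) mulmxV//.
by rewrite mulmx1 mulmxV.
Qed.

Lemma g0_unit : g0 \in unitmx.
Proof. by have [] := mulmx1_unit g0g0. Qed.

Lemma Gamma_unit A : Gamma A -> A \in unitmx.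
Proof.
elim=> [|_ B [i _ <-] _ uB|_ B [i _ <-] _ uB]; first exact: unitmx1.
- by rewrite unitmx_mul gen_unit.
- by rewrite unitmx_mul unitmx_inv gen_unit.
Qed.

Lemma GammaM A B : Gamma A -> Gamma B -> Gamma (A *m B).
Proof.
move=> GA GB; elim: GA => [|g C Sg _ IH|g C Sg _ IH]; first by rewrite mul1mx.
- by rewrite -mulmxA; exact: generatedM.
- by rewrite -mulmxA; exact: generatedV.
Qed.

Lemma GammaV A : Gamma A -> Gamma (invmx A).
Proof.
elim=> [|g C [i _ <-] GC IH|g C [i _ <-] GC IH].
- by rewrite invmx1; exact: generated1.
- rewrite invmxM ?gen_unit ?Gamma_unit//; apply: GammaM => //.
  rewrite -[invmx _]mulmx1; apply: generatedV; [by exists i|exact: generated1].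
- rewrite invmxM ?unitmx_inv ?gen_unit ?Gamma_unit// invmxK; apply: GammaM => //.
  rewrite -[gen i]mulmx1; apply: generatedM; [by exists i|exact: generated1].
Qed.

Lemma g0_Gamma A : Gamma A -> g0 *m A = A *m g0.
Proof.
elim=> [|_ B [i _ <-] _ IH|_ B [i _ <-] _ IH]; first by rewrite mul1mx mulmx1.
- by rewrite mulmxA g0_gen -!mulmxA IH.
- have -> : g0 *m (invmx (gen i) *m B) = invmx (gen i) *m (g0 *m B).
    rewrite -[LHS](mulKmx (gen_unit i)); congr (_ *m _).
    by rewrite mulmxA -g0_gen -!mulmxA mulKVmx ?gen_unit.
  by rewrite IH mulmxA.
Qed.

Lemma hatGamma_unit A : hatGamma A -> A \in unitmx.
Proof.
move=> [/Gamma_unit //|[B /Gamma_unit uB <-]].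
by rewrite unitmx_mul g0_unit.
Qed.

Lemma hatGammaM A B : hatGamma A -> hatGamma B -> hatGamma (A *m B).
Proof.
move=> [GA|[A' GA <-]] [GB|[B' GB <-]].
- by left; exact: GammaM.
- by right; exists (A *m B'); [exact: GammaM|rewrite !mulmxA -(g0_Gamma GA)].
- by right; exists (A' *m B); [exact: GammaM|rewrite !mulmxA].
- left; rewrite g0_Gamma// -mulmxA [g0 *m _]mulmxA g0g0 mul1mx; exact: GammaM.
Qed.

Lemma hatGammaV A : hatGamma A -> hatGamma (invmx A).
Proof.
move=> [GA|[B GB <-]]; first by left; exact: GammaV.
right; exists (invmx B); first exact: GammaV.
rewrite invmxM ?g0_unit ?Gamma_unit// (g0_Gamma (GammaV GB)); congr (_ *m _).
by rewrite -[RHS]mulmx1 -g0g0 mulmxA mulVmx ?g0_unit// mul1mx.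
Qed.

Lemma same_orbit_refl : reflexive same_orbit.
Proof.
by move=> x; apply/asboolP; exists 1%:M; [left; exact: generated1|rewrite act1].
Qed.

Lemma same_orbit_trans : transitive same_orbit.
Proof.
move=> y x z /asboolP [A GA e] /asboolP [B GB e']; apply/asboolP.
exists (B *m A); first exact: hatGammaM.
by rewrite actM ?hatGamma_unit// -e.
Qed.

Lemma same_orbit_sym : symmetric same_orbit.
Proof.
suff H x y : same_orbit x y -> same_orbit y x by move=> x y; apply/idP/idP; exact: H.
move=> /asboolP [A GA e]; apply/asboolP; exists (invmx A); first exact: hatGammaV.
by rewrite e -actM ?unitmx_inv ?hatGamma_unit// mulVmx ?hatGamma_unit// act1.
Qed.

Canonical same_orbit_equiv :=
  EquivRel same_orbit same_orbit_refl same_orbit_sym same_orbit_trans.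

Definition compactification : Type := quotient_topology {eq_quot same_orbit}.
HB.instance Definition _ := Topological.on compactification.
HB.instance Definition _ := Quotient.on compactification.

Local Notation M := compactification.

Definition proj (x : set_type hatOmega) : M := \pi_M x.

(* The inverse charts of M are the injective maps which lift to affine charts of
   the space of oriented flags: this is the smooth structure for which the
   projection is a local diffeomorphism. They cover M as soon as the action of
   the group on [hatOmega] is free and proper. *)
Definition atlas : set (@chart R M) :=
  [set c | [/\ open c.1, {in c.1 &, injective c.2} &
     exists2 B : 'M[R]_3, B \in unitmx & forall v, c.1 v ->
       exists2 x, val x = big_cell B v & c.2 v = proj x]].

(* The line field induced on M by the line field of X tangent to the circles
   [C x] through each flag [x]: it is made of the velocities of the curves of M
   having a lift which stays, after forgetting orientations, in such a circle. *)
Definition circle_field (C : @flag R -> set (@flag R)) : @tfield R M :=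
  fun c x => [set v | exists (u : R -> 'rV[R]_3) (w : R -> set_type hatOmega),
    [/\ u 0 = x, is_derive (0 : R) 1 u v, {for 0, continuous w} &
        \forall s \near (0 : R), proj (w s) = c.2 (u s) /\
          C (forget (val (w 0))) (forget (val (w s)))]].

Definition E_alpha : @tfield R M := circle_field (fun x => circle_alpha (val x).1).
Definition E_beta : @tfield R M := circle_field (fun x => circle_beta (val x).2).

Definition psi (t : R) : 'M[R]_3 := diag3 (expR t) (expR t) 1.

Lemma psi_unit t : psi t \in unitmx.
Proof.
rewrite unitmxE det_diag unitfE; apply/prodf_neq0 => i _; rewrite mxE.
by case: i => -[|[|[|]]] // ? /=; rewrite ?oner_eq0 ?gt_eqF ?expR_gt0.
Qed.

Lemma diag3M (a b c : R) (v : V) (i : 'I_3) :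
  (diag3 a b c *m v) i 0 = [:: a; b; c]`_i * v i 0.
Proof. by rewrite mul_diag_mx !mxE. Qed.

Lemma psi_in_plane12 t q : psi t *m in_plane12 q = expR t *: in_plane12 q.
Proof.
apply/matrixP => i k; rewrite ord1 diag3M [RHS]mxE /in_plane12 mxE.
case: splitP => l il; last first.
  by rewrite [(0 : 'cV[R]_1) _ _]mxE !mulr0.
by case: l il => -[|[|]] // ? /= ->.
Qed.

Lemma psi_e3 t : psi t *m e3 = e3.
Proof.
apply/matrixP => i k; rewrite ord1 diag3M !mxE -!val_eqE /=.
by case: i => -[|[|[|]]] // ? /=; rewrite ?mulr0 ?mul1r.
Qed.

Lemma psi_line t q :
  (linfun (mulmx (psi t)) @: line (in_plane12 q))%VS = line (in_plane12 q).
Proof. by rewrite /line limg_line lfunE /= psi_in_plane12 line_scale// gt_eqF ?expR_gt0. Qed.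

Lemma psi_plane t q : (linfun (mulmx (psi t)) @: plane (in_plane12 q) e3)%VS =
  plane (in_plane12 q) e3.
Proof.
rewrite /plane limgD !limg_line !lfunE /= psi_e3 psi_in_plane12.
by rewrite line_scale// gt_eqF ?expR_gt0.
Qed.

Lemma limg_mul_inj (A : 'M[R]_3) : A \in unitmx ->
  injective (fun U : {vspace V} => linfun (mulmx A) @: U)%VS.
Proof.
move=> uA; apply: (can_inj (g := fun U => linfun (mulmx (invmx A)) @: U)%VS) => U.
rewrite -limg_comp -[RHS]lim1g; congr (_ @: _)%VS.
by apply/lfunP => v; rewrite comp_lfunE !lfunE /= mulKmx.
Qed.

Lemma psi_hatOmega t (x : set_type hatOmega) : act (psi t) (val x) \in hatOmega.
Proof.
have uP := psi_unit t; rewrite inE => -[q Lq H].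
have {}H : (val (forget (act (psi t) (val x)))).1 = line (in_plane12 q) \/
           (val (forget (act (psi t) (val x)))).2 = plane (in_plane12 q) e3 by exact: H.
rewrite (forget_act _ uP) in H.
have := set_mem (valP x); apply; exists q => //.
by case: H => H; [left|right]; apply: (limg_mul_inj uP); rewrite [LHS]H ?psi_line ?psi_plane.
Qed.

Definition flow (t : R) (m : M) : M :=
  proj (SigSub (psi_hatOmega (t / 2) (repr m))).

End Construction.

Arguments proj {R d} h x.
Arguments atlas {R d} h.
Arguments E_alpha {R d} h.
Arguments E_beta {R d} h.
Arguments flow {R d} h t m.

(* Main.v *)
(** The limit set [Lambda] misses a neighbourhood of the leaf C_alpha(q) for any q
    of RP^1 outside [L], and [psi^t] preserves this leaf.  In affine charts around
    the two flags (q, [e1,e2]) and (q, [q,e3]) the flow is diag(1,l,l) and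
    diag(l,1/l,1) with l = e^(-t/2).  For t > 0 the first flag lies on a
    curve of fixed points, towards which the flow contracts the transverse directions:
    - boxes shrinking under the flow to a null set have equal mass, so that a finite
      absolutely continuous invariant measure cannot charge open sets;
    - the differential there has eigenvalues 1, l, l only, so that no subbundle is
      uniformly expanded;
    - an invariant line field transverse to the contact planes is forced, along the
      leaf, into the kernel of the first coordinate of each of the two charts, which
      together only leave the leaf direction;
    - a limit of the maps [phi^(-nt)] would send the fixed point to a point which the
      quotient topology does not separate from the rest of the leaf; lifting to flags,
      [|A q|] would be arbitrarily small for A in [Gamma_0], and q would lie in [L].

    Such a q is found by ping-pong on the circle C_beta([e1,e2]), which meets the
    handlebodies in disjoint closed sets and so, being connected, is not covered by
    them.  A cone around q meets none of its translates, which makes the charts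
    injective without any appeal to proper discontinuity. *)

(* Neither separation of M nor covering by its charts is established: every dynamical argument lives
   in two explicit charts, and a limit of the flow is refuted by lifting to flags rather than by
   uniqueness of limits.

   The cone condition speaks of lines of [e1,e2] only, and there [g0] = j(-1) acts trivially. What
   excludes [g0] is orientation: it reverses the component along [e1,e2], which an oriented flag
   remembers. This is why the charts can be whole slabs, bounded in one direction only and invariant
   under the flow, so that the flow is linear on them for all times.

   The cone condition is also quantitative: a translate of a vector of the cone has slope at least e
   in the basis (q, r). This uniform gap, and not freeness alone, keeps the cone away from L.

   Smoothness is obtained uniformly: changes of cells and the flow are rational in the coordinates
   and in the exponential of time.

   The sign of t costs little: the inverse flow replaces the flow, and the stable bundle the
   unstable one. *)
Require Import Defs.
From HB Require Import structures.
From mathcomp Require Import all_boot all_order all_algebra.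
From mathcomp Require Import all_classical all_reals all_analysis.
From mathcomp Require Import lra perm.

Set Implicit Arguments.
Unset Strict Implicit.
Unset Printing Implicit Defensive.

Import Order.TTheory GRing.Theory Num.Theory.
Import numFieldNormedType.Exports.

Local Open Scope classical_set_scope.
Local Open Scope ring_scope.
Local Open Scope quotient_scope.

(** * Closure of elementary functions under differentiation *)

Section Elementary.
Context {R : realType} {V : normedModType R}.
Implicit Types (U : set V) (f g : V -> R) (x v : V).

(** [Cr] is phrased by iterated directional derivatives, so smoothness follows for any class of
    differentiable functions closed under them. This one is large enough for matrix products,
    quotients by minors and exponentials of time; [U] records where denominators do not vanish. *)
Inductive elementary U : (V -> R) -> Prop :=
| elementary_affine f : (forall x, differentiable f x) ->
    (forall v, exists c, forall x, 'D_v f x = c) -> elementary U f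
| elementaryD f g : elementary U f -> elementary U g -> elementary U (f \+ g)
| elementaryM f g : elementary U f -> elementary U g -> elementary U (f \* g)
| elementaryV f : (forall x, U x -> f x != 0) -> elementary U f ->
    elementary U (fun x => (f x)^-1)
| elementary_exp f : elementary U f -> elementary U (expR \o f).

Lemma elementary_cst U (a : R) : elementary U (cst a).
Proof.
apply: elementary_affine => [x|v]; first exact: differentiable_cst.
by exists 0 => x; rewrite derive_cst.
Qed.

Lemma elementary_differentiable U f x : elementary U f -> U x -> differentiable f x.
Proof.
move=> + Ux; elim=> [{}f df _ //|{}f g _ df _ dg|{}f g _ df _ dg|{}f f0 _ df|{}f _ df].
- exact: differentiableD.
- exact: differentiableM.
- exact: differentiableV (f0 _ Ux).
- apply: differentiable_comp => //; apply/derivable1_diffP; exact: derivable_expR.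
Qed.

Lemma elementary_derive U f v : elementary U f ->
  exists2 g, elementary U g & forall x, U x -> 'D_v f x = g x.
Proof.
elim=> [{}f df /(_ v)[c Dc]|{}f g ef [f' ef' Df] eg [g' eg' Dg]|
        {}f g ef [f' ef' Df] eg [g' eg' Dg]|{}f f0 ef [f' ef' Df]|{}f ef [f' ef' Df]].
- by exists (cst c); [exact: elementary_cst|move=> x _; exact: Dc].
- exists (f' \+ g'); first exact: elementaryD.
  move=> x Ux; have df := elementary_differentiable ef Ux.
  have dg := elementary_differentiable eg Ux.
  by rewrite deriveD ?Df ?Dg//; exact: diff_derivable.
- exists ((f \* g') \+ (g \* f')); first by apply: elementaryD; exact: elementaryM.
  move=> x Ux; have df := elementary_differentiable ef Ux.
  have dg := elementary_differentiable eg Ux.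
  by rewrite deriveM ?Df ?Dg//; exact: diff_derivable.
- exists ((cst (-1) \* ((fun x => (f x)^-1) \* (fun x => (f x)^-1))) \* f').
    apply: elementaryM => //; apply: elementaryM; first exact: elementary_cst.
    by apply: elementaryM; exact: elementaryV.
  move=> x Ux; have df := elementary_differentiable ef Ux.
  rewrite deriveV ?f0//; last exact: diff_derivable.
  by rewrite Df// /= /GRing.scale /= mulN1r -exprVn expr2.
- exists ((expR \o f) \* f'); first by apply: elementaryM => //; exact: elementary_exp.
  move=> x Ux; have df := elementary_differentiable ef Ux.
  have de : differentiable (@expR R) (f x).
    by apply/derivable1_diffP; exact: derivable_expR.
  rewrite deriveE; last exact: differentiable_comp.
  have := Df x Ux; rewrite deriveE// => Dfx.
  rewrite diff_comp//= diff1E//= derive1E derive_val Dfx.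
  by rewrite /GRing.scale /= mulrC.
Qed.

Lemma elementary_coord n U (F : V -> 'rV[R]_n) :
  (forall i, elementary U (fun x => F x 0 i)) ->
  (forall x, U x -> differentiable F x) /\
  forall v, exists2 G : V -> 'rV[R]_n, (forall i, elementary U (fun x => G x 0 i)) &
    forall x, U x -> 'D_v F x = G x.
Proof.
move=> eF.
have FE : F = \sum_i (fun x => F x 0 i *: (delta_mx 0 i : 'rV[R]_n)).
  by apply/funext => x; rewrite fct_sumE [LHS]row_sum_delta.
have dF x : U x -> differentiable F x.
  move=> Ux; rewrite FE; apply: differentiable_sum => i.
  by apply: differentiableZl; exact: elementary_differentiable (eF i) Ux.
split=> // v.
have /choice[g gP] : forall i, exists g, elementary U g /\
    forall x, U x -> 'D_v (fun x => F x 0 i) x = g x.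
  by move=> i; have [g] := elementary_derive v (eF i); exists g.
exists (fun x => \row_i g i x) => [i|x Ux].
  by under eq_fun do rewrite mxE; have [] := gP i.
have dvF := diff_derivable (dF _ Ux) (v := v).
rewrite derive_mx//; apply/rowP => i; rewrite !mxE.
by have [_ ->] := gP i.
Qed.

(** The first order expansion of [f] at [x] is also one of [g], and an expansion with continuous
    linear part determines the differential. *)
Lemma near_eq_differentiable (W : normedModType R) (f g : V -> W) x :
  (\forall z \near x, f z = g z) -> differentiable f x -> differentiable g x.
Proof.
move=> fg df; have [cdf Df] := (diff_locallyP _ _).1 df.
have gx := nbhs_singleton fg.
have Dg : g \o shift x = cst (g x) + 'd f x +o_ 0 id.
  apply/eqaddoP => e e0; move/eqaddoP : Df => /(_ e e0) De.
  have fgx : \forall h \near 0, f (h + x) = g (h + x).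
    have : (fun h => h + x) @ 0 --> 0 + x by apply: cvgD; [exact: cvg_id|exact: cvg_cst].
    by rewrite add0r => /(_ _ fg).
  apply: filterS2 fgx De => h fgh; rewrite !fctE /= -gx.
  by rewrite -fgh.
by apply/diff_locallyP; rewrite (diff_unique cdf Dg).
Qed.

(** Continuity and directional derivatives depend on germs only, and equality on an open set is
    equality of germs at its points. *)
Lemma Cr_eq (W : normedModType R) k U (f g : V -> W) : open U ->
  (forall x, U x -> f x = g x) -> Cr k U f -> Cr k U g.
Proof.
move=> oU; elim: k f g => [|k IH] f g fg /=.
  move=> cf x Ux; have {cf} := cf x Ux.
  have nfg : \forall z \near x, f z = g z.
    by apply: filterS (fg) _; exact: open_nbhs_nbhs.
  move=> cf; rewrite /prop_for /continuous_at -fg//.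
  by apply: cvg_trans cf; exact: near_eq_cvg.
have nfg x : U x -> \forall z \near x, f z = g z.
  by move=> Ux; apply: filterS (fg) _; exact: open_nbhs_nbhs.
move=> [df Df]; split=> [x Ux|v].
  have := df _ Ux; have /nfg nfgx := Ux.
  exact: near_eq_differentiable.
apply: IH (Df v) => x Ux; exact/near_eq_derive/nfg.
Qed.

Lemma Cr_coord n k U (F : V -> 'rV[R]_n) : open U ->
  (forall i, elementary U (fun x => F x 0 i)) -> Cr k U F.
Proof.
move=> oU; elim: k F => [|k IH] F eF /=; have [dF DF] := elementary_coord eF.
  by move=> x /dF; exact: differentiable_continuous.
split=> // v; have [G eG FG] := DF v.
by apply: (@Cr_eq _ _ _ G) => [//|x /FG//|]; exact: IH.
Qed.

End Elementary.

(** * The big cell of the space of oriented flags *)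

Section Cells.
Context {R : realType}.
Local Notation R3 := 'rV[R]_3.
Implicit Types (v : R3) (C : 'M[R]_(3, 2)) (B : 'M[R]_3).

Lemma cvg_mx {T : Type} {F : set_system T} {FF : Filter F} m n
    (f : T -> 'M[R]_(m, n)) (l : 'M[R]_(m, n)) :
  (forall i j, f x i j @[x --> F] --> l i j) -> f @ F --> l.
Proof.
move=> fl A [P nP PA]; have : \forall x \near F, forall i j, P i j (f x i j).
  apply: filter_forall => i; apply: filter_forall => j; exact: fl (nP i j).
by apply: filterS => x Px; exact: PA.
Qed.

Lemma continuous_mx {T : topologicalType} m n (f : T -> 'M[R]_(m, n)) x :
  (forall i j, {for x, continuous (fun y => f y i j)}) -> {for x, continuous f}.
Proof. by move=> fc; apply: cvg_mx => i j; exact: fc. Qed.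

Lemma cvg_coord {T : Type} {F : set_system T} {FF : Filter F} m n
    (f : T -> 'M[R]_(m, n)) (l : 'M[R]_(m, n)) i j :
  f @ F --> l -> f x i j @[x --> F] --> l i j.
Proof.
move=> fl; apply: (cvg_comp f (fun M : 'M[R]_(m, n) => M i j) fl).
exact: coord_continuous.
Qed.

Lemma mulmx_cvg {T : Type} {F : set_system T} {FF : Filter F} m n p
    (f : T -> 'M[R]_(m, n)) (g : T -> 'M[R]_(n, p)) (a : 'M[R]_(m, n)) (b : 'M[R]_(n, p)) :
  f @ F --> a -> g @ F --> b -> (fun x => f x *m g x) @ F --> a *m b.
Proof.
move=> fa gb; apply: cvg_mx => i j; rewrite mxE; under eq_fun do rewrite mxE.
apply: (cvg_big add_continuous) => // k _; apply: cvgM.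
  exact: cvg_coord.
exact: cvg_coord.
Qed.

Lemma row3P (v w : R3) : v 0 0 = w 0 0 -> v 0 1 = w 0 1 -> v 0 2 = w 0 2 -> v = w.
Proof.
move=> e0 e1 e2; apply/rowP => -[[|[|[|//]]] i3].
- by rewrite (_ : Ordinal i3 = 0)//; exact: val_inj.
- by rewrite (_ : Ordinal i3 = 1)//; exact: val_inj.
- by rewrite (_ : Ordinal i3 = 2)//; exact: val_inj.
Qed.

(* The point (x, y, z) of the cell is the flag ([1 : x : z], [(1, x, z), (0, 1, y)]), so that
   the contact form is dz - y dx. *)
Definition cell_mx v : 'M[R]_(3, 2) := \matrix_(i < 3, j < 2)
  (if j == 0 then [:: 1; v 0 0; v 0 2]`_i else [:: 0; 1; v 0 1]`_i).

Definition minor C : R := C 0 0 * C 1 1 - C 0 1 * C 1 0.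

(** The two signs are those of orientation: such frames are the ones that positive rescalings and a
    shear turn into a [cell_mx]. *)
Definition in_cell C : Prop := 0 < C 0 0 /\ 0 < minor C.

(** Ratios of entries of the first column, and of two maximal minors: they do not change when the
    frame is replaced by an equivalent one. *)
Definition cell_coord C : R3 := \row_(i < 3)
  [:: C 1 0 / C 0 0; (C 2 1 * C 0 0 - C 0 1 * C 2 0) / minor C; C 2 0 / C 0 0]`_i.

Lemma cell_mx_in v : in_cell (cell_mx v).
Proof. by rewrite /in_cell /minor !mxE /= !mulr1 mul0r subr0 ltr01. Qed.

Lemma cell_mxK v : cell_coord (cell_mx v) = v.
Proof.
by apply: row3P; rewrite !mxE /minor !mxE /= ?(mulr1, mul0r, subr0, divr1, invr1).
Qed.

Lemma rank_minor C : minor C != 0 -> \rank C = 2%N.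
Proof.
move=> C0; apply/eqP/row_fullP.
(* A left inverse: the inverse of the top 2x2 block, padded with a zero column. *)
exists (\matrix_(i < 2, j < 3) (if i == 0 then [:: C 1 1 / minor C; - C 0 1 / minor C; 0]`_j
  else [:: - C 1 0 / minor C; C 0 0 / minor C; 0]`_j)).
apply/matrixP => i j; rewrite !mxE !big_ord_recl big_ord0 !mxE /= if_same mul0r !addr0.
have eqo : [:: 0 ; 1] = enum 'I_2.
  by rewrite !enum_ordSl enum_ord0; congr [:: _; _]; apply: val_inj.
have : i \in [:: 0; 1] by rewrite eqo mem_enum.
have : j \in [:: 0; 1] by rewrite eqo mem_enum.
have -> : lift ord0 ord0 = 1 :> 'I_3 by apply: val_inj.
have -> : ord0 = 0 :> 'I_3 by apply: val_inj.
rewrite !inE => /orP[] /eqP-> /orP[] /eqP->; rewrite /= mulrAC [X in _ + X]mulrAC -mulrDl.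
- by rewrite -[RHS](divff C0); congr (_ / _); rewrite /minor; lra.
- by rewrite (_ : _ + _ = 0) ?mul0r//; lra.
- by rewrite (_ : _ + _ = 0) ?mul0r//; lra.
- by rewrite -[RHS](divff C0); congr (_ / _); rewrite /minor; lra.
Qed.

Lemma in_cell_rank C : in_cell C -> \rank C = 2%N.
Proof. by move=> [_ m0]; apply: rank_minor; rewrite gt_eqF. Qed.

(** [same_oflag] for bare matrices, so that no proof of rank has to be carried through products. *)
Definition oriented_equiv C C' : Prop := exists a b c : R,
  [/\ 0 < a, 0 < b, col 0 C' = a *: col 0 C & col 1 C' = b *: col 1 C + c *: col 0 C].

Lemma oriented_equivP C C' : oriented_equiv C C' <-> exists a b c : R,
  [/\ 0 < a, 0 < b, forall i, C' i 0 = a * C i 0 & forall i, C' i 1 = b * C i 1 + c * C i 0].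
Proof.
split=> -[a [b [c [a0 b0 e1 e2]]]]; exists a, b, c; split=> //.
- by move=> i; have := congr1 (fun M : 'cV[R]_3 => M i 0) e1; rewrite !mxE.
- by move=> i; have := congr1 (fun M : 'cV[R]_3 => M i 0) e2; rewrite !mxE.
- by apply/colP => i; rewrite !mxE.
- by apply/colP => i; rewrite !mxE.
Qed.

Lemma in_cell_equiv C : in_cell C -> oriented_equiv (cell_mx (cell_coord C)) C.
Proof.
move=> [C0 m0]; have C0' : C 0 0 != 0 by rewrite gt_eqF.
have m0' : minor C != 0 by rewrite gt_eqF.
(* The first row of a [cell_mx] is (1, 0), which forces the first scale to be [C 0 0] and the shear
   to be [C 0 1]; comparing minors gives the other scale. *)
apply/oriented_equivP; exists (C 0 0), (minor C / C 0 0), (C 0 1).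
rewrite divr_gt0//; split=> // -[[|[|[|//]]] i3]; rewrite !mxE /= ?mxE /=.
- by rewrite mulr1; congr (C _ _); exact: val_inj.
- rewrite mulrCA divff// mulr1; congr (C _ _); exact: val_inj.
- rewrite mulrCA divff// mulr1; congr (C _ _); exact: val_inj.
- by rewrite mulr0 mulr1 add0r; congr (C _ _); exact: val_inj.
- rewrite mulr1 mulrA -mulrDl (_ : _ + _ = C 1 1 * C 0 0); last by rewrite /minor; lra.
  by rewrite mulfK//; congr (C _ _); exact: val_inj.
- have -> (X : R) : minor C / C 0 0 * (X / minor C) = X / C 0 0.
    by rewrite mulrC mulrA divfK.
  rewrite mulrA -mulrDl.
  rewrite subrK.
  by rewrite mulfK//; congr (C _ _); exact: val_inj.
Qed.

Lemma equiv_in_cell C C' : oriented_equiv C C' -> in_cell C ->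
  in_cell C' /\ cell_coord C' = cell_coord C.
Proof.
move=> /oriented_equivP[a [b [c [a0 b0 e0 e1]]]] [C0 m0].
have m' : minor C' = a * b * minor C by rewrite /minor !e0 !e1; lra.
split; first by rewrite /in_cell m' e0 !mulr_gt0.
apply: row3P; rewrite !mxE /= ?m' ?e0 ?e1.
- by rewrite -mulf_div divff ?mul1r ?gt_eqF.
- rewrite (_ : _ - _ = a * b * (C 2 1 * C 0 0 - C 0 1 * C 2 0)); last by lra.
  by rewrite -mulf_div divff ?mul1r ?gt_eqF// mulr_gt0.
- by rewrite -mulf_div divff ?mul1r ?gt_eqF.
Qed.

Lemma oriented_equiv_mul B C C' : oriented_equiv C C' -> oriented_equiv (B *m C) (B *m C').
Proof.
move=> [a [b [c [a0 b0 e1 e2]]]]; exists a, b, c; split=> //.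
  by rewrite !col_mulmx e1 scalemxAr.
by rewrite !col_mulmx e2 mulmxDr !scalemxAr.
Qed.

Lemma oflag_ofE (F : @frame R) : oflag_of (val F) = \pi_oflag F.
Proof. by rewrite /oflag_of valKd. Qed.

Lemma oflag_of_eqP C C' : \rank C = 2%N -> \rank C' = 2%N ->
  oflag_of C = oflag_of C' <-> oriented_equiv C C'.
Proof.
move=> rC rC'.
have inC : C \in [set F : 'M[R]_(3, 2) | \rank F = 2%N] by rewrite inE.
have inC' : C' \in [set F : 'M[R]_(3, 2) | \rank F = 2%N] by rewrite inE.
rewrite -[C]/(val (SigSub inC : @frame R)) -[C']/(val (SigSub inC' : @frame R)) !oflag_ofE.
split=> [/eqmodP/asboolP [a [b [c H]]]|[a [b [c H]]]].
  by exists a, b, c.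
by apply/eqmodP/asboolP; exists a, b, c.
Qed.

Lemma rank_unit_mul B C : B \in unitmx -> \rank (B *m C) = \rank C.
Proof.
move=> uB; rewrite -mxrank_tr trmx_mul mxrankMfree ?mxrank_tr//.
by rewrite row_free_unit unitmx_tr.
Qed.

Lemma act_oflag_of B C : B \in unitmx -> \rank C = 2%N ->
  act B (oflag_of C) = oflag_of (B *m C).
Proof.
move=> uB rC; have inC : C \in [set F : 'M[R]_(3, 2) | \rank F = 2%N] by rewrite inE.
rewrite -[C]/(val (SigSub inC : @frame R)) oflag_ofE (actE uB) -oflag_ofE.
by [].
Qed.

Lemma big_cellE B v : big_cell B v = oflag_of (B *m cell_mx v).
Proof. by []. Qed.

Lemma rank_cell B v : B \in unitmx -> \rank (B *m cell_mx v) = 2%N.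
Proof. by move=> uB; rewrite rank_unit_mul// in_cell_rank//; exact: cell_mx_in. Qed.

Lemma act_big_cell A B v : A \in unitmx -> B \in unitmx ->
  act A (big_cell B v) = big_cell (A *m B) v.
Proof. by move=> uA uB; rewrite !big_cellE act_oflag_of ?rank_cell// mulmxA. Qed.

Lemma oflag_of_cell B C : B \in unitmx -> in_cell C ->
  oflag_of (B *m C) = big_cell B (cell_coord C).
Proof.
move=> uB iC; rewrite big_cellE.
apply/esym/oflag_of_eqP; rewrite ?rank_cell// ?rank_unit_mul ?in_cell_rank//.
exact/oriented_equiv_mul/in_cell_equiv.
Qed.

(** Change of cells: coordinates transform by the rational map [cell_coord] of a matrix product,
    where the positivity conditions hold. Smoothness of local expressions is read off from this
    formula. *)
Lemma big_cell_eqP B B' v v' : B \in unitmx -> B' \in unitmx ->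
  big_cell B v = big_cell B' v' <->
  in_cell (invmx B' *m B *m cell_mx v) /\ cell_coord (invmx B' *m B *m cell_mx v) = v'.
Proof.
move=> uB uB'; split=> [|[iC <-]].
  move/oflag_of_eqP => -/(_ (rank_cell _ uB) (rank_cell _ uB')) /(oriented_equiv_mul (invmx B')).
  rewrite !mulmxA mulVmx// mul1mx => -[a [b [c [a0 b0 e1 e2]]]].
  have : oriented_equiv (cell_mx v') (invmx B' *m B *m cell_mx v).
    exists a^-1, b^-1, (- (b^-1 * c * a^-1)).
    split; rewrite ?invr_gt0// ?e1 ?e2 ?scalerDr ?scalerA ?mulVf ?gt_eqF ?scale1r//.
    by rewrite mulNr -!mulrA mulVf ?gt_eqF// mulr1 scaleNr addrK.
  by move=> /equiv_in_cell/(_ (cell_mx_in _)); rewrite cell_mxK.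
by rewrite -oflag_of_cell// !mulmxA mulmxV// mul1mx.
Qed.

Lemma big_cell_inj B : B \in unitmx -> injective (big_cell B).
Proof.
move=> uB v v' /big_cell_eqP -/(_ uB uB)[_].
by rewrite mulVmx// mul1mx cell_mxK.
Qed.

End Cells.

Arguments cvg_coord {R T F FF m n f l} i j.

Section CellTopology.
Context {R : realType}.
Local Notation R3 := 'rV[R]_3.
Implicit Types (B : 'M[R]_3).

Section Limits.
Context {T : Type} {F : set_system T} {FF : Filter F} (f : T -> 'M[R]_(3, 2)).
Context {C : 'M[R]_(3, 2)} (fC : f @ F --> C).

Lemma minor_cvg : minor (f x) @[x --> F] --> minor C.
Proof. by apply: cvgB; apply: cvgM; exact: cvg_coord. Qed.

Lemma near_in_cell : in_cell C -> \forall x \near F, in_cell (f x).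
Proof.
move=> [C0 m0].
have nC : \forall x \near F, 0 < f x 0 0 by exact: cvgr_gt (cvg_coord 0 0 fC) _ C0.
have nm : \forall x \near F, 0 < minor (f x) by exact: cvgr_gt minor_cvg _ m0.
by near=> x; split; near: x.
Unshelve. all: by end_near. Qed.

Lemma cell_coord_cvg : in_cell C -> cell_coord (f x) @[x --> F] --> cell_coord C.
Proof.
move=> [C0 m0]; have cc i j : f x i j @[x --> F] --> C i j by exact: cvg_coord.
have C00 : C 0 0 != 0 by rewrite gt_eqF.
have m00 : minor C != 0 by rewrite gt_eqF.
have c0 : (f x 0 0)^-1 @[x --> F] --> (C 0 0)^-1 by exact: cvgV.
have cm : (minor (f x))^-1 @[x --> F] --> (minor C)^-1 by exact: cvgV minor_cvg.
apply: cvg_mx => i j; under eq_fun do rewrite mxE; rewrite mxE.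
case: j => -[|[|[|//]]] j3 /=.
- exact: cvgM.
- by apply: cvgM => //; apply: cvgB; exact: cvgM.
- exact: cvgM.
Qed.

Lemma cell_mx_cvg (g : T -> R3) v : g @ F --> v -> cell_mx (g x) @[x --> F] --> cell_mx v.
Proof.
move=> gv; apply: cvg_mx => i j; under eq_fun do rewrite mxE; rewrite mxE.
have cc k : g x 0 k @[x --> F] --> v 0 k by exact: cvg_coord.
by case: (j == 0); case: i => -[|[|[|//]]] i3 /=; by [exact: cvg_cst|exact: cc].
Qed.

End Limits.

Lemma open_in_cell {T : topologicalType} (f : T -> 'M[R]_(3, 2)) (W : set R3) :
  continuous f -> open W -> open [set x | in_cell (f x) /\ W (cell_coord (f x))].
Proof.
move=> cf oW; rewrite openE => x [iC WC]; have WC' := open_nbhs_nbhs (conj oW WC).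
have n1 : \forall y \near x, in_cell (f y) by exact: near_in_cell (cf x) iC.
have n2 : \forall y \near x, W (cell_coord (f y)).
  by exact: cell_coord_cvg (cf x) iC _ WC'.
by apply: filterS2 n1 n2 => y.
Qed.

Lemma continuous_frame {T : topologicalType} (f : T -> @frame R) :
  continuous (fun x => val (f x) : 'M[R]_(3, 2)) -> continuous f.
Proof.
move=> /continuousP cf; apply/continuousP => A [D oD <-].
exact: cf.
Qed.

Lemma val_frame_continuous :
  continuous (fun F : @frame R => val F : 'M[R]_(3, 2)).
Proof. exact: initial_continuous. Qed.

Lemma mulmxl_continuous {T : topologicalType} n p q (B : 'M[R]_(n, p))
    (f : T -> 'M[R]_(p, q)) : continuous f -> continuous (fun x => B *m f x).
Proof. by move=> cf x; apply: mulmx_cvg (cf x); exact: cvg_cst. Qed.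

Lemma mul_frame_continuous B (uB : B \in unitmx) : continuous (mul_frame uB).
Proof.
by apply: continuous_frame; apply: mulmxl_continuous; exact: val_frame_continuous.
Qed.

Lemma act_continuous B : B \in unitmx -> continuous (act B).
Proof.
move=> uB; apply/quotient_continuous.
rewrite (_ : _ \o _ = \pi_oflag \o mul_frame uB).
  move=> F; apply: continuous_comp; first exact: mul_frame_continuous.
  exact: pi_continuous.
by apply/funext => F /=; rewrite (actE uB).
Qed.

Lemma cell_mx_continuous {T : topologicalType} (g : T -> R3) :
  continuous g -> continuous (fun x => cell_mx (g x)).
Proof. by move=> cg x; exact: cell_mx_cvg (cg x). Qed.

Lemma big_cell_continuous B : B \in unitmx -> continuous (big_cell B).
Proof.
move=> uB.
have inB v : B *m cell_mx v \in [set F : 'M[R]_(3, 2) | \rank F = 2%N].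
  by rewrite inE /=; exact: rank_cell.
have -> : big_cell B = (\pi_oflag : @frame R -> oflag) \o (fun v => SigSub (inB v)).
  by apply/funext => v /=; rewrite -oflag_ofE.
move=> v; apply: continuous_comp; last exact: pi_continuous.
apply: continuous_frame => /=; apply: mulmxl_continuous.
by apply: cell_mx_continuous => w; exact: cvg_id.
Qed.

(** Openness is tested on frames, the topology being a quotient; there the set is cut out by strict
    inequalities and by the continuous coordinates. *)
Lemma big_cell_open B (W : set R3) : B \in unitmx -> open W ->
  open (big_cell B @` W : set (@oflag R)).
Proof.
move=> uB oW; rewrite /open /= /quotient_open.
have -> : \pi_oflag @^-1` (big_cell B @` W) =
    (fun F : frame => invmx B *m val F) @^-1` [set C | in_cell C /\ W (cell_coord C)].
  apply/seteqP; split => F /=.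
    move=> [v Wv]; rewrite -oflag_ofE big_cellE.
    move/oflag_of_eqP => -/(_ (rank_cell _ uB) (set_mem (valP F))).
    move/(oriented_equiv_mul (invmx B)); rewrite mulmxA mulVmx// mul1mx.
    by move=> /equiv_in_cell/(_ (cell_mx_in _))[iC]; rewrite cell_mxK => ->.
  move=> [iC WC]; exists (cell_coord (invmx B *m val F)) => //.
  by rewrite -oflag_of_cell// mulmxA mulmxV// mul1mx oflag_ofE.
apply: open_in_cell => //; apply: mulmxl_continuous; exact: val_frame_continuous.
Qed.

End CellTopology.

(** * The group and its action on the quotient *)

Section BlockMatrices.
Context {R : realType}.
Implicit Types (A B : 'M[R]_2) (q : 'cV[R]_2).

Lemma j_mxM A B : j_mx (A *m B) = j_mx A *m j_mx B.
Proof.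
rewrite /j_mx [RHS](@mulmx_block _ 2 1 2 1 2 1).
by rewrite !mulmx0 !mul0mx !addr0 !add0r mulmx1.
Qed.

Lemma j_mx1 : j_mx (1%:M : 'M[R]_2) = 1%:M.
Proof. by rewrite /j_mx [RHS](@scalar_mx_block _ 2 1). Qed.

Lemma j_mx_inj : injective (@j_mx R).
Proof. by move=> A B /(@eq_block_mx _ 2 1 2 1)[]. Qed.

Lemma j_mx_in_plane12 A q : j_mx A *m in_plane12 q = in_plane12 (A *m q).
Proof.
rewrite /j_mx /in_plane12 [LHS](@mul_block_col _ 2 1 2 1 1).
by rewrite mulmx0 !mul0mx mulmx0 !addr0.
Qed.

Lemma in_plane12D q q' : in_plane12 (q + q') = in_plane12 q + in_plane12 q'.
Proof. by rewrite /in_plane12 (@add_col_mx _ 2 1) addr0. Qed.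

Lemma in_plane12Z (a : R) q : in_plane12 (a *: q) = a *: in_plane12 q.
Proof. by rewrite /in_plane12 (@scale_col_mx _ 2 1) scaler0. Qed.

Lemma in_plane12E q : [/\ in_plane12 q 0 0 = q 0 0, in_plane12 q 1 0 = q 1 0 &
  in_plane12 q 2 0 = 0].
Proof.
rewrite /in_plane12 !mxE; split.
- by case: splitP => k //= ek; congr (q _ _); exact: val_inj.
- by case: splitP => k //= ek; congr (q _ _); exact: val_inj.
- case: splitP => k; last by rewrite mxE.
  by case: k => -[|[|]].
Qed.

Lemma e3_col_mx : @e3 R = col_mx (0 : 'cV[R]_2) (1%:M : 'cV[R]_1).
Proof.
apply/colP => i; rewrite !mxE; case: splitP => k; rewrite !mxE -val_eqE /= => ->.
  by case: k => -[|[|]].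
by rewrite ord1.
Qed.

Lemma j_mx_e3 A : j_mx A *m e3 = e3.
Proof.
rewrite e3_col_mx /j_mx [LHS](@mul_block_col _ 2 1 2 1 1).
by rewrite mulmx0 !mul0mx mulmx1 addr0 add0r.
Qed.

Lemma det_j_mx A : \det (j_mx A) = \det A.
Proof. by rewrite /j_mx (@det_ublock _ 2 1) det1 mulr1. Qed.

Lemma j_mx_unit A : (j_mx A \in unitmx) = (A \in unitmx).
Proof. by rewrite !unitmxE det_j_mx. Qed.

Lemma g0_j_mx : @g0 R = j_mx (- 1%:M).
Proof.
apply/matrixP => a b; rewrite !mxE /=; case: splitP => a' ea; rewrite !mxE;
case: splitP => b' eb; rewrite !mxE -!val_eqE /= ea eb ?ord1 /=.
- by case: a' ea => -[|[|]] // ? _; rewrite -mulNrn.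
- by case: a' ea => -[|[|]] // ?.
- by case: b' eb => -[|[|]] // ?.
- by [].
Qed.

Lemma cV2P q q' : q 0 0 = q' 0 0 -> q 1 0 = q' 1 0 -> q = q'.
Proof.
move=> e0 e1; apply/colP => -[[|[|//]] i2].
- by rewrite (_ : Ordinal i2 = 0)//; exact: val_inj.
- by rewrite (_ : Ordinal i2 = 1)//; exact: val_inj.
Qed.

Lemma ord2P (i : 'I_2) : i = 0 \/ i = 1.
Proof. by case: i => -[|[|//]] i2; [left|right]; exact: val_inj. Qed.

Lemma mx22P A B : A 0 0 = B 0 0 -> A 0 1 = B 0 1 -> A 1 0 = B 1 0 -> A 1 1 = B 1 1 -> A = B.
Proof.
move=> e00 e01 e10 e11; apply/matrixP => i j.
by have [->|->] := ord2P i; have [->|->] := ord2P j.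
Qed.

Lemma sum2E (V : nmodType) (f : 'I_2 -> V) : \sum_i f i = f 0 + f 1.
Proof. by rewrite !big_ord_recl big_ord0 addr0; congr (_ + f _); exact: val_inj. Qed.

Lemma sum3E (V : nmodType) (f : 'I_3 -> V) : \sum_i f i = f 0 + f 1 + f 2.
Proof.
rewrite !big_ord_recl big_ord0 addr0 addrA.
by congr (_ + f _ + f _); exact: val_inj.
Qed.

Lemma det2E A : \det A = A 0 0 * A 1 1 - A 0 1 * A 1 0.
Proof.
rewrite (expand_det_row _ 0) sum2E /cofactor !det_mx11 !mxE /=.
rewrite expr0 expr1 mul1r mulN1r mulrN; congr (_ * A _ _ - _ * A _ _); exact: val_inj.
Qed.

End BlockMatrices.

Section GroupAction.
Context {R : realType} (d : nat) (h : 'I_d -> @SL2 R).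
Implicit Types (A B : 'M[R]_2) (q : 'cV[R]_2).

Lemma Gamma0_det A : Gamma0 h A -> \det A = 1.
Proof.
elim=> [|_ B [i _ <-] _ IH|_ B [i _ <-] _ IH]; first by rewrite det1.
- by rewrite det_mulmx IH mulr1; exact/eqP/(valP (h i)).
- by rewrite det_mulmx IH mulr1 det_inv (eqP (valP (h i))) invr1.
Qed.

Lemma Gamma0_unit A : Gamma0 h A -> A \in unitmx.
Proof. by move=> /Gamma0_det dA; rewrite unitmxE dA unitr1. Qed.

Lemma SL2_unit i : val (h i) \in unitmx.
Proof. by rewrite unitmxE (eqP (valP (h i))) unitr1. Qed.

Lemma j_mxV A : A \in unitmx -> j_mx (invmx A) = invmx (j_mx A).
Proof.
move=> uA; have uJ : j_mx A \in unitmx by rewrite j_mx_unit.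
by apply: (can_inj (mulKmx uJ)); rewrite -j_mxM !mulmxV// j_mx1.
Qed.

Lemma GammaP (B : 'M[R]_3) : Gamma h B <-> exists2 A, Gamma0 h A & B = j_mx A.
Proof.
split=> [|[A + ->]].
  elim=> [|_ {}B [i _ <-] _ [A GA ->]|_ {}B [i _ <-] _ [A GA ->]].
  - by exists 1%:M; [exact: generated1|rewrite j_mx1].
  - exists (val (h i) *m A); last by rewrite j_mxM.
    by apply: generatedM => //; exists i.
  - exists (invmx (val (h i)) *m A); last by rewrite j_mxM j_mxV// SL2_unit.
    by apply: generatedV => //; exists i.
elim=> [|_ A' [i _ <-] _ IH|_ A' [i _ <-] _ IH].
- by rewrite j_mx1; exact: generated1.
- by rewrite j_mxM; apply: generatedM => //; exists i.
- by rewrite j_mxM j_mxV ?SL2_unit//; apply: generatedV => //; exists i.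
Qed.

(** Since [g0] is the image of -1 under [j_mx], every question on the group reduces to 2x2 matrices
    up to sign. *)
Lemma hatGammaP (B : 'M[R]_3) : hatGamma h B <->
  exists A s, [/\ Gamma0 h A, s = 1 \/ s = -1 & B = j_mx (s *: A)].
Proof.
split=> [[/GammaP[A GA ->]|[_ /GammaP[A GA ->] <-]]|[A [s [GA [->|->] ->]]]].
- by exists A, 1; split; [|left|rewrite scale1r].
- by exists A, (-1); split; [|right|rewrite g0_j_mx -j_mxM mulNmx mul1mx scaleN1r].
- by left; apply/GammaP; exists A; rewrite ?scale1r.
- right; exists (j_mx A); first by apply/GammaP; exists A.
  by rewrite g0_j_mx -j_mxM mulNmx mul1mx scaleN1r.
Qed.

Lemma Gamma0M A B : Gamma0 h A -> Gamma0 h B -> Gamma0 h (A *m B).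
Proof.
move=> GA GB; have : Gamma h (j_mx A *m j_mx B).
  by apply: GammaM; apply/GammaP; [exists A|exists B].
by rewrite -j_mxM => /GammaP[C GC /j_mx_inj ->].
Qed.

Lemma Gamma0V A : Gamma0 h A -> Gamma0 h (invmx A).
Proof.
move=> GA; have : Gamma h (invmx (j_mx A)) by apply: GammaV; apply/GammaP; exists A.
by rewrite -j_mxV ?Gamma0_unit// => /GammaP[C GC /j_mx_inj ->].
Qed.

Lemma trace_oneZ (a : R) (S : 'M[R]_2) : a != 0 -> trace_one (a *: S) = trace_one S.
Proof.
move=> a0; rewrite /trace_one mxtraceZ scalerA; congr (_ *: S).
by rewrite invfM mulrAC mulVf// mul1r.
Qed.

Lemma mxtrace_mul_tr q : \tr (q *m q^T) = q 0 0 ^+ 2 + q 1 0 ^+ 2.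
Proof. by rewrite /mxtrace sum2E !mxE !big_ord1 !mxE -!expr2. Qed.

Lemma mxtrace_mul_tr_gt0 q : q != 0 -> 0 < \tr (q *m q^T).
Proof.
rewrite mxtrace_mul_tr => q0; rewrite lt_neqAle addr_ge0 ?sqr_ge0// andbT.
apply: contra q0 => /eqP/esym/eqP; rewrite paddr_eq0 ?sqr_ge0// !sqrf_eq0.
by move=> /andP[/eqP e0 /eqP e1]; apply/eqP/cV2P; rewrite mxE.
Qed.

Lemma mxtrace_mul_tr_mx A : \tr (A *m A^T) =
  A 0 0 ^+ 2 + A 0 1 ^+ 2 + A 1 0 ^+ 2 + A 1 1 ^+ 2.
Proof. by rewrite /mxtrace sum2E !mxE !sum2E !mxE -!expr2 addrA. Qed.

(** For determinant 1, the trace minus 2 equals (A00 - A11)^2 + (A01 + A10)^2. This keeps the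
    denominators of [trace_one] away from 0. *)
Lemma Gamma0_trace A : Gamma0 h A -> 2 <= \tr (A *m A^T).
Proof.
move=> /Gamma0_det; rewrite det2E mxtrace_mul_tr_mx => dA.
have := sqr_ge0 (A 0 0 - A 1 1); have := sqr_ge0 (A 0 1 + A 1 0).
rewrite sqrrB sqrrD; lra.
Qed.

(** The action S -> A S A^T is continuous and commutes with scalars, so multiplying the
    approximating sequence by [A] moves its limit by [A]. *)
Lemma limit_set_Gamma0 A q : Gamma0 h A -> limit_set h q -> limit_set h (A *m q).
Proof.
move=> GA [q0 [B [GB Bq]]]; have uA := Gamma0_unit GA.
have Aq0 : A *m q != 0 
  by apply: contra_neq q0 => Aq0; rewrite -(mulKmx uA q) Aq0 mulmx0.
split=> //; exists (fun n => A *m B n); split; first by move=> n; exact: Gamma0M.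
pose f (S : 'M[R]_2) := A *m S *m A^T.
have fB n : trace_one (A *m B n *m (A *m B n)^T) = trace_one (f (trace_one (B n *m (B n)^T))).
  rewrite {3}/trace_one /f -scalemxAr -scalemxAl trace_oneZ.
    by rewrite trmx_mul !mulmxA.
  by rewrite invr_neq0// gt_eqF// (lt_le_trans _ (Gamma0_trace (GB n))).
have fq : trace_one (A *m q *m (A *m q)^T) = trace_one (f (trace_one (q *m q^T))).
  rewrite {3}/trace_one /f -scalemxAr -scalemxAl trace_oneZ.
    by rewrite trmx_mul !mulmxA.
  by rewrite invr_neq0// gt_eqF// mxtrace_mul_tr_gt0.
rewrite fq; under eq_fun do rewrite fB.
have cf : f (trace_one (B n *m (B n)^T)) @[n --> \oo] --> f (trace_one (q *m q^T)).
  apply: mulmx_cvg; last exact: cvg_cst.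
  by apply: mulmx_cvg; [exact: cvg_cst|].
have ct : \tr (f (trace_one (B n *m (B n)^T))) @[n --> \oo] -->
    \tr (f (trace_one (q *m q^T))).
  apply: (cvg_big add_continuous) => // i _; exact: cvg_coord.
rewrite /trace_one; apply: cvgZ => //.
apply: cvgV => //; rewrite /f -scalemxAr -scalemxAl mxtraceZ.
rewrite mulf_neq0 ?invr_neq0// gt_eqF ?mxtrace_mul_tr_gt0//.
by rewrite -mulmxA -mulmxA -trmx_mul mulmxA mxtrace_mul_tr_gt0.
Qed.

Lemma limg_j_mx_line A q :
  (linfun (mulmx (j_mx A)) @: line (in_plane12 q))%VS = line (in_plane12 (A *m q)).
Proof. by rewrite /line limg_line lfunE /= j_mx_in_plane12. Qed.

Lemma limg_j_mx_plane A q : (linfun (mulmx (j_mx A)) @: plane (in_plane12 q) e3)%VS =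
  plane (in_plane12 (A *m q)) e3.
Proof.
by rewrite /plane limgD !limg_line !lfunE /= j_mx_e3 j_mx_in_plane12.
Qed.

Lemma line_in_plane12Z (a : R) q : a != 0 -> line (in_plane12 (a *: q)) = line (in_plane12 q).
Proof. by move=> a0; rewrite /line in_plane12Z line_scale. Qed.

Lemma plane_in_plane12Z (a : R) q : a != 0 ->
  plane (in_plane12 (a *: q)) e3 = plane (in_plane12 q) e3.
Proof. by move=> a0; rewrite /plane in_plane12Z line_scale. Qed.

Lemma hatOmega_act (B : 'M[R]_3) (x : oflag) : hatGamma h B -> hatOmega h x -> hatOmega h (act B x).
Proof.
move=> hB Ox [q Lq H]; apply: Ox.
have [A [s [GA s1 EB]]] := (hatGammaP _).1 (hatGammaV hB).
have uB := hatGamma_unit hB.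
have s0 : s != 0 by case: s1 => ->; rewrite ?oppr_eq0 oner_eq0.
have {}H : (val (forget (act B x))).1 = line (in_plane12 q) \/
           (val (forget (act B x))).2 = plane (in_plane12 q) e3 by exact: H.
rewrite (forget_act _ uB) /= in H.
have K (U : {vspace 'cV[R]_3}) :
    (linfun (mulmx (invmx B)) @: (linfun (mulmx B) @: U))%VS = U.
  rewrite -limg_comp -[RHS]lim1g; congr (_ @: _)%VS.
  by apply/lfunP => v; rewrite comp_lfunE !lfunE /= mulKmx.
exists (A *m q); first exact: limit_set_Gamma0.
case: H => [H|H]; [left|right]; rewrite /circle_alpha /circle_beta /= -[LHS]K H EB.
  by rewrite limg_j_mx_line -scalemxAl line_in_plane12Z.
by rewrite limg_j_mx_plane -scalemxAl plane_in_plane12Z.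
Qed.

End GroupAction.

Section Quotient.
Context {R : realType} (d : nat) (h : 'I_d -> @SL2 R).
Local Notation M := (compactification h).
Local Notation X := (set_type (hatOmega h)).
Local Notation proj := Defs.proj.

Lemma proj_eqP (x y : X) :
  proj h x = proj h y <-> exists2 A, hatGamma h A & val y = act A (val x).
Proof. by split=> [/eqmodP/asboolP|H] //; apply/eqmodP/asboolP. Qed.

(** For [A] in [hatGamma] the default value [x] is never taken, because the action preserves
    [hatOmega]. *)
Definition hat_act (A : 'M[R]_3) (x : X) : X := insubd x (act A (val x)).

Lemma val_hat_act A (x : X) : hatGamma h A -> val (hat_act A x) = act A (val x).
Proof.
by move=> GA; rewrite val_insubd mem_set//; apply: hatOmega_act => //; exact: set_mem (valP x).
Qed.

Lemma proj_hat_act A (x : X) : hatGamma h A -> proj h (hat_act A x) = proj h x.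
Proof. by move=> GA; apply/esym/proj_eqP; exists A; rewrite ?val_hat_act. Qed.

Lemma proj_surj (m : M) : exists x, m = proj h x.
Proof. by exists (repr m); rewrite /Defs.proj reprK. Qed.

Lemma val_hatOmega_continuous : continuous (fun x : X => val x : @oflag R).
Proof. exact: initial_continuous. Qed.

(** The preimage of this image is the union of the translates of [O], each open by continuity of the
    action. *)
Lemma proj_open (O : set (@oflag R)) : open O ->
  open [set m : M | exists2 x, O (val x) & m = proj h x].
Proof.
move=> oO; rewrite /open /= /quotient_open.
have -> : \pi_M @^-1` [set m : M | exists2 x, O (val x) & m = proj h x] =
    \bigcup_(A in hatGamma h) ((fun x : X => act A (val x)) @^-1` O).
  apply/seteqP; split=> x.
    by move=> [y Oy /proj_eqP[A GA e]]; exists A => //=; rewrite -e.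
  move=> [A GA /= OA]; exists (hat_act A x); first by rewrite val_hat_act.
  by rewrite proj_hat_act.
apply: bigcup_open => A GA.
have /continuousP : continuous (fun x : X => act A (val x)).
  move=> x; apply: continuous_comp; first exact: val_hatOmega_continuous.
  exact: act_continuous (hatGamma_unit GA) _.
exact.
Qed.

Lemma psi_j_mx t : @psi R t = j_mx (expR t *: 1%:M).
Proof.
apply/matrixP => a b; rewrite !mxE /=; case: splitP => a' ea; rewrite !mxE;
case: splitP => b' eb; rewrite !mxE -!val_eqE /= ea eb ?ord1 /=.
- by case: a' ea => -[|[|]] // ? _; rewrite mulr_natr.
- by case: a' ea => -[|[|]] // ?.
- by case: b' eb => -[|[|]] // ?.
- by [].
Qed.

Lemma psi0 : @psi R 0 = 1%:M.
Proof. by rewrite psi_j_mx expR0 scale1r j_mx1. Qed.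

Lemma psiD s t : @psi R (s + t) = psi s *m psi t.
Proof. by rewrite !psi_j_mx -j_mxM expRD -scalemxAl mul1mx scalerA. Qed.

Lemma psi_hatGamma t A : hatGamma h A -> A *m psi t = psi t *m A.
Proof.
move=> /hatGammaP[B [s [_ _ ->]]]; rewrite psi_j_mx -!j_mxM.
by rewrite -scalemxAl -scalemxAr mul1mx mulmx1.
Qed.

Definition psi_hat t (x : X) : X := SigSub (psi_hatOmega t x).

(** [psi] is scalar on [e1,e2], hence commutes with the group: the flow can be computed on any lift,
    not only on the chosen representative. *)
Lemma flow_proj t (x : X) : flow h t (proj h x) = proj h (psi_hat (t / 2) x).
Proof.
have /proj_eqP[A GA e] : proj h x = proj h (repr (proj h x)) by rewrite /Defs.proj reprK.
apply/esym/proj_eqP; exists A => //=.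
have uA := hatGamma_unit GA.
by rewrite e -!actM ?psi_unit// (psi_hatGamma _ GA).
Qed.

Lemma psi_hat_id (x : X) : psi_hat 0 x = x.
Proof. by apply: val_inj; rewrite /= psi0 act1. Qed.

Lemma psi_hatD s t (x : X) : psi_hat (s + t) x = psi_hat s (psi_hat t x).
Proof. by apply: val_inj; rewrite /= psiD actM ?psi_unit. Qed.

Lemma flow0 : flow h 0 = id.
Proof.
by apply/funext => m; have [x ->] := proj_surj m; rewrite flow_proj mul0r psi_hat_id.
Qed.

Lemma flowD s t : flow h (s + t) = flow h s \o flow h t.
Proof.
apply/funext => m; have [x ->] := proj_surj m.
by rewrite /= !flow_proj mulrDl psi_hatD.
Qed.

Lemma flowNK t : cancel (flow h t) (flow h (- t)).
Proof. by move=> m; rewrite -[LHS]/((_ \o _) m) -flowD addNr flow0. Qed.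

Lemma flowKN t : cancel (flow h (- t)) (flow h t).
Proof. by move=> m; rewrite -{1}[t]opprK flowNK. Qed.

Lemma iter_flow n t : iter n (flow h t) = flow h (n%:R * t).
Proof.
elim: n => [|n IH]; first by rewrite mul0r flow0.
by apply/funext => m; rewrite iterS IH mulrSr mulrDl mul1r addrC flowD.
Qed.

End Quotient.

(** * Smoothness of the flow in charts *)

Section ElementaryMatrices.
Context {R : realType} {V : normedModType R} (U : set V).
Local Notation R3 := 'rV[R]_3.

Lemma elementary_sum n (f : 'I_n -> V -> R) :
  (forall i, elementary U (f i)) -> elementary U (fun x => \sum_i f i x).
Proof.
elim: n f => [|n IH] f ef.
  by under eq_fun do rewrite big_ord0; exact: elementary_cst.
under eq_fun do rewrite big_ord_recl.
by apply: (elementaryD (ef ord0)); exact: IH.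
Qed.

Lemma elementary_mulmx m n p (f : V -> 'M[R]_(m, n)) (g : V -> 'M[R]_(n, p)) :
  (forall i j, elementary U (fun x => f x i j)) ->
  (forall i j, elementary U (fun x => g x i j)) ->
  forall i j, elementary U (fun x => (f x *m g x) i j).
Proof.
move=> ef eg i j; under eq_fun do rewrite mxE.
by apply: elementary_sum => k; exact: elementaryM.
Qed.

Lemma elementary_cell_mx (z : V -> R3) : (forall i, elementary U (fun x => z x 0 i)) ->
  forall i j, elementary U (fun x => cell_mx (z x) i j).
Proof.
move=> ez i j; under eq_fun do rewrite mxE.
by case: (j == 0); case: i => -[|[|[|//]]] i3 /=;
  by [exact: (elementary_cst _ 1)|exact: (elementary_cst _ 0)|exact: ez].
Qed.

Lemma elementary_psi (t : V -> R) : elementary U t ->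
  forall i j, elementary U (fun x => psi (t x) i j).
Proof.
move=> et i j.
have -> : (fun x => psi (t x) i j) = (expR \o t) \* cst (diag3 1 1 0 i j) \+ cst (diag3 0 0 1 i j).
  apply/funext => x; rewrite /= !mxE.
  by case: i => -[|[|[|//]]] i3 /=; rewrite ?mul0rn ?addr0 ?mulr0 ?add0r// mulr_natr.
apply: elementaryD; last exact: elementary_cst.
by apply: elementaryM; [exact: elementary_exp|exact: elementary_cst].
Qed.

Lemma elementary_cell_coord (C : V -> 'M[R]_(3, 2)) :
  (forall i j, elementary U (fun x => C x i j)) -> (forall x, U x -> in_cell (C x)) ->
  forall i, elementary U (fun x => cell_coord (C x) 0 i).
Proof.
move=> eC iC i.
have eV (f : V -> R) : elementary U f -> (forall x, U x -> 0 < f x) ->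
    elementary U (fun x => (f x)^-1).
  by move=> ef f0; apply: elementaryV => // x /f0 /lt0r_neq0.
have e0 : elementary U (fun x => (C x 0 0)^-1) by apply: eV => // x /iC[].
have eN (f : V -> R) : elementary U f -> elementary U (fun x => - f x).
  move=> ef; rewrite (_ : (fun x => - f x) = cst (-1) \* f).
    by apply: elementaryM => //; exact: elementary_cst.
  by apply/funext => x /=; rewrite mulN1r.
have em : elementary U (fun x => (minor (C x))^-1).
  apply: eV => [|x /iC[]//]; rewrite /minor.
  by apply: elementaryD; [exact: elementaryM|apply: eN; exact: elementaryM].
under eq_fun do rewrite mxE.
case: i => -[|[|[|//]]] i3 /=.
- exact: elementaryM.
- apply: elementaryM => //; apply: elementaryD; first exact: elementaryM.
  by apply: eN; exact: elementaryM.
- exact: elementaryM.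
Qed.

End ElementaryMatrices.

Section Charts.
Context {R : realType} (d : nat) (h : 'I_d -> @SL2 R).
Local Notation M := (compactification h).
Local Notation X := (set_type (hatOmega h)).
Local Notation proj := Defs.proj.
Local Notation R3 := 'rV[R]_3.
Implicit Types (c : @chart R M).

Lemma chart_inj c v w : atlas h c -> c.1 v -> c.1 w -> c.2 v = c.2 w -> v = w.
Proof. by move=> [_ ci _] cv cw; apply: ci; exact/mem_set. Qed.

Lemma chart_nbhs c v : atlas h c -> c.1 v -> nbhs v c.1.
Proof. by move=> [oc _ _] cv; exact: open_nbhs_nbhs. Qed.

(** The parameter space [V] has two uses: R^3 with constant [t] for a single map of the flow, and R
    x R^3 for joint smoothness in time and space. *)
Lemma flow_expr {V : normedModType R} (t : V -> R) (z : V -> R3) (a : V) c c' y :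
  elementary setT t -> (forall i, elementary setT (fun x => z x 0 i)) ->
  at_chart (atlas h) c (z a) -> at_chart (atlas h) c' y ->
  flow h (t a) (c.2 (z a)) = c'.2 y ->
  exists F : V -> R3, [/\ F a = y, smooth_near F a &
    \forall x \near a, [/\ c.1 (z x), c'.1 (F x) & c'.2 (F x) = flow h (t x) (c.2 (z x))]].
Proof.
move=> et ez [Ac cz] [Ac' c'y].
have [_ _ [B uB cB]] := Ac; have [oc' _ [B' uB' cB']] := Ac'.
have [x1 ex1 ->] := cB _ cz; have [y1 ey1 ->] := cB' _ c'y.
rewrite flow_proj => /proj_eqP[A GA]; rewrite ey1 /= ex1.
have uA := hatGamma_unit GA.
rewrite -actM ?psi_unit// act_big_cell ?unitmx_mul ?psi_unit ?uA// => Ey.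
(* The group element [A] relating the two lifts at [a] is kept for all nearby parameters, so that
   one rational formula describes the flow there. *)
pose P x := invmx B' *m (A *m psi (t x / 2) *m B) *m cell_mx (z x).
have [iP Py] : in_cell (P a) /\ cell_coord (P a) = y.
  by apply/big_cell_eqP => //; rewrite ?unitmx_mul ?psi_unit ?uA.
have eP i j : elementary setT (fun x => P x i j).
  apply: elementary_mulmx; last exact: elementary_cell_mx.
  apply: elementary_mulmx; first by move=> *; exact: elementary_cst.
  apply: elementary_mulmx; last by move=> *; exact: elementary_cst.
  apply: elementary_mulmx; first by move=> *; exact: elementary_cst.
  by apply: elementary_psi; apply: elementaryM => //; exact: elementary_cst.
have cP : continuous P.
  move=> x; apply: continuous_mx => i j; apply: differentiable_continuous.
  exact: elementary_differentiable (eP i j) _.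
have cz' : continuous z.
  move=> x; apply: continuous_mx => i j; apply: differentiable_continuous.
  by rewrite ord1; exact: elementary_differentiable (ez j) _.
pose U := [set x | in_cell (P x) /\ c'.1 (cell_coord (P x))].
have oU : open U by exact: open_in_cell.
have Ua : U a by split=> //; rewrite Py.
exists (fun x => cell_coord (P x)); split=> //.
  exists U; split=> // k; apply: Cr_coord => // i.
  apply: elementary_cell_coord => [i' j|x [] //].
  (* A function elementary on the whole space is elementary on every subset. *)
  suff e0 f : elementary setT f -> elementary U f by exact: e0.
  elim=> {f}; [exact: elementary_affine|by move=> *; exact: elementaryD|
    by move=> *; exact: elementaryM| |by move=> *; exact: elementary_exp].
  by move=> f f0 _ ef; apply: elementaryV => // x _; exact: f0.
have nU : nbhs a U by exact: open_nbhs_nbhs.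
have ncz : \forall x \near a, c.1 (z x) by exact: cz' (chart_nbhs Ac cz).
apply: filterS2 nU ncz => x [iPx cPx] czx; split=> //.
have [x2 ex2 ->] := cB _ czx; have [y2 ey2 ->] := cB' _ cPx.
rewrite flow_proj; apply/esym/proj_eqP; exists A => //=.
rewrite ey2 ex2 -actM ?psi_unit// act_big_cell ?unitmx_mul ?psi_unit ?uA//.
rewrite -oflag_of_cell// /P !mulmxA mulmxV// mul1mx.
by [].
Qed.

End Charts.

Section Coordinates.
Context {R : realType}.
Local Notation R3 := 'rV[R]_3.

Lemma elementary_linear {V : normedModType R} (U : set V) (f : V -> R) :
  linear f -> continuous f -> elementary U f.
Proof.
move=> lf cf; pose g : {linear V -> R} := HB.pack f (GRing.isLinear.Build _ _ _ _ f lf).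
have dg x : differentiable g x by exact: linear_differentiable.
apply: elementary_affine => [x|v]; first exact: (dg x).
by exists (g v) => x; rewrite [LHS](deriveE v (dg x)) diff_lin.
Qed.

Lemma elementary_coord1 (i : 'I_3) : elementary setT (fun z : R3 => z 0 i).
Proof.
apply: elementary_linear; last exact: coord_continuous.
by move=> a x y; rewrite !mxE.
Qed.

Lemma elementary_fst : elementary setT (fun p : R * R3 => p.1).
Proof. by apply: elementary_linear => // p; exact: cvg_fst. Qed.

Lemma elementary_snd (i : 'I_3) : elementary setT (fun p : R * R3 => p.2 0 i).
Proof.
apply: elementary_linear; first by move=> a x y; rewrite !mxE.
move=> p; apply: (@continuous_comp _ _ _ snd (fun z : R3 => z 0 i)).
  exact: cvg_snd.
exact: coord_continuous.
Qed.

End Coordinates.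

Section FlowSmooth.
Context {R : realType} (d : nat) (h : 'I_d -> @SL2 R).
Local Notation M := (compactification h).
Local Notation X := (set_type (hatOmega h)).
Local Notation proj := Defs.proj.
Local Notation R3 := 'rV[R]_3.
Implicit Types (c : @chart R M).

Lemma flow_local_expr t c x c' y :
  at_chart (atlas h) c x -> at_chart (atlas h) c' y -> flow h t (c.2 x) = c'.2 y ->
  exists2 F, local_expr (atlas h) (flow h t) c x c' y F & smooth_near F x.
Proof.
move=> cx c'y e.
have [F [Fx sF nF]] := flow_expr (elementary_cst setT t) elementary_coord1 cx c'y e.
exists F => //; split=> //; apply: filterS nF => z [_].
by split.
Qed.

Lemma smooth_map_flow t : smooth_map (atlas h) (flow h t).
Proof. by move=> c x c' y; exact: flow_local_expr. Qed.

Lemma diffeomorphism_flow t : diffeomorphism (atlas h) (flow h t).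
Proof.
exists (flow h (- t)); split; [exact: flowNK|exact: flowKN|exact: smooth_map_flow|].
exact: smooth_map_flow.
Qed.

Lemma smooth_flow_flow : smooth_flow (atlas h) (flow h).
Proof.
split; [exact: flow0|exact: flowD|move=> t c x c' y cx c'y e].
have [F [Fx sF nF]] := flow_expr (a := (t, x)) elementary_fst elementary_snd cx c'y e.
exists F; split=> //; apply: filterS nF => z [_].
by split.
Qed.

Lemma smooth_near_differentiable (F : R3 -> R3) x : smooth_near F x -> differentiable F x.
Proof. by move=> [U [_ Ux /(_ 1%N)[dF _]]]; exact: dF. Qed.

Lemma local_expr_chart f c x c' y F : local_expr (atlas h) f c x c' y F ->
  c'.2 y = f (c.2 x).
Proof. by move=> [_ _ <-] /nbhs_singleton[]. Qed.

(** Local expressions of the flow at times t and -t are inverse to each other near [x] because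
    charts are injective; the chain rule does the rest. Thanks to this, the equivalences in
    [preserves] need proof in one direction only. *)
Lemma tangent_map_inv t c x v c' y w :
  tangent_map (atlas h) (flow h t) c x v c' y w ->
  tangent_map (atlas h) (flow h (- t)) c' y w c x v.
Proof.
move=> [F [lF dF <-]]; have [cx c'y Fx nF] := lF.
subst y.
have [|G lG sG] := @flow_local_expr (- t) c' (F x) c x c'y cx.
  by rewrite (local_expr_chart lF) flowNK.
have dG := smooth_near_differentiable sG.
exists G; split=> //.
have GF : \forall z \near x, (G \o F) z = z.
  have [_ _ Gy nG] := lG.
  have cF : {for x, continuous F} by exact: differentiable_continuous.
  have : \forall z \near x, c.1 (G (F z)) /\ c.2 (G (F z)) = flow h (- t) (c'.2 (F z)).
    exact: (cF _ nG).
  apply: filterS3 nF (chart_nbhs cx.1 cx.2) => z [_ eF] cz [cG eG].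
  by apply: (chart_inj cx.1) => //; rewrite eG eF flowNK.
have dGF : differentiable (G \o F) x by exact: differentiable_comp.
rewrite -[LHS]/(('d G (F x) \o 'd F x) v) -diff_comp//.
by rewrite -deriveE// (near_eq_derive v GF) derive_id.
Qed.

End FlowSmooth.

(** * The path structure in affine charts *)

Section FlagsOfCells.
Context {R : realType}.
Local Notation R3 := 'rV[R]_3.
Implicit Types (B : 'M[R]_3) (C : 'M[R]_(3, 2)).

Lemma plane_equiv C C' : oriented_equiv C C' ->
  line (col 0 C') = line (col 0 C) /\
  subsetv (plane (col 0 C') (col 1 C')) (plane (col 0 C) (col 1 C)).
Proof.
move=> [a [b [c [a0 b0 e1 e2]]]].
have l1 : line (col 0 C') = line (col 0 C) by rewrite /line e1 line_scale// gt_eqF.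
split=> //; rewrite /plane -!/(line _) l1 subv_add addvSl /= /line -memvE e2.
by rewrite memvD ?memvZ// ?(subvP (addvSr _ _) _ (memv_line _)) ?(subvP (addvSl _ _) _ (memv_line _)).
Qed.

Lemma oriented_equiv_sym C C' : oriented_equiv C C' -> oriented_equiv C' C.
Proof.
move=> [a [b [c [a0 b0 e1 e2]]]].
exists a^-1, b^-1, (- (b^-1 * c * a^-1)).
split; rewrite ?invr_gt0// ?e1 ?e2 ?scalerDr ?scalerA ?mulVf ?gt_eqF ?scale1r//.
by rewrite mulNr -!mulrA mulVf ?gt_eqF// mulr1 scaleNr addrK.
Qed.

Lemma val_forget C : \rank C = 2%N ->
  val (forget (oflag_of C)) = (line (col 0 C), plane (col 0 C) (col 1 C)).
Proof.
move=> rC; have := set_mem (valP (repr (oflag_of C))).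
rewrite /forget; set F := repr _ => /= rF.
have eq : oriented_equiv (val F) C.
  by apply/oflag_of_eqP => //; rewrite oflag_ofE reprK.
have [l1 p1] := plane_equiv eq; have [_ p2] := plane_equiv (oriented_equiv_sym eq).
congr (_, _); first exact/esym.
by apply/subv_anti/andP; split.
Qed.

Definition alpha_leaf (v w : R3) : Prop := v 0 0 = w 0 0 /\ v 0 2 = w 0 2.

(** In the affine plane of the points (x, z), the line of RP^2 carried by the flag has slope y and
    intercept z - x y. *)
Definition beta_leaf (v w : R3) : Prop :=
  v 0 1 = w 0 1 /\ v 0 2 - v 0 0 * v 0 1 = w 0 2 - w 0 0 * w 0 1.

Lemma big_cell_alpha B v w : B \in unitmx ->
  (val (forget (big_cell B v))).1 = (val (forget (big_cell B w))).1 <-> alpha_leaf v w.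
Proof.
move=> uB; rewrite !big_cellE !val_forget ?rank_cell//= !col_mulmx; split.
  move=> e; have : B *m col 0 (cell_mx w) \in line (B *m col 0 (cell_mx v)).
    by rewrite e memv_line.
  move=> /vlineP[k]; rewrite scalemxAr => /(can_inj (mulKmx uB)) ek.
  have E i := congr1 (fun M : 'cV[R]_3 => M i 0) ek.
  have := E 0; have := E 1; have := E 2.
  rewrite !mxE /= mulr1 => e2 e1 e0.
  by rewrite /alpha_leaf e1 e2 -e0 !mul1r.
move=> [e0 e2]; congr (line (B *m _)).
by apply/colP => i; rewrite !mxE /= e0 e2.
Qed.

Lemma big_cell_beta B v w : B \in unitmx ->
  (val (forget (big_cell B v))).2 = (val (forget (big_cell B w))).2 <-> beta_leaf v w.
Proof.
move=> uB; rewrite !big_cellE !val_forget ?rank_cell//= !col_mulmx; split.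
  move=> e.
  have H (k : 'I_2) : B *m col k (cell_mx w) \in
      plane (B *m col 0 (cell_mx v)) (B *m col 1 (cell_mx v)).
    rewrite e; have [->|->] := ord2P k.
      exact: subvP (addvSl _ _) _ (memv_line _).
    exact: subvP (addvSr _ _) _ (memv_line _).
  have {}H k : exists a b, col k (cell_mx w) = a *: col 0 (cell_mx v) + b *: col 1 (cell_mx v).
    have /memv_addP[_ /vlineP[a ->] [_ /vlineP[b ->]]] := H k.
    by rewrite !scalemxAr -mulmxDr => /(can_inj (mulKmx uB)) ->; exists a, b.
  have [a [b E0]] := H 0; have [a' [b' E1]] := H 1.
  have {}E0 i := congr1 (fun M : 'cV[R]_3 => M i 0) E0.
  have {}E1 i := congr1 (fun M : 'cV[R]_3 => M i 0) E1.
  have := E0 0; have := E0 1; have := E0 2; have := E1 0; have := E1 1; have := E1 2.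
  rewrite !mxE /= => f2 f1 f0 g2 g1 g0; rewrite /beta_leaf.
  have ea' : a' = 0 by lra.
  have ea : a = 1 by lra.
  subst a a'; have eb' : b' = 1 by lra.
  by subst b'; split; nra.
move=> [e1 e2].
have -> : col 1 (cell_mx v) = col 1 (cell_mx w) by apply/colP => i; rewrite !mxE /= e1.
have -> : col 0 (cell_mx v) = col 0 (cell_mx w) + (v 0 0 - w 0 0) *: col 1 (cell_mx w).
  apply/colP => -[[|[|[|//]]] i3]; rewrite !mxE /= ?mulr0 ?addr0//; first by lra.
  by rewrite -e1; move: e2; rewrite -e1; lra.
rewrite /plane mulmxDr -scalemxAr.
set p := B *m col 0 _; set q := B *m col 1 _.
apply/subv_anti; rewrite !subv_add !addvSr !andbT -!memvE; apply/andP; split.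
  by rewrite memvD ?memvZ// ?(subvP (addvSr _ _) _ (memv_line _)) ?(subvP (addvSl _ _) _ (memv_line _)).
rewrite -[X in X \in _](addrK ((v 0 0 - w 0 0) *: q)).
by rewrite memvB ?memvZ// ?(subvP (addvSr _ _) _ (memv_line _)) ?(subvP (addvSl _ _) _ (memv_line _)).
Qed.

End FlagsOfCells.

Section CircleFields.
Context {R : realType} (d : nat) (h : 'I_d -> @SL2 R).
Local Notation M := (compactification h).
Local Notation X := (set_type (hatOmega h)).
Local Notation proj := Defs.proj.
Local Notation R3 := 'rV[R]_3.
Implicit Types (c : @chart R M).

Lemma continuous_hatOmega {T : topologicalType} (w : T -> X) (s : T) :
  {for s, continuous (fun r => val (w r) : @oflag R)} -> {for s, continuous w}.
Proof.
move=> cw A; rewrite nbhsE => -[D [oD Ds] DA]; case: oD => V oV ED; subst D.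
have : nbhs (val (w s)) V by exact: open_nbhs_nbhs.
move=> /cw nV; have : \forall r \near s, V (val (w r)) by exact: nV.
by apply: filterS => r Vr; exact: DA.
Qed.

(** Undoing the group element that matches the lifts at 0 brings [w] into the open image of the
    chart domain; injectivity of the chart then identifies it with the chart's own lift. The group
    element is thus constant near 0. *)
Lemma curve_lift c (B : 'M[R]_3) (u : R -> R3) (w : R -> X) :
  atlas h c -> B \in unitmx ->
  (forall v, c.1 v -> exists2 x, val x = big_cell B v & c.2 v = proj h x) ->
  c.1 (u 0) -> {for 0, continuous u} -> {for 0, continuous w} ->
  (\forall s \near 0, proj h (w s) = c.2 (u s)) ->
  exists2 A, hatGamma h A & \forall s \near 0, val (w s) = act A (big_cell B (u s)).
Proof.
move=> Ac uB cB cu0 uc wc pw; have [oc _ _] := Ac.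
have [x0 ex0 ce0] := cB _ cu0.
have /proj_eqP[A GA eA] : proj h x0 = proj h (w 0) by rewrite -ce0 (nbhs_singleton pw).
exists A => //; have uA := hatGamma_unit GA; have GV := hatGammaV GA.
have uV := hatGamma_unit GV.
pose w' s := act (invmx A) (val (w s)).
have cw' : {for 0, continuous w'}.
  apply: (@continuous_comp _ _ _ (fun s => val (w s) : @oflag R) (act (invmx A))).
    exact: (@continuous_comp _ _ _ w (fun x : X => val x : @oflag R)) wc
      (@val_hatOmega_continuous _ _ _ _).
  exact: act_continuous.
have w'0 : w' 0 = big_cell B (u 0).
  by rewrite /w' eA -actM// mulVmx// act1 ex0.
have nw : \forall s \near 0, (big_cell B @` c.1) (w' s).
  by apply: cw'; apply: open_nbhs_nbhs; split; [exact: big_cell_open|rewrite w'0; exists (u 0)].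
have nu : \forall s \near 0, c.1 (u s) by apply: uc; exact: open_nbhs_nbhs.
apply: filterS3 nw nu pw => s [v cv ev] cus pws.
have [xv exv cev] := cB _ cv.
have vu : v = u s.
  apply: (chart_inj Ac) => //; rewrite cev -pws; apply/proj_eqP; exists A => //.
  by rewrite exv ev /w' -actM// mulmxV// act1.
by rewrite -vu ev /w' -actM// mulmxV// act1.
Qed.

Definition equivariant (Cf : @flag R -> set (@flag R)) : Prop :=
  forall (A : 'M[R]_3) (y z : @oflag R), A \in unitmx ->
    Cf (forget y) (forget z) <-> Cf (forget (act A y)) (forget (act A z)).

Lemma equivariant_alpha : equivariant (fun x => circle_alpha (val x).1).
Proof.
move=> A y z uA.
change ((val (forget z)).1 = (val (forget y)).1 <->
  (val (forget (act A z))).1 = (val (forget (act A y))).1).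
by rewrite !(forget_act _ uA); split=> [/= -> //|]; exact: limg_mul_inj.
Qed.

Lemma equivariant_beta : equivariant (fun x => circle_beta (val x).2).
Proof.
move=> A y z uA.
change ((val (forget z)).2 = (val (forget y)).2 <->
  (val (forget (act A z))).2 = (val (forget (act A y))).2).
by rewrite !(forget_act _ uA); split=> [/= -> //|]; exact: limg_mul_inj.
Qed.

Lemma big_cell_alphaC (B : 'M[R]_3) (y z : R3) : B \in unitmx ->
  circle_alpha (val (forget (big_cell B y))).1 (forget (big_cell B z)) <-> alpha_leaf y z.
Proof. by move=> uB; rewrite -(big_cell_alpha y z uB); split=> /esym. Qed.

Lemma big_cell_betaC (B : 'M[R]_3) (y z : R3) : B \in unitmx ->
  circle_beta (val (forget (big_cell B y))).2 (forget (big_cell B z)) <-> beta_leaf y z.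
Proof. by move=> uB; rewrite -(big_cell_beta y z uB); split=> /esym. Qed.

Lemma is_derive_continuous (u : R -> R3) (v : R3) :
  is_derive (0 : R) 1 u v -> {for 0, continuous u}.
Proof. by move=> [du _]; apply: differentiable_continuous; apply/derivable1_diffP. Qed.

(** Lifts disappear from the description: any of them is, near 0, a translate of the chart's own
    lift, and the circle condition is equivariant. Conversely a curve in the chart has that lift. *)
Lemma circle_fieldP (Cf : @flag R -> set (@flag R)) (leaf : R3 -> R3 -> Prop) c x v :
  equivariant Cf ->
  (forall (B : 'M[R]_3) (y z : R3), B \in unitmx ->
    Cf (forget (big_cell B y)) (forget (big_cell B z)) <-> leaf y z) ->
  at_chart (atlas h) c x ->
  circle_field Cf c x v <-> exists u : R -> R3,
    [/\ u 0 = x, is_derive (0 : R) 1 u v & \forall s \near (0 : R), leaf x (u s)].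
Proof.
move=> eqC leafC [Ac cx]; have [oc _ [B uB cB]] := Ac; split.
  move=> [u [w [u0 du cw pw]]]; exists u; split=> //.
  have cu0 : c.1 (u 0) by rewrite u0.
  have [|A GA wu] := curve_lift Ac uB cB cu0 (is_derive_continuous du) cw.
    by apply: filterS pw => s [].
  have uA := hatGamma_unit GA; have w0 := nbhs_singleton wu.
  apply: filterS2 pw wu => s [_ Cs] ws.
  apply/(leafC B) => //; apply/(eqC _ _ _ uA).
  by move: Cs; rewrite w0 ws u0.
move=> [u [u0 du lu]].
have [x0 _ _] := cB _ cx.
have /choice[L LP] : forall y : R3, exists z : X, c.1 y -> val z = big_cell B y /\ c.2 y = proj h z.
  move=> y; have [/cB[z e1 e2]|cy] := pselect (c.1 y); first by exists z.
  by exists x0.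
have cu := is_derive_continuous du.
have nu : \forall s \near (0 : R), c.1 (u s) by apply: cu; rewrite u0; exact: chart_nbhs.
exists u, (L \o u); split=> //.
  apply: continuous_hatOmega; rewrite /= /prop_for /continuous_at.
  have [-> _] := LP _ (nbhs_singleton nu).
  have cb : (big_cell B \o u) s @[s --> (0 : R)] --> big_cell B (u 0).
    by apply: (@continuous_comp _ _ _ u (big_cell B)) => //; exact: big_cell_continuous.
  apply: cvg_trans cb; apply: near_eq_cvg.
  by apply: filterS nu => s /LP[].
have [e3' _] := LP _ (nbhs_singleton nu).
apply: filterS2 nu lu => s cus lus.
have [e1 e2] := LP _ cus; split=> //=.
by rewrite e1 e3'; apply/leafC => //; rewrite u0.
Qed.

Lemma circle_field_flow (Cf : @flag R -> set (@flag R)) t c x v c' y w :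
  equivariant Cf -> tangent_map (atlas h) (flow h t) c x v c' y w ->
  circle_field Cf c x v -> circle_field Cf c' y w.
Proof.
move=> eqC [F [[cx c'y Fx nF] dF <-]] [u [l [u0 du cl pl]]].
have cu := is_derive_continuous du.
exists (F \o u), (fun s => psi_hat (t / 2) (l s)); split.
- by rewrite /= u0.
- have [/derivable1_diffP du' Du] := du.
  have dFu : differentiable (F \o u) 0 by apply: differentiable_comp => //; rewrite u0.
  apply: DeriveDef; first exact: diff_derivable.
  have eu : 'd u 0 (1 : R) = v by rewrite -Du deriveE.
  by rewrite deriveE// diff_comp// ?u0//= eu.
- apply: continuous_hatOmega.
  apply: (@continuous_comp _ _ _ (fun s => val (l s) : @oflag R) (act (psi (t / 2)))).
    exact: (@continuous_comp _ _ _ l (fun x : X => val x : @oflag R)) cl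
      (@val_hatOmega_continuous _ _ _ _).
  exact: act_continuous (psi_unit _) _.
- have nu : \forall s \near (0 : R), c'.1 (F (u s)) /\ c'.2 (F (u s)) = flow h t (c.2 (u s)).
    by move: nF; rewrite -u0 => nF; exact: (cu _ nF).
  apply: filterS2 pl nu => s [ps Cs] [_ ->]; split.
    by rewrite -ps flow_proj.
  exact: (eqC (psi (t / 2)) (val (l 0)) (val (l s)) (psi_unit _)).1.
Qed.

Lemma circle_field_preserved (Cf : @flag R -> set (@flag R)) t :
  equivariant Cf -> preserves (atlas h) (flow h t) (circle_field Cf).
Proof.
move=> eqC c x v c' y w tm; split; first exact: circle_field_flow tm.
exact: circle_field_flow (tangent_map_inv tm).
Qed.

Lemma circle_field_compatible (Cf : @flag R -> set (@flag R)) :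
  equivariant Cf -> compatible (atlas h) (circle_field (h := h) Cf).
Proof. by move=> eqC; have := circle_field_preserved (t := 0) eqC; rewrite flow0. Qed.

Lemma is_derive_coord (u : R -> R3) (v : R3) (i : 'I_3) :
  is_derive (0 : R) 1 u v -> is_derive (0 : R) 1 (fun s => u s 0 i : R) (v 0 i).
Proof.
move=> [du Du]; apply: DeriveDef; first by move/derivable_mxP : du; exact.
by rewrite -Du derive_mx// mxE.
Qed.

Lemma is_derive_locally_cst (f : R -> R) (a k : R) :
  is_derive (0 : R) 1 f a -> (\forall s \near (0 : R), f s = k) -> a = 0.
Proof.
move=> [_ <-] fk; rewrite (near_eq_derive (g := cst k)) ?derive_cst//.
Qed.

Lemma near_forall {T : topologicalType} (x : T) (P : T -> Prop) :
  (forall y, P y) -> \forall y \near x, P y.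
Proof. by move=> HP; exact: nearW. Qed.

Lemma is_derive_line (x v : R3) : is_derive (0 : R) 1 (fun s : R => x + s *: v) v.
Proof.
have dx : is_derive (0 : R) 1 (cst x) (0 : R3) by exact: is_derive_cst.
have dv : is_diff (0 : R) (fun s : R => s *: v) (fun s : R => s *: v).
  exact: is_diff_scalel.
have dl : is_derive (0 : R) 1 (fun s : R => s *: v) v.
  have dfv : differentiable (fun s : R => s *: v) 0 by exact: ex_diff.
  apply: DeriveDef; first exact: diff_derivable.
  by rewrite deriveE// diff_val scale1r.
have := is_deriveD dx dl; rewrite add0r.
by [].
Qed.

Lemma E_alphaE c x : at_chart (atlas h) c x ->
  E_alpha h c x = [set v | v 0 0 = 0 /\ v 0 2 = 0].
Proof.
move=> cx; apply/seteqP; split=> v.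
  move=> /(circle_fieldP v equivariant_alpha (big_cell_alphaC) cx)[u [u0 du lu]].
  have l0 : \forall s \near (0 : R), u s 0 0 = x 0 0 by apply: filterS lu => s [].
  have l2 : \forall s \near (0 : R), u s 0 2 = x 0 2 by apply: filterS lu => s [].
  by split; [exact: is_derive_locally_cst (is_derive_coord 0 du) l0|
             exact: is_derive_locally_cst (is_derive_coord 2 du) l2].
move=> [v0 v2]; apply/(circle_fieldP v equivariant_alpha (big_cell_alphaC) cx).
exists (fun s => x + s *: v); split; first by rewrite scale0r addr0.
  exact: is_derive_line.
by apply: near_forall => s; split; rewrite !mxE ?v0 ?v2 mulr0 addr0.
Qed.

Lemma E_betaE c x : at_chart (atlas h) c x ->
  E_beta h c x = [set v | v 0 1 = 0 /\ v 0 2 = x 0 1 * v 0 0].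
Proof.
move=> cx; apply/seteqP; split=> v.
  move=> /(circle_fieldP v equivariant_beta (big_cell_betaC) cx)[u [u0 du lu]].
  have l1 : \forall s \near (0 : R), u s 0 1 = x 0 1 by apply: filterS lu => s [].
  split; first exact: is_derive_locally_cst (is_derive_coord 1 du) l1.
  have d0 := is_derive_coord 0 du; have d2 := is_derive_coord 2 du.
  (* Along the leaf the slope y is constant, so the constancy of the intercept z - x y
     differentiates to a linear relation. *)
  have dd := is_deriveB d2 (is_deriveZ (x 0 1) d0).
  apply/eqP; rewrite -subr_eq0; apply/eqP.
  apply: (is_derive_locally_cst dd (k := x 0 2 - x 0 0 * x 0 1)).
  apply: filterS lu => s [e1 e2]; rewrite e2 -e1 !fctE /GRing.scale /= mulrC.
  by [].
move=> [v1 v2]; apply/(circle_fieldP v equivariant_beta (big_cell_betaC) cx).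
exists (fun s => x + s *: v); split; first by rewrite scale0r addr0.
  exact: is_derive_line.
by apply: near_forall => s; split; rewrite !mxE ?v1 ?v2; lra.
Qed.

End CircleFields.

Section PathStructure.
Context {R : realType} (d : nat) (h : 'I_d -> @SL2 R).
Local Notation M := (compactification h).
Local Notation R3 := 'rV[R]_3.
Implicit Types (c : @chart R M).

Lemma smooth_near_elementary (F : R3 -> R3) x :
  (forall i, elementary setT (fun z => F z 0 i)) -> smooth_near F x.
Proof.
move=> eF; exists setT; split=> // [|k]; first exact: openT.
by apply: Cr_coord => //; exact: openT.
Qed.

Definition alpha_frame (z : R3) : R3 := \row_(i < 3) [:: 0; 1; 0]`_i.

(** The two frames are d/dy and d/dx + y d/dz. Their bracket is d/dz, on which the contact form dz -
    y dx equals 1. *)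
Definition beta_frame (z : R3) : R3 := \row_(i < 3) [:: 1; 0; z 0 1]`_i.

Lemma smooth_alpha_frame x : smooth_near alpha_frame x.
Proof.
apply: smooth_near_elementary => i; rewrite /alpha_frame.
under eq_fun do rewrite mxE.
exact: (elementary_cst _ ([:: 0; 1; 0]`_i)).
Qed.

Lemma smooth_beta_frame x : smooth_near beta_frame x.
Proof.
apply: smooth_near_elementary => i; rewrite /beta_frame.
under eq_fun do rewrite mxE.
case: i => -[|[|[|//]]] i3 /=; [exact: (elementary_cst _ 1)|exact: (elementary_cst _ 0)|].
exact: elementary_coord1.
Qed.

Lemma chart_near_at c x : at_chart (atlas h) c x ->
  \forall z \near x, at_chart (atlas h) c z.
Proof. by move=> [Ac cx]; apply: filterS (chart_nbhs Ac cx) => z cz; split. Qed.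

Lemma independent1 (v : R3) i : v 0 i != 0 -> independent (fun _ : 'I_1 => v).
Proof.
move=> vi a; rewrite big_ord1 => /rowP/(_ i); rewrite !mxE => /eqP.
by rewrite mulf_eq0 (negPf vi) orbF => /eqP a0 j; rewrite ord1.
Qed.

Lemma span_of1 (v : R3) : span_of (fun _ : 'I_1 => v) = [set w | exists a, w = a *: v].
Proof.
apply/seteqP; split=> w [a ->].
  by exists (a 0); rewrite big_ord1.
by exists (fun _ => a); rewrite big_ord1.
Qed.

Lemma smooth_distribution_alpha : smooth_distribution (atlas h) 1 (E_alpha h).
Proof.
split; first exact: circle_field_compatible equivariant_alpha.
move=> c x cx; exists (fun _ => alpha_frame); last by move=> _; exact: smooth_alpha_frame.
apply: filterS (chart_near_at cx) => z cz; split.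
  by apply: (@independent1 _ 1); rewrite mxE /= oner_eq0.
rewrite (E_alphaE cz) span_of1; apply/seteqP; split=> [v [v0 v2]|_ [a ->]].
  by exists (v 0 1); apply: row3P; rewrite !mxE /= ?mulr0 ?mulr1.
by split; rewrite !mxE /= mulr0.
Qed.

Lemma smooth_distribution_beta : smooth_distribution (atlas h) 1 (E_beta h).
Proof.
split; first exact: circle_field_compatible equivariant_beta.
move=> c x cx; exists (fun _ => beta_frame); last by move=> _; exact: smooth_beta_frame.
apply: filterS (chart_near_at cx) => z cz; split.
  by apply: (@independent1 _ 0); rewrite mxE /= oner_eq0.
rewrite (E_betaE cz) span_of1; apply/seteqP; split=> [v [v1 v2]|_ [a ->]].
  by exists (v 0 0); apply: row3P; rewrite !mxE /= ?mulr0 ?mulr1// v2 mulrC.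
by split; rewrite !mxE /= ?mulr0 ?mulr1// mulrC.
Qed.

Lemma sum_fieldE c x : at_chart (atlas h) c x ->
  sum_field (E_alpha h) (E_beta h) c x = [set v | v 0 2 = x 0 1 * v 0 0].
Proof.
move=> cx; rewrite /sum_field (E_alphaE cx) (E_betaE cx).
apply/seteqP; split=> [v [a [b [[a0 a2] [b1 b2] ->]]]|v v2].
  by rewrite /= !mxE a0 a2 !add0r.
exists (\row_(i < 3) [:: 0; v 0 1; 0]`_i), (\row_(i < 3) [:: v 0 0; 0; v 0 2]`_i).
split; rewrite /= ?mxE //.
by apply: row3P; rewrite !mxE /= ?add0r ?addr0.
Qed.

Lemma derive_coord (i : 'I_3) (x v : R3) : 'D_v (fun z : R3 => z 0 i : R) x = v 0 i.
Proof.
have lf : linear (fun z : R3 => z 0 i : R) by move=> a y z; rewrite !mxE.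
pose g : {linear R3 -> R} := HB.pack (fun z : R3 => z 0 i : R)
  (GRing.isLinear.Build _ _ _ _ _ lf).
have cg : continuous g by exact: coord_continuous.
have dg : differentiable g x by exact: linear_differentiable.
by rewrite [LHS](deriveE v dg) diff_lin.
Qed.

Lemma tangent_map_id_inv c x v c' y w :
  tangent_map (atlas h) id c x v c' y w -> tangent_map (atlas h) id c' y w c x v.
Proof.
move=> tm; have /tangent_map_inv : tangent_map (atlas h) (flow h 0) c x v c' y w.
  by rewrite flow0.
by rewrite oppr0 flow0.
Qed.

Lemma compatible_sum_field (E E' : @tfield R M) :
  compatible (atlas h) E -> compatible (atlas h) E' -> compatible (atlas h) (sum_field E E').
Proof.
move=> cE cE'.
have H c x v c' y w : tangent_map (atlas h) id c x v c' y w ->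
    sum_field E E' c x v -> sum_field E E' c' y w.
  move=> [F [lF dF <-]] [a [b [Ea Eb ->]]]; exists ('d F x a), ('d F x b); split.
  - by apply/(cE c x a) => //; exists F.
  - by apply/(cE' c x b) => //; exists F.
  - exact: linearD.
by move=> c x v c' y w tm; split; apply: H => //; exact: tangent_map_id_inv.
Qed.

Lemma diff_coord (F : R3 -> R3) (x v : R3) (i : 'I_3) : differentiable F x ->
  ('d F x v) 0 i = 'D_v (fun z => F z 0 i : R) x.
Proof. by move=> dF; rewrite -(deriveE v dF) (derive_mx (diff_derivable dF)) mxE. Qed.

Lemma lie_bracket_frames x : lie_bracket alpha_frame beta_frame x 0 0 = 0 /\
  lie_bracket alpha_frame beta_frame x 0 2 = 1.
Proof.
have da := smooth_near_differentiable (smooth_alpha_frame x).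
have db := smooth_near_differentiable (smooth_beta_frame x).
have E i : lie_bracket alpha_frame beta_frame x 0 i =
    'D_(alpha_frame x) (fun z => beta_frame z 0 i : R) x.
  have A : ('d alpha_frame x (beta_frame x)) 0 i = 0.
    rewrite (diff_coord _ _ da) (_ : (fun _ => _) = cst ([:: 0; 1; 0]`_i)) ?derive_cst//.
    by apply/funext => z; rewrite mxE.
  rewrite -(diff_coord _ _ db) -[RHS]subr0 -[X in _ = _ - X]A.
  by rewrite /lie_bracket mxE; congr (_ + _); rewrite mxE.
rewrite (E 0) (E 2); split.
  rewrite (_ : (fun _ => _) = cst 1) ?derive_cst//.
  by apply/funext => z; rewrite mxE.
have -> : (fun z : R3 => beta_frame z 0 2 : R) = (fun z => z 0 1).
  by apply/funext => z; rewrite mxE.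
by rewrite derive_coord mxE.
Qed.

Lemma contact_sum_field :
  contact_distribution (atlas h) (sum_field (E_alpha h) (E_beta h)).
Proof.
split.
  apply: compatible_sum_field; apply: circle_field_compatible.
    exact: equivariant_alpha.
  exact: equivariant_beta.
move=> c x cx; exists (fun i => if i == 0 then alpha_frame else beta_frame); split.
- apply: filterS (chart_near_at cx) => z cz; split.
    move=> a; rewrite sum2E /= => /rowP e i.
    have := e 0; have := e 1; rewrite !mxE /= !mulr0 !mulr1 add0r addr0 => a0 a1.
    by have [->|->] := ord2P i.
  rewrite (sum_fieldE cz); apply/seteqP; split=> [v v2|_ [a ->]].
    exists (fun i => if i == 0 then v 0 1 else v 0 0); rewrite sum2E /=.
    apply: row3P; rewrite !mxE /= ?mulr0 ?mulr1 ?addr0 ?add0r//.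
    by rewrite v2 mulrC.
  by rewrite /= sum2E !mxE /= !mulr0 !mulr1 !add0r mulrC.
- by move=> i; case: ifP => _; [exact: smooth_alpha_frame|exact: smooth_beta_frame].
- rewrite (sum_fieldE cx) /=.
  have [-> ->] := lie_bracket_frames x.
  by rewrite mulr0 => /eqP; rewrite oner_eq0.
Qed.

Lemma path_structure_charts : path_structure (atlas h) (E_alpha h) (E_beta h).
Proof.
split; [exact: smooth_distribution_alpha|exact: smooth_distribution_beta|].
exact: contact_sum_field.
Qed.

Lemma automorphism_flow_flow :
  automorphism_flow (atlas h) (E_alpha h) (E_beta h) (flow h).
Proof.
split; first exact: smooth_flow_flow.
move=> t; split; first exact: diffeomorphism_flow.
  exact: circle_field_preserved equivariant_alpha.
exact: circle_field_preserved equivariant_beta.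
Qed.

End PathStructure.

(** * Ping-pong on the invariant circle *)

Section Eigenvectors.
Context {R : realType}.
Implicit Types (A : 'M[R]_2) (u v q : 'cV[R]_2).

(** The area form: it detects linear dependence, is preserved in determinant 1, and yields
    coordinates by Cramer's rule. *)
Definition bracket u v : R := u 0 0 * v 1 0 - u 1 0 * v 0 0.

Lemma mulmx2E A v i : (A *m v) i 0 = A i 0 * v 0 0 + A i 1 * v 1 0.
Proof. by rewrite mxE sum2E. Qed.

(** The candidates (A01, l - A00) and (l - A11, A10) are, up to sign, the columns of the adjugate of
    A - l; if both vanish, A is the scalar l. *)
Lemma eigenvector_ex A l : l ^+ 2 - \tr A * l + \det A = 0 ->
  exists2 v : 'cV[R]_2, v != 0 & A *m v = l *: v.
Proof.
rewrite /mxtrace sum2E det2E => el.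
pose w (a b : R) : 'cV[R]_2 := \col_i (if i == 0 then a else b).
have w0 a b : (w a b == 0) = (a == 0) && (b == 0).
  apply/eqP/andP => [/colP e|[/eqP-> /eqP->]].
    by have := e 0; have := e 1; rewrite !mxE /= => -> ->.
  by apply/colP => i; rewrite !mxE if_same.
have [|n1] := eqVneq (w (A 0 1) (l - A 0 0)) 0.
  move/eqP; rewrite w0 => /andP[/eqP b0 /eqP la].
  have [|n2] := eqVneq (w (l - A 1 1) (A 1 0)) 0.
    move/eqP; rewrite w0 => /andP[/eqP le /eqP c0].
    exists (w 1 0); first by rewrite w0 oner_eq0.
    by apply: cV2P; rewrite mulmx2E !mxE /=; lra.
  exists (w (l - A 1 1) (A 1 0)) => //.
  by apply: cV2P; rewrite mulmx2E !mxE /=; lra.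
exists (w (A 0 1) (l - A 0 0)) => //.
by apply: cV2P; rewrite mulmx2E !mxE /=; lra.
Qed.

(** The eigenvalues are the two distinct roots of X^2 - t X + 1, where t is the trace. They are
    positive with product 1, hence lie on both sides of 1. *)
Lemma hyperbolic_eigenvectors A : \det A = 1 -> 2 < `|\tr A| ->
  (forall a, eigenvalue A a -> 0 < a) ->
  exists (u v : 'cV[R]_2) (l m : R),
    [/\ u != 0, v != 0, A *m u = l *: u, A *m v = m *: v & [&& 0 < l, l < 1 & 1 < m]].
Proof.
move=> dA tA pA; set t := \tr A in tA.
have t4 : 0 < t ^+ 2 - 4.
  have : 2 ^+ 2 < `|t| ^+ 2 by rewrite ltr_pXn2r ?nnegrE.
  by rewrite real_normK ?num_real// => ?; lra.
pose s := Num.sqrt (t ^+ 2 - 4).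
have s0 : 0 < s by rewrite sqrtr_gt0.
have ss : s ^+ 2 = t ^+ 2 - 4 by rewrite sqr_sqrtr// ltW.
have E l : l = (t - s) / 2 \/ l = (t + s) / 2 -> l ^+ 2 - t * l + 1 = 0.
  by case=> ->; nra.
have eig l : l ^+ 2 - t * l + 1 = 0 -> 0 < l.
  move=> el; apply: pA; apply/eigenvalueP.
  (* [eigenvalue] is about row vectors, whence the transpose. *)
  have [|v v0 Av] := @eigenvector_ex A^T l; first by rewrite mxtrace_tr det_tr dA.
  exists v^T; last by rewrite trmx_eq0.
  by rewrite -[LHS]trmxK trmx_mul trmxK Av linearZ.
have l0 := eig _ (E _ (or_introl erefl)); have m0 := eig _ (E _ (or_intror erefl)).
have [|u u0 Au] := @eigenvector_ex A ((t - s) / 2); first by rewrite dA; apply: E; left.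
have [|v v0 Av] := @eigenvector_ex A ((t + s) / 2); first by rewrite dA; apply: E; right.
exists u, v, ((t - s) / 2), ((t + s) / 2); split=> //.
by apply/and3P; split; nra.
Qed.

Lemma bracket_eq0 u v : u != 0 -> bracket u v = 0 -> exists a, v = a *: u.
Proof.
move=> u0; rewrite /bracket => b0.
have [u00|u00] := eqVneq (u 0 0) 0.
  have u1 : u 1 0 != 0.
    by apply: contra_neq u0 => u1; apply: cV2P; rewrite mxE.
  exists (v 1 0 / u 1 0); apply: cV2P; rewrite mxE ?divfK//.
  apply: (mulfI u1); move: b0; rewrite u00 mul0r !mulr0 sub0r => /eqP.
  by rewrite oppr_eq0 => /eqP.
exists (v 0 0 / u 0 0); apply: cV2P; rewrite mxE ?divfK//.
apply: (mulfI u00); rewrite mulrA [u 0 0 * (_ / _)]mulrC divfK//; lra.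
Qed.

Lemma eigenvectors_bracket A u v l m : u != 0 -> v != 0 -> A *m u = l *: u ->
  A *m v = m *: v -> l != m -> bracket u v != 0.
Proof.
move=> u0 v0 Au Av; apply: contra_neq => /(bracket_eq0 u0)[a ev].
apply/eqP; rewrite -subr_eq0.
have : (l - m) *: v = 0 by rewrite scalerBl -Av ev -scalemxAr Au !scalerA mulrC subrr.
by move=> /eqP; rewrite scaler_eq0 (negPf v0) orbF.
Qed.

End Eigenvectors.

Section BoundaryFlags.
Context {R : realType}.
Local Notation V := 'cV[R]_3.
Implicit Types (q r : 'cV[R]_2) (x y : @flag R) (A : 'M[R]_2).

Definition plane12 : {vspace V} := plane (in_plane12 (delta_mx 0 0)) (in_plane12 (delta_mx 1 0)).

Lemma lincombE n (a b : R) (u w : 'cV[R]_n) i :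
  (a *: u + b *: w) i 0 = a * u i 0 + b * w i 0.
Proof. by rewrite !mxE. Qed.

Lemma addscaleE n (b : R) (u w : 'cV[R]_n) i : (u + b *: w) i 0 = u i 0 + b * w i 0.
Proof. by rewrite !mxE. Qed.

Lemma e3E : [/\ @e3 R 0 0 = 0, @e3 R 1 0 = 0 & @e3 R 2 0 = 1].
Proof. by rewrite !mxE. Qed.

Lemma cV3P (u w : V) : u 0 0 = w 0 0 -> u 1 0 = w 1 0 -> u 2 0 = w 2 0 -> u = w.
Proof.
move=> e0 e1 e2; apply/colP => -[[|[|[|//]]] i3].
- by rewrite (_ : Ordinal i3 = 0)//; exact: val_inj.
- by rewrite (_ : Ordinal i3 = 1)//; exact: val_inj.
- by rewrite (_ : Ordinal i3 = 2)//; exact: val_inj.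
Qed.

Lemma mem_plane12 (v : V) : (v \in plane12) = (v 2 0 == 0).
Proof.
have [e00 e01 e02] := in_plane12E (delta_mx 0 0 : 'cV[R]_2).
have [e10 e11 e12] := in_plane12E (delta_mx 1 0 : 'cV[R]_2).
apply/idP/eqP.
  move=> /memv_addP[_ /vlineP[a ->] [_ /vlineP[b ->] ->]].
  by rewrite lincombE e02 e12 !mulr0 addr0.
move=> v2.
have -> : v = v 0 0 *: in_plane12 (delta_mx 0 0) + v 1 0 *: in_plane12 (delta_mx 1 0).
  apply: cV3P; rewrite lincombE ?e00 ?e01 ?e02 ?e10 ?e11 ?e12 ?v2 ?[delta_mx _ _ _ _]mxE /=;
    by rewrite ?mulr0 ?mulr1 ?addr0 ?add0r.
by rewrite memvD ?memvZ// ?(subvP (addvSr _ _) _ (memv_line _)) ?(subvP (addvSl _ _) _ (memv_line _)).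
Qed.

Lemma dim_line_le (v : V) : (\dim <[v]> <= 1)%N.
Proof. by rewrite dim_vline; case: (v != 0). Qed.

Lemma dim_plane_le (v w : V) : (\dim (plane v w) <= 2)%N.
Proof.
apply: leq_trans (leq_of_leqif (dimv_add_leqif _ _)) _.
exact: leq_add (dim_line_le _) (dim_line_le _).
Qed.

Lemma dim2_plane12 (U : {vspace V}) : \dim U = 2%N ->
  (forall v, v \in U -> v 2 0 = 0) -> U = plane12.
Proof.
move=> dU U0; apply/eqP; rewrite eqEdim dU dim_plane_le andbT.
by apply/subvP => v /U0/eqP; rewrite mem_plane12.
Qed.

Lemma flag_dim x : \dim (val x).1 = 1%N /\ \dim (val x).2 = 2%N.
Proof. by case: x => -[l p] /= /and3P[/eqP-> /eqP->]. Qed.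

Definition boundary_flag q x : Prop := (val x).1 = line (in_plane12 q) /\ (val x).2 = plane12.

Lemma boundary_flag_uniq q x y : boundary_flag q x -> boundary_flag q y -> x = y.
Proof. by move=> [x1 x2] [y1 y2]; apply: val_inj; apply: injective_projections; rewrite ?x1 ?x2. Qed.

Lemma boundary_flagZ (a : R) q x : a != 0 -> boundary_flag (a *: q) x <-> boundary_flag q x.
Proof. by move=> a0; rewrite /boundary_flag line_in_plane12Z. Qed.

Lemma row_mx2E q r i : (row_mx q r : 'M[R]_2) i 0 = q i 0 /\ (row_mx q r : 'M[R]_2) i 1 = r i 0.
Proof. by rewrite !mxE; split; case: splitP => k //=; rewrite ord1. Qed.

Lemma bracketE q r : bracket q r = \det (row_mx q r : 'M[R]_2).
Proof.
rewrite det2E /bracket; have [-> ->] := row_mx2E q r 0; have [-> ->] := row_mx2E q r 1.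
by rewrite [r 0 0 * _]mulrC.
Qed.

(** The columns are q, r and e3, so the cell of this matrix is centred at the flag (q, [e1,e2]). *)
Definition basis_mx q r : 'M[R]_3 := j_mx (row_mx q r).

Lemma basis_mx_unit q r : bracket q r != 0 -> basis_mx q r \in unitmx.
Proof. by rewrite j_mx_unit unitmxE unitfE -bracketE. Qed.

Lemma basis_mxE q r (v : V) :
  basis_mx q r *m v = in_plane12 (v 0 0 *: q + v 1 0 *: r) + v 2 0 *: e3.
Proof.
set w : 'cV[R]_2 := \col_i (if i == 0 then v 0 0 else v 1 0).
have [w0 w1] : w 0 0 = v 0 0 /\ w 1 0 = v 1 0 by rewrite !mxE.
have [f0 f1 f2] := e3E; have [e0 e1 e2] := in_plane12E w.
have ev : v = in_plane12 w + v 2 0 *: e3.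
  by apply: cV3P; rewrite addscaleE ?e0 ?e1 ?e2 ?w0 ?w1 ?f0 ?f1 ?f2 ?mulr0 ?addr0 ?add0r ?mulr1.
rewrite [in LHS]ev mulmxDr -scalemxAr j_mx_e3 j_mx_in_plane12.
congr (in_plane12 _ + _ *: _).
apply/colP => i; rewrite mulmx2E lincombE; have [-> ->] := row_mx2E q r i.
by rewrite w0 w1 mulrC; congr (_ + _); rewrite mulrC.
Qed.

Definition boundary_frame q r (b0 : bracket q r != 0) (v : 'rV[R]_3) : frame :=
  SigSub (mem_set (rank_cell v (basis_mx_unit b0)) :
    basis_mx q r *m cell_mx v \in [set F : 'M[R]_(3, 2) | \rank F = 2%N]).

Lemma basis_mx_col q r (v : 'rV[R]_3) :
  basis_mx q r *m col 0 (cell_mx v) = in_plane12 (q + v 0 0 *: r) + v 0 2 *: e3 /\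
  basis_mx q r *m col 1 (cell_mx v) = in_plane12 r + v 0 1 *: e3.
Proof. by rewrite !basis_mxE !mxE /= !scale1r scale0r add0r. Qed.

Lemma boundary_flag_frame q r (b0 : bracket q r != 0) (v : 'rV[R]_3) :
  v 0 1 = 0 -> v 0 2 = 0 ->
  boundary_flag (q + v 0 0 *: r) (flag_of_frame (boundary_frame b0 v)).
Proof.
move=> v1 v2; have [c0 c1] := basis_mx_col q r v.
have [_ d2] := flag_dim (flag_of_frame (boundary_frame b0 v)).
split; first by rewrite /= /vec1 /= col_mulmx c0 v2 scale0r addr0.
apply: dim2_plane12 => // u /=; rewrite /vec1 /vec2 /= !col_mulmx c0 c1 v1 v2 !scale0r !addr0.
move=> /memv_addP[_ /vlineP[a ->] [_ /vlineP[b ->] ->]]; rewrite lincombE.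
by have [_ _ ->] := in_plane12E (q + v 0 0 *: r); have [_ _ ->] := in_plane12E r; rewrite !mulr0 addr0.
Qed.

Lemma boundary_flag_ex q : q != 0 -> exists x, boundary_flag q x.
Proof.
(* [r] is [q] turned by a right angle, which makes the bracket equal to |q|^2. *)
move=> q0; pose r : 'cV[R]_2 := \col_i (if i == 0 then - q 1 0 else q 0 0).
have b0 : bracket q r != 0.
  rewrite /bracket !mxE /= mulrN opprK -!expr2 -mxtrace_mul_tr gt_eqF//.
  exact: mxtrace_mul_tr_gt0.
exists (flag_of_frame (boundary_frame b0 0)).
have := @boundary_flag_frame q r b0 0; rewrite !mxE scale0r addr0; exact.
Qed.

Lemma limg_j_mx_plane12 A : A \in unitmx -> (linfun (mulmx (j_mx A)) @: plane12)%VS = plane12.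
Proof.
move=> uA; have uJ : j_mx A \in unitmx by rewrite j_mx_unit.
have d2 : \dim plane12 = 2%N.
  have q0 : delta_mx 0 0 != 0 :> 'cV[R]_2.
    by apply/eqP => /colP/(_ 0); rewrite !mxE => /eqP; rewrite oner_eq0.
  by have [x [_ <-]] := boundary_flag_ex q0; have [] := flag_dim x.
apply: dim2_plane12.
  rewrite limg_dim_eq//; apply/eqP; rewrite -subv0; apply/subvP => v.
  rewrite memv_cap memv_ker lfunE /= => /andP[_ /eqP Av].
  by rewrite memv0 -[v](mulKmx uJ) Av mulmx0.
rewrite /plane12 /plane limgD !limg_line !lfunE /= !j_mx_in_plane12.
move=> _ /memv_addP[_ /vlineP[a ->] [_ /vlineP[b ->] ->]]; rewrite lincombE.
have [_ _ ->] := in_plane12E (A *m delta_mx 0 0).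
by have [_ _ ->] := in_plane12E (A *m delta_mx 1 0); rewrite !mulr0 addr0.
Qed.

Lemma boundary_flag_pull A q x y : A \in unitmx -> boundary_flag (A *m q) y ->
  (val y).1 = (linfun (mulmx (j_mx A)) @: (val x).1)%VS ->
  (val y).2 = (linfun (mulmx (j_mx A)) @: (val x).2)%VS -> boundary_flag q x.
Proof.
move=> uA [y1 y2] e1 e2; have uJ : j_mx A \in unitmx by rewrite j_mx_unit.
split; apply: (limg_mul_inj uJ) => /=.
  by rewrite limg_j_mx_line -e1.
by rewrite limg_j_mx_plane12// -e2.
Qed.

End BoundaryFlags.

Section PingPong.
Context {R : realType} (d : nat) (h : 'I_d -> @SL2 R).
Context (H : 'I_d -> bool -> set (@flag R)).
Hypothesis H_disjoint : forall i b j b', (i, b) != (j, b') -> H i b `&` H j b' = set0.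
Hypothesis H_schottky : forall i, H i true = ~` interior (flag_image (gen h i) (H i false)).
Implicit Types (q : 'cV[R]_2) (A : 'M[R]_2).

(* The trace of the handlebody [H i b] on the circle C_beta([e1,e2]). *)
Definition handle i b q : Prop := exists2 x, H i b x & boundary_flag q x.

Lemma handleZ i b (a : R) q : a != 0 -> handle i b (a *: q) <-> handle i b q.
Proof.
by move=> a0; split=> -[x Hx /(boundary_flagZ _ _ a0) qx];
  exists x => //; apply/(boundary_flagZ _ _ a0).
Qed.

Lemma handle_disjoint i b j b' q : handle i b q -> handle j b' q -> (i, b) = (j, b').
Proof.
move=> [x Hx qx] [y Hy qy]; apply/eqP/negPn/negP => /H_disjoint E.
by rewrite (boundary_flag_uniq qy qx) in Hy; have : (H i b `&` H j b') x by []; rewrite E.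
Qed.

Definition letter i b : 'M[R]_2 := if b then val (h i) else invmx (val (h i)).

Lemma letter_unit i b : letter i b \in unitmx.
Proof. by case: b; rewrite /letter ?unitmx_inv SL2_unit. Qed.

Lemma mulmx_neq0 A q : A \in unitmx -> q != 0 -> A *m q != 0.
Proof. by move=> uA; apply: contra_neq => Aq0; rewrite -(mulKmx uA q) Aq0 mulmx0. Qed.

(** The relation between [H i true] and [H i false] says that h_i sends the outside of the negative
    handlebody into the positive one, and its inverse the outside of the positive into the negative.
    The circle of flags with plane [e1,e2] is invariant, so this restricts to handles. *)
Lemma letter_handle i b q : q != 0 -> ~ handle i (~~ b) q -> handle i b (letter i b *m q).
Proof.
move=> q0 nH; have uh := SL2_unit h i.
have [y qy] := boundary_flag_ex (mulmx_neq0 (letter_unit i b) q0).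
exists y => //; case: b nH qy => /= nH qy.
  rewrite H_schottky => /interior_subset[x Hx [e1 e2]].
  by apply: nH; exists x => //; exact: boundary_flag_pull qy e1 e2.
have [z qz] := boundary_flag_ex q0.
have : ~ H i true z by move=> Hz; apply: nH; exists z.
rewrite H_schottky => /contrapT/interior_subset[x Hx [e1 e2]].
rewrite (boundary_flag_uniq qy (_ : boundary_flag _ x))//.
by apply: boundary_flag_pull e1 e2 => //; rewrite mulKVmx.
Qed.

(** Reduced words with their leftmost letter; [None] marks the empty word. *)
Inductive reduced : 'M[R]_2 -> option ('I_d * bool) -> Prop :=
| reduced1 : reduced 1%:M None
| reducedM A l i b : reduced A l -> l != Some (i, ~~ b) ->
    reduced (letter i b *m A) (Some (i, b)).

Lemma reduced_letter i b A l : reduced A l -> exists l', reduced (letter i b *m A) l'.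
Proof.
move=> rA; have [E|lE] := eqVneq l (Some (i, ~~ b));
  last by exists (Some (i, b)); exact: reducedM lE.
case: rA E => [//|B l' j b' rB _ [-> ->]]; exists l'.
suff -> : letter i b *m (letter i (~~ b) *m B) = B by [].
by case: b => /=; [rewrite mulKVmx ?SL2_unit|rewrite mulKmx ?SL2_unit].
Qed.

Lemma Gamma0_reduced A : Gamma0 h A -> exists l, reduced A l.
Proof.
elim=> [|_ B [i _ <-] _ [l rB]|_ B [i _ <-] _ [l rB]]; first by exists None; exact: reduced1.
- exact: (reduced_letter i true rB).
- exact: (reduced_letter i false rB).
Qed.

Lemma reduced_unit A l : reduced A l -> A \in unitmx.
Proof.
by elim=> [|B l' i b _ uB _]; rewrite ?unitmx1// unitmx_mul letter_unit.
Qed.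

(** The shorter word puts the point into the handle of its own leftmost letter, which by reducedness
    is not the handle that the next letter requires the point to avoid. For the empty word the
    hypothesis on [q] takes over. *)
Lemma reduced_handle A l q : q != 0 -> (forall i b, ~ handle i b q) -> reduced A l ->
  forall i b, l = Some (i, b) -> handle i b (A *m q).
Proof.
move=> q0 nH; elim=> [//|B l' i b rB IH lE _ _ [<- <-]].
rewrite -mulmxA; apply: letter_handle; first exact: mulmx_neq0 (reduced_unit rB) q0.
case: l' rB IH lE => [[j b'] rB IH lE|rB _ _ Hq].
  move=> Hi; have := IH j b' erefl => Hj.
  by case/eqP: lE; rewrite (handle_disjoint Hj Hi).
by inversion rB; subst; apply: (nH i (~~ b)); rewrite -[q]mul1mx.
Qed.

Lemma ping_pong A q : q != 0 -> (forall i b, ~ handle i b q) -> Gamma0 h A -> A != 1%:M ->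
  exists i b, handle i b (A *m q).
Proof.
move=> q0 nH /Gamma0_reduced[[[i b]|] rA] A1.
  by exists i, b; exact: reduced_handle rA _ _ erefl.
by inversion rA; subst; rewrite eqxx in A1.
Qed.

End PingPong.

(** * A cone disjoint from its translates *)

Section Projectors.
Context {R : realType}.
Local Notation V := 'cV[R]_3.

(** The orthogonal projector on the line of [v]. It embeds RP^2 into the Hausdorff space of
    matrices, where compact images are closed. *)
Definition line_projector (v : V) : 'M[R]_3 := (\tr (v *m v^T))^-1 *: (v *m v^T).

Lemma mxtrace_cV3 (v : V) : \tr (v *m v^T) = v 0 0 ^+ 2 + v 1 0 ^+ 2 + v 2 0 ^+ 2.
Proof. by rewrite /mxtrace sum3E !mxE !big_ord1 !mxE -!expr2. Qed.

Lemma mxtrace_cV3_gt0 (v : V) : v != 0 -> 0 < \tr (v *m v^T).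
Proof.
rewrite mxtrace_cV3 => v0; rewrite lt_neqAle !addr_ge0 ?sqr_ge0// andbT.
apply: contra v0 => /eqP/esym/eqP; rewrite paddr_eq0 ?addr_ge0 ?sqr_ge0//.
rewrite paddr_eq0 ?sqr_ge0// !sqrf_eq0 => /andP[/andP[/eqP e0 /eqP e1] /eqP e2].
by apply/eqP/cV3P; rewrite mxE.
Qed.

Lemma line_projectorZ (a : R) (v : V) : a != 0 -> line_projector (a *: v) = line_projector v.
Proof.
move=> a0.
rewrite /line_projector; have -> : (a *: v) *m (a *: v)^T = (a * a) *: (v *m v^T).
  by rewrite linearZ /= -scalemxAl -scalemxAr scalerA.
rewrite mxtraceZ scalerA; congr (_ *: _).
by rewrite invfM mulrAC mulVf ?mul1r// mulf_neq0.
Qed.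

Lemma line_projector_inj (v w : V) : v != 0 -> w != 0 ->
  line_projector v = line_projector w -> line v = line w.
Proof.
move=> v0 w0 e.
have E (u : V) : u != 0 -> line_projector u *m u = u.
  move=> u0; rewrite /line_projector -scalemxAl -mulmxA.
  have -> : u^T *m u = (\tr (u *m u^T))%:M.
    by rewrite mxtrace_mulC /mxtrace big_ord1; apply/matrixP => i j; rewrite !ord1 [RHS]mxE.
  by rewrite mul_mx_scalar scalerA mulVf ?scale1r// gt_eqF// mxtrace_cV3_gt0.
have [k ek] : exists k, w = k *: v.
  exists ((\tr (v *m v^T))^-1 * (v^T *m w) 0 0).
  rewrite -{1}(E w w0) -e /line_projector -scalemxAl -mulmxA -scalerA.
  by congr (_ *: _); rewrite [X in v *m X]mx11_scalar mul_mx_scalar.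
rewrite /line ek line_scale//; apply: contra_neq w0 => k0.
by rewrite ek k0 scale0r.
Qed.

Lemma line_projector_cvg {T : Type} {F : set_system T} {FF : Filter F} (f : T -> V) (v : V) :
  v != 0 -> f @ F --> v -> line_projector (f x) @[x --> F] --> line_projector v.
Proof.
move=> v0 fv.
have ft : (f x)^T @[x --> F] --> v^T.
  by apply: cvg_mx => i j; rewrite mxE; under eq_fun do rewrite mxE; exact: cvg_coord.
have fm : (f x) *m (f x)^T @[x --> F] --> v *m v^T by exact: mulmx_cvg.
apply: cvgZ => //; apply: cvgV; first by rewrite gt_eqF// mxtrace_cV3_gt0.
by apply: (cvg_big add_continuous) => // i _; exact: cvg_coord.
Qed.

Lemma line_projector_continuous {T : topologicalType} (f : T -> V) :
  continuous f -> (forall x, f x != 0) -> continuous (line_projector \o f).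
Proof. by move=> cf f0 x; exact: line_projector_cvg (f0 x) (cf x). Qed.

Lemma col_continuous {T : topologicalType} m n (f : T -> 'M[R]_(m, n)) k :
  continuous f -> continuous (fun x => col k (f x)).
Proof.
move=> cf x; apply: cvg_mx => i j; rewrite mxE; under eq_fun do rewrite mxE.
exact: (cvg_coord i k (cf x)).
Qed.

Lemma coord_comp_continuous {T : topologicalType} m n (f : T -> 'M[R]_(m, n)) i j :
  continuous f -> continuous (fun x => f x i j).
Proof. by move=> cf x; exact: (cvg_coord i j (cf x)). Qed.

Definition flag_projector (x : @flag R) : 'M[R]_3 := line_projector (vpick (val x).1).

Lemma flag_projectorE (x : @flag R) (v : V) : v != 0 -> (val x).1 = line v ->
  flag_projector x = line_projector v.
Proof.
move=> v0 e; have [d1 _] := flag_dim x.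
have p0 : vpick (val x).1 != 0.
  by rewrite vpick0 -dimv_eq0 d1.
have := memv_pick (val x).1; rewrite e => /vlineP[k ek].
rewrite /flag_projector e ek line_projectorZ//.
by apply: contra_neq p0 => k0; rewrite e ek k0 scale0r.
Qed.

Lemma vec1_neq0 (F : @frame R) : vec1 F != 0.
Proof.
apply/eqP => v0; have /frame_indep [/eqP] : 1 *: vec1 F + 0 *: vec2 F = 0.
  by rewrite v0 scaler0 scale0r addr0.
by rewrite oner_eq0.
Qed.

Lemma flag_projector_continuous : continuous flag_projector.
Proof.
apply/continuousP => A oA; rewrite /open /= /flag_open -comp_preimage.
have -> : flag_projector \o flag_of_frame = line_projector \o @vec1 R.
  by apply/funext => F /=; apply: flag_projectorE; rewrite ?vec1_neq0.
have /continuousP : continuous (line_projector \o @vec1 R); last exact.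
apply: line_projector_continuous; last exact: vec1_neq0.
exact: col_continuous val_frame_continuous.
Qed.

Lemma flag_of_frame_continuous : continuous (@flag_of_frame R).
Proof. by apply/continuousP => A. Qed.

(** On frames the condition is the vanishing of the third row. *)
Lemma closed_boundary : closed [set x : @flag R | (val x).2 = plane12].
Proof.
rewrite -openC /open /= /flag_open.
have -> : flag_of_frame @^-1` (~` [set x : @flag R | (val x).2 = plane12]) =
    ~` [set F | (val F : 'M[R]_(3, 2)) 2 0 = 0 /\ (val F : 'M[R]_(3, 2)) 2 1 = 0].
  congr (~` _); apply/seteqP; split=> F /=.
    move=> e; split; apply/eqP.
      have : vec1 F \in plane12 by rewrite -e (subvP (addvSl _ _) _ (memv_line _)).
      by rewrite mem_plane12 mxE.
    have : vec2 F \in plane12 by rewrite -e (subvP (addvSr _ _) _ (memv_line _)).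
    by rewrite mem_plane12 mxE.
  move=> [e1 e2]; have [_ d2] := flag_dim (flag_of_frame F).
  apply: dim2_plane12 => //= _ /memv_addP[_ /vlineP[a ->] [_ /vlineP[b ->] ->]].
  by rewrite lincombE !mxE e1 e2 !mulr0 addr0.
rewrite openC.
have c k : closed [set F : @frame R | (val F : 'M[R]_(3, 2)) 2 k = 0].
  apply: (@closed_comp _ _ (fun F : @frame R => (val F : 'M[R]_(3, 2)) 2 k) [set 0]).
    by move=> F _; exact: (coord_comp_continuous val_frame_continuous).
  exact: closed_eq.
exact: closedI (c 0) (c 1).
Qed.

End Projectors.

Section FreeCone.
Context {R : realType} (d : nat) (h : 'I_d -> @SL2 R).
Implicit Types (q r : 'cV[R]_2) (A : 'M[R]_2).

Lemma line_neq0 q r s : bracket q r != 0 -> q + s *: r != 0.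
Proof.
apply: contra_neq => /colP e; have := e 0; have := e 1; rewrite !mxE /bracket => e1 e0.
have -> : q 0 0 = - (s * r 0 0) by lra.
have -> : q 1 0 = - (s * r 1 0) by lra.
lra.
Qed.

(** The flags of [H i b] with plane [e1,e2] form a compact set, whose image by the projector is
    compact, hence closed; the handle is its preimage along a continuous curve of projectors. *)
Lemma handle_closed (H : 'I_d -> bool -> set (@flag R)) i b q r :
  compact (H i b) -> bracket q r != 0 -> closed [set s : R | handle H i b (q + s *: r)].
Proof.
move=> cH b0.
pose p (s : R) := in_plane12 (q + s *: r).
have p0 s : p s != 0.
  apply: contra_neq (line_neq0 s b0) => ps; have [e0 e1 _] := in_plane12E (q + s *: r).
  by apply: cV2P; rewrite -?e0 -?e1 -/(p s) ps !mxE.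
have cp : continuous p.
  have -> : p = (fun s => in_plane12 q + s *: in_plane12 r).
    by apply/funext => s; rewrite /p in_plane12D in_plane12Z.
  move=> s; apply: cvgD; first exact: cvg_cst.
  by apply: cvgZr_tmp; exact: cvg_id.
pose K := flag_projector @` (H i b `&` [set x | (val x).2 = plane12]).
have -> : [set s : R | handle H i b (q + s *: r)] = (line_projector \o p) @^-1` K.
  apply/seteqP; split=> s /=.
    move=> [x Hx [x1 x2]]; exists x => //=; exact: flag_projectorE.
  move=> [x [Hx x2] e]; exists x => //; split=> //.
  have [d1 _] := flag_dim x.
  have v0 : vpick (val x).1 != 0 by rewrite vpick0 -dimv_eq0 d1.
  have x1 : (val x).1 = line (vpick (val x).1).
    apply/esym/eqP; rewrite eqEdim d1 dim_vline v0 andbT.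
    by rewrite -memvE memv_pick.
  by rewrite x1; exact: line_projector_inj v0 (p0 s) e.
apply: closed_comp => [s _|].
  by apply: line_projector_continuous.
apply: compact_closed; first exact: norm_hausdorff.
apply: continuous_compact; first exact/continuous_subspaceT/flag_projector_continuous.
by apply: compact_closedI => //; exact: closed_boundary.
Qed.

Lemma free_cone : (0 < d)%N -> positive_hyperbolic h -> schottky (gen h) ->
  exists q r (e : R), [/\ 0 < e, bracket q r != 0 &
    forall A (a s s' : R), Gamma0 h A -> A != 1%:M -> `|s| < e -> `|s'| < e ->
      A *m (q + s *: r) = a *: (q + s' *: r) -> False].
Proof.
move=> d0 hyp [H [cgH disj neigh sch]].
pose i0 := Ordinal d0; have [tr0 pos0] := hyp i0.
have [p0 [p2 [l [m [p00 p20 E0 E2 /and3P[l0 l1 m1]]]]]] :=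
  hyperbolic_eigenvectors (eqP (valP (h i0))) tr0 pos0.
have b0 : bracket p0 p2 != 0.
  by apply: eigenvectors_bracket E0 E2 _ => //; rewrite lt_eqF// (lt_trans l1).
(* The affine line through the repelling and attracting fixed points of one generator: parameter 0
   is in its negative handle, parameter 1 in its positive one. *)
pose r := p2 - p0.
have br : bracket p0 r != 0.
  by rewrite (_ : bracket p0 r = bracket p0 p2)// /bracket !mxE; lra.
have ip q : q != 0 -> in_plane12 q != 0.
  apply: contra_neq => q0; have [e0 e1 _] := in_plane12E q.
  by apply: cV2P; rewrite -?e0 -?e1 q0 !mxE.
have ord : ordered_eigenlines (gen h i0) (in_plane12 p0) e3 (in_plane12 p2).
  split; [exact: ip| |exact: ip|].
    apply/eqP => /colP e30; have := e30 2; have [_ _ ->] := @e3E R.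
    by rewrite mxE => /eqP; rewrite oner_eq0.
  exists l, 1, m; rewrite normr1 !ger0_norm ?(ltW l0) ?(le_trans _ (ltW m1))//.
  split=> //; rewrite /gen ?j_mx_e3 ?scale1r// j_mx_in_plane12.
    by rewrite E0 in_plane12Z.
  by rewrite E2 in_plane12Z.
have [n0 n2] := neigh _ _ _ _ ord.
have hf : handle H i0 false (p0 + 0 *: r).
  have [x qx] := boundary_flag_ex (line_neq0 0 br).
  exists x => //; apply: interior_subset; apply: n0; left.
  by rewrite /circle_alpha /=; case: qx => -> _; rewrite scale0r addr0.
have ht : handle H i0 true (p0 + 1 *: r).
  have [x qx] := boundary_flag_ex (line_neq0 1 br).
  exists x => //; apply: interior_subset; apply: n2; left.
  by rewrite /circle_alpha /=; case: qx => -> _; rewrite scale1r addrC subrK.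
pose K i b := [set s : R | handle H i b (p0 + s *: r)].
have cK i b : closed (K i b) by apply: handle_closed br; have [] := cgH i b.
have cKU (P : pred ('I_d * bool)) : closed (\bigcup_(k in [set k | P k]) K k.1 k.2).
  by apply: closed_bigcup => [|k _]; [exact: finite_finset|exact: cK].
(* If the finitely many disjoint closed handles covered the line, this positive handle would be open
   and closed, hence everything, although it misses parameter 0. *)
have [s0 Ks0] : exists s, forall i b, ~ K i b s.
  apply: contrapT => /forallNP nK.
  have cov s : exists k, K k.1 k.2 s.
    by have /existsNP[i /existsNP[b /contrapT Kib]] := nK s; exists (i, b).
  have cR : connected [set: R] by exact/connected_intervalP.
  have E : K i0 true = setT.
    apply: cR.
    - by exists 1.
    - exists (~` (\bigcup_(k in [set k | k != (i0, true)]) K k.1 k.2)).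
        by rewrite openC.
      rewrite setTI; apply/seteqP; split=> s.
        move=> Ks [k /= kt Kk]; case/eqP: kt.
        by have := handle_disjoint disj Kk Ks; case: k {Kk}.
      move=> nKs; have [k Kk] := cov s; have [ek|nk] := eqVneq k (i0, true).
        by move: Kk; rewrite ek.
      by case: nKs; exists k.
    - by exists (K i0 true); rewrite ?setTI.
  have /(handle_disjoint disj hf) : K i0 true 0 by rewrite E.
  by case.
have oK : open (~` (\bigcup_(k in [set k : 'I_d * bool | true]) K k.1 k.2)) by rewrite openC.
(* The union of the handles is closed, so an interval around [s0] avoids it; its radius is the
   aperture of the cone. *)
have [e /= e0 Be] : \forall s \near s0, ~ (\bigcup_(k in [set k : 'I_d * bool | true]) K k.1 k.2) s.
  by apply: open_nbhs_nbhs; split=> // -[k _]; exact: Ks0.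
pose q := p0 + s0 *: r.
have qE s : q + s *: r = p0 + (s0 + s) *: r by rewrite /q -addrA -scalerDl.
have nh s : `|s| < e -> forall i b, ~ handle H i b (q + s *: r).
  move=> se i b Hs; apply: (Be (s0 + s)); last by exists (i, b) => //=; rewrite /K /= -qE.
  by rewrite /= opprD addrA subrr sub0r normrN.
exists q, r, e; split=> //.
  by rewrite (_ : bracket q r = bracket p0 r)// /bracket /q !mxE; lra.
move=> A a s s' GA A1 se se' eA.
have q0 : q + s *: r != 0 by rewrite qE; exact: line_neq0.
have [i [b Hb]] := ping_pong disj sch q0 (nh s se) GA A1.
have a0 : a != 0.
  apply: contra_neq (mulmx_neq0 (Gamma0_unit GA) q0) => a0.
  by rewrite eA a0 scale0r.
by apply: (nh s' se' i b); apply/(handleZ _ _ _ _ a0); rewrite -eA.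
Qed.

End FreeCone.

(** * The cone avoids the limit set *)

Section ConeLimitSet.
Context {R : realType} (d : nat) (h : 'I_d -> @SL2 R).
Implicit Types (p y : 'cV[R]_2) (A : 'M[R]_2).

Context (q r : 'cV[R]_2) (e : R).
Hypothesis e0 : 0 < e.
Hypothesis b0 : bracket q r != 0.
Hypothesis free : forall A (a s s' : R), Gamma0 h A -> A != 1%:M -> `|s| < e -> `|s'| < e ->
  A *m (q + s *: r) = a *: (q + s' *: r) -> False.

Lemma cramer y i : bracket q r * y i 0 = bracket y r * q i 0 + bracket q y * r i 0.
Proof. by have [->|->] := ord2P i; rewrite /bracket; lra. Qed.

(** In the basis (q, r) the slope of the image y is [q,y] / [y,r]. Were it smaller than [e], the
    image would fall back into the cone. *)
Lemma outside_cone A s : Gamma0 h A -> A != 1%:M -> `|s| < e ->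
  e * `|bracket (A *m (q + s *: r)) r| <= `|bracket q (A *m (q + s *: r))|.
Proof.
move=> GA A1 se; set y := A *m _; rewrite leNgt; apply/negP => lt.
have yr : bracket y r != 0.
  by apply: contraTneq lt => ->; rewrite normr0 mulr0 -leNgt.
apply: (@free A (bracket y r / bracket q r) s (bracket q y / bracket y r)) => //.
  by rewrite normrM normfV ltr_pdivrMr ?normr_gt0.
apply/colP => i; rewrite -/y [RHS]mxE addscaleE.
apply: (mulfI b0); rewrite cramer mulrA mulrCA divff// mulr1 mulrDr; congr (_ + _).
by rewrite mulrA [bracket y r * _]mulrC divfK.
Qed.

(* Translates of the cone avoid the cone, so every entry of [A] is controlled by
   [w A = A^T J p]; if [A A^T / tr (A A^T)] tended to the projector on the line of [p],
   then [|w A|^2 / tr (A A^T)] would tend to 0. *)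
Section Dominated.
Context (p : 'cV[R]_2) (a s : R).
Hypothesis a0 : a != 0.
Hypothesis se : `|s| < e.
Hypothesis pE : p = a *: (q + s *: r).

Let w A k : R := A 0 k * p 1 0 - A 1 k * p 0 0.
Let N A := `|w A 0| + `|w A 1|.
Let dom (f : 'M[R]_2 -> R) := exists C, forall A, Gamma0 h A -> A != 1%:M -> `|f A| <= C * N A.

Let domZ k f : dom f -> dom (fun A => k * f A).
Proof.
move=> [C HC]; exists (`|k| * C) => A GA A1.
by rewrite normrM -mulrA ler_wpM2l// HC.
Qed.

Let domD f g : dom f -> dom g -> dom (fun A => f A + g A).
Proof.
move=> [C HC] [D HD]; exists (C + D) => A GA A1.
by rewrite mulrDl (le_trans (ler_normD _ _))// lerD ?HC ?HD.
Qed.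

Let dom_eq f g : (forall A, g A = f A) -> dom f -> dom g.
Proof. by move=> fg [C HC]; exists C => A; rewrite fg; exact: HC. Qed.

Let dom_bracket x : dom (fun A => bracket (A *m x) p).
Proof.
apply: (@dom_eq (fun A => x 0 0 * w A 0 + x 1 0 * w A 1)).
  by move=> A; rewrite /bracket !mulmx2E /w; lra.
by apply: domD; apply: domZ; exists 1 => A _ _; rewrite mul1r ?lerDl ?lerDr.
Qed.

Let plucker y : bracket q y = s * bracket y r - a^-1 * bracket y p.
Proof.
have -> : bracket y p = a * (bracket y q + s * bracket y r).
  by rewrite pE /bracket !mxE; lra.
by rewrite mulKf// /bracket; lra.
Qed.

(** For the image y, avoiding the cone of aperture e while p has slope s gives (e - |s|) |[y,r]| <=
    |[y,p]| / |a|. Both coordinates of y are then controlled by its bracket with p. *)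
Let dom_image (t : R) i : `|t| < e -> dom (fun A => (A *m (q + t *: r)) i 0).
Proof.
move=> te; have dr : dom (fun A => bracket (A *m (q + t *: r)) r).
  have [C HC] := dom_bracket (q + t *: r).
  exists ((`|a|^-1 * C) / (e - `|s|)) => A GA A1.
  have := outside_cone GA A1 te; set y := A *m _ => oc.
  have := HC A GA A1; rewrite -/y => Hy.
  have hp : `|bracket q y| <= `|s| * `|bracket y r| + `|a|^-1 * `|bracket y p|.
    by rewrite plucker (le_trans (ler_normB _ _))// !normrM normfV.
  have ia : 0 <= `|a|^-1 by rewrite invr_ge0.
  have := ler_wpM2l ia Hy; rewrite mulrAC ler_pdivlMr ?subr_gt0//; lra.
apply: (@dom_eq (fun A => (bracket q r)^-1 * (q i 0 * bracket (A *m (q + t *: r)) r +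
    r i 0 * (s * bracket (A *m (q + t *: r)) r + (- a^-1) * bracket (A *m (q + t *: r)) p)))).
  move=> A; set y := A *m _; apply: (mulfI b0); rewrite mulVKf// cramer plucker.
  lra.
by apply: domZ; apply: domD; apply: domZ => //; apply: domD; apply: domZ.
Qed.

Let dom_entry i j : dom (fun A => A i j).
Proof.
(* [q] and [q + (e / 2) r] are two independent vectors of the cone, from whose images all of [A] is
   recovered. *)
have e2 : `|e / 2| < e by have e0' := e0; rewrite ger0_norm; lra.
have dq := dom_image i (_ : `|0| < e); rewrite normr0 scale0r addr0 in dq.
have {}dq := dq e0; have dq1 := dom_image i e2.
have dr : dom (fun A => (A *m r) i 0).
  apply: (@dom_eq (fun A => (2 / e) * ((A *m (q + (e / 2) *: r)) i 0 + (-1) * (A *m q) i 0))).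
    move=> A; rewrite mulmxDr -scalemxAr addscaleE.
    have E2 : 2 / e * (e / 2) = 1.
      by rewrite mulf_div [2 * e]mulrC divff// mulf_neq0 ?gt_eqF.
    by rewrite mulN1r addrC addKr mulrA E2 mul1r.
  by apply: domZ; apply: domD => //; apply: domZ.
pose x : 'cV[R]_2 := delta_mx j 0.
apply: (@dom_eq (fun A => (bracket q r)^-1 *
    (bracket x r * (A *m q) i 0 + bracket q x * (A *m r) i 0))).
  move=> A; apply: (mulfI b0); rewrite mulVKf//.
  have -> : A i j = (A *m x) i 0 by rewrite /x -colE mxE.
  rewrite !mulmx2E; have := cramer x 0; have := cramer x 1 => c1 c0.
  by rewrite mulrDr !mulrA ![bracket q r * _]mulrC -!mulrA c0 c1; lra.
by apply: domZ; apply: domD; apply: domZ.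
Qed.

(** The value of the quadratic form S at Jp: it vanishes for p p^T and equals |w A|^2 for A A^T. *)
Let phi (S : 'M[R]_2) : R :=
  p 1 0 ^+ 2 * S 0 0 - p 0 0 * p 1 0 * (S 0 1 + S 1 0) + p 0 0 ^+ 2 * S 1 1.

Let phi_mul_tr A : phi (A *m A^T) = w A 0 ^+ 2 + w A 1 ^+ 2.
Proof. by rewrite /phi /w !mxE !sum2E !mxE; lra. Qed.

Let phi_trace_one (S : 'M[R]_2) : phi (trace_one S) = phi S / \tr S.
Proof. by rewrite /phi /trace_one !mxE; lra. Qed.

Let trace_bound : exists2 C, 0 < C & forall A, Gamma0 h A -> A != 1%:M ->
  \tr (A *m A^T) <= C * phi (A *m A^T).
Proof.
have : forall k : 'I_2 * 'I_2, exists C, forall A, Gamma0 h A -> A != 1%:M ->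
    `|A k.1 k.2| <= C * N A by move=> k; exact: dom_entry.
move=> /choice[C HC]; pose D := \sum_i \sum_j C (i, j) ^+ 2.
have D0 : 0 <= D by apply: sumr_ge0 => i _; apply: sumr_ge0 => j _; exact: sqr_ge0.
(* The factor 2 comes from (x + y)^2 <= 2 (x^2 + y^2); adding 1 makes the constant positive. *)
exists (2 * D + 1).
  by rewrite ltr_pwDr// mulr_ge0.
move=> A GA A1; rewrite phi_mul_tr.
have sq i j : A i j ^+ 2 <= C (i, j) ^+ 2 * N A ^+ 2.
  rewrite -exprMn -[A i j ^+ 2]real_normK ?num_real// lerXn2r ?nnegrE//.
    exact: le_trans (normr_ge0 _) (HC (i, j) A GA A1).
  exact: HC (i, j) A GA A1.
have trD : \tr (A *m A^T) <= D * N A ^+ 2.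
  rewrite /mxtrace /D mulr_suml; apply: ler_sum => i _.
  by rewrite mxE mulr_suml; apply: ler_sum => j _; rewrite mxE -expr2 sq.
apply: le_trans trD _.
have N2 : N A ^+ 2 <= 2 * (w A 0 ^+ 2 + w A 1 ^+ 2).
  rewrite /N -[w A 0 ^+ 2]real_normK ?num_real// -[w A 1 ^+ 2]real_normK ?num_real//.
  by have := sqr_ge0 (`|w A 0| - `|w A 1|); nra.
by have := sqr_ge0 (w A 0); have := sqr_ge0 (w A 1); nra.
Qed.

Lemma cone_notin_limit_set : ~ limit_set h p.
Proof.
move=> [p0 [A [GA Ap]]]; have [C C0 HC] := trace_bound.
have pp := mxtrace_mul_tr_gt0 p0.
have cphi : phi (trace_one (A n *m (A n)^T)) @[n --> \oo] --> phi (trace_one (p *m p^T)).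
  have cc i j : trace_one (A n *m (A n)^T) i j @[n --> \oo] --> trace_one (p *m p^T) i j.
    by exact: (cvg_coord i j Ap).
  rewrite /phi; apply: cvgD; last by apply: cvgM => //; exact: cvg_cst.
  apply: cvgB; first by apply: cvgM => //; exact: cvg_cst.
  by apply: cvgM; [exact: cvg_cst|exact: cvgD].
have phip : phi (trace_one (p *m p^T)) = 0.
  by rewrite phi_trace_one /phi !mxE !big_ord1 !mxE (_ : _ + _ = 0) ?mul0r//; lra.
rewrite phip in cphi.
(* A lower bound valid on the whole orbit: 1/C for nontrivial elements, and |p|^2 / 2 for the
   identity. *)
pose k := Num.min C^-1 (\tr (p *m p^T) / 2).
have k0 : 0 < k by rewrite lt_min invr_gt0 C0 divr_gt0.
have [n /= nk] : exists n, phi (trace_one (A n *m (A n)^T)) < k.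
  have : \forall n \near \oo, phi (trace_one (A n *m (A n)^T)) < k.
    by exact: cvgr_lt cphi _ k0.
  exact: filter_ex.
move: nk; apply/negP; rewrite -leNgt phi_trace_one.
have [->|A1] := eqVneq (A n) 1%:M.
  rewrite trmx1 mulmx1 mxtrace1 /phi !mxE /= ge_min; apply/orP; right.
  by rewrite mxtrace_mul_tr; lra.
have t2 := Gamma0_trace (GA n).
rewrite ge_min; apply/orP; left.
rewrite ler_pdivlMr ?(lt_le_trans _ t2)// mulrC ler_pdivrMr// mulrC.
exact: HC.
Qed.

End Dominated.
End ConeLimitSet.

(** * Charts around the two fixed flags *)

Section ModelCharts.
Context {R : realType} (d : nat) (h : 'I_d -> @SL2 R).
Local Notation M := (compactification h).
Local Notation X := (set_type (hatOmega h)).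
Local Notation proj := Defs.proj.
Local Notation R3 := 'rV[R]_3.
Implicit Types (A : 'M[R]_2) (C : 'M[R]_(3, 2)) (v : R3).

Context (q r : 'cV[R]_2) (e : R).
Hypothesis e0 : 0 < e.
Hypothesis b0 : bracket q r != 0.
Hypothesis free : forall A (a s s' : R), Gamma0 h A -> A != 1%:M -> `|s| < e -> `|s'| < e ->
  A *m (q + s *: r) = a *: (q + s' *: r) -> False.

Lemma in_plane12_e3_inj (p p' : 'cV[R]_2) (a b : R) :
  in_plane12 p + a *: e3 = in_plane12 p' + b *: e3 -> p = p' /\ a = b.
Proof.
move=> /colP E; have [f0 f1 f2] := @e3E R.
have [e00 e01 e02] := in_plane12E p; have [e10 e11 e12] := in_plane12E p'.
have := E 0; have := E 1; have := E 2; rewrite !addscaleE f0 f1 f2 e00 e01 e02 e10 e11 e12.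
by rewrite !mulr0 !mulr1 !addr0 !add0r => -> h1 h0; split=> //; exact: cV2P.
Qed.

(** Both ways of lying in [Lambda] make a point of L proportional to q + s r, the component along
    [e1,e2] of the first vector of the frame. *)
Lemma cone_hatOmega C s z : \rank C = 2%N -> `|s| < e ->
  col 0 C = in_plane12 (q + s *: r) + z *: e3 -> hatOmega h (oflag_of C).
Proof.
move=> rC se c0 [p Lp H].
have p0 : p != 0 by case: Lp.
have q0 := line_neq0 s b0.
have nL (a : R) : a != 0 -> p = a *: (q + s *: r) -> False.
  by move=> a0 pE; exact: (cone_notin_limit_set e0 b0 free a0 se pE Lp).
have {}H : (val (forget (oflag_of C))).1 = line (in_plane12 p) \/
           (val (forget (oflag_of C))).2 = plane (in_plane12 p) e3 by exact: H.
rewrite (val_forget rC) /= c0 in H; case: H => H.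
  have : in_plane12 p \in line (in_plane12 (q + s *: r) + z *: e3) by rewrite H memv_line.
  move=> /vlineP[a]; rewrite scalerDr scalerA -in_plane12Z => E.
  have [|E1 _] := @in_plane12_e3_inj p (a *: (q + s *: r)) 0 (a * z).
    by rewrite scale0r addr0.
  by apply: (nL a) => //; apply: contra_neq p0 => a0; rewrite E1 a0 scale0r.
have : in_plane12 (q + s *: r) + z *: e3 \in plane (in_plane12 p) e3.
  by rewrite -H (subvP (addvSl _ _) _ (memv_line _)).
move=> /memv_addP[_ /vlineP[a ->] [_ /vlineP[b ->] ]]; rewrite -in_plane12Z => /in_plane12_e3_inj[E _].
have a0 : a != 0 by apply: contra_neq q0 => a0; rewrite E a0 scale0r.
by apply: (nL a^-1); rewrite ?invr_neq0// E scalerA mulVf// scale1r.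
Qed.

(** The cone condition leaves only j(1) and j(-1). The latter makes the coordinate along q negative,
    which is impossible for a positive multiple of q + s' r + z' e3. *)
Lemma cone_free C C' s z s' z' (B : 'M[R]_3) : \rank C = 2%N -> \rank C' = 2%N ->
  `|s| < e -> `|s'| < e ->
  col 0 C = in_plane12 (q + s *: r) + z *: e3 ->
  col 0 C' = in_plane12 (q + s' *: r) + z' *: e3 ->
  hatGamma h B -> oflag_of C' = act B (oflag_of C) -> oflag_of C' = oflag_of C.
Proof.
move=> rC rC' se se' c0 c0' hB.
have uB := hatGamma_unit hB.
have [A [t [GA t1 EB]]] := (hatGammaP _ _).1 hB.
rewrite act_oflag_of// => E.
have rBC : \rank (B *m C) = 2%N by rewrite rank_unit_mul.
have [a [b [c [a0 _ + _]]]] := (oflag_of_eqP rC' rBC).1 E.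
rewrite col_mulmx c0 c0' mulmxDr -scalemxAr {1 2}EB j_mx_e3 j_mx_in_plane12.
rewrite scalerDr scalerA -in_plane12Z => /in_plane12_e3_inj[+ _].
rewrite -scalemxAl => E1.
have tt : t * t = 1 by case: t1 => ->; rewrite ?mulrNN mulr1.
have A1 : A = 1%:M.
  apply/eqP/negPn/negP => A1.
  apply: (free GA A1 se se' (a := t * a)).
  by rewrite -scalerA -E1 scalerA tt scale1r.
have q0 := line_neq0 s b0.
rewrite A1 mul1mx in E1.
have ta : t = a.
  have := congr1 (fun y => bracket y r) E1; rewrite /bracket !mxE => E2.
  have : t * bracket q r = a * bracket q r by rewrite /bracket; lra.
  exact: mulIf.
suff EB1 : B = 1%:M by rewrite E EB1 mul1mx.
rewrite EB A1; case: t1 => t1; first by rewrite t1 scale1r j_mx1.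
by move: a0; rewrite -ta t1 ltr0N1.
Qed.

Lemma cone_chart (x0 : X) (B : 'M[R]_3) (U : set R3) (s z : R3 -> R) :
  B \in unitmx -> open U ->
  (forall v, U v -> `|s v| < e /\
    B *m col 0 (cell_mx v) = in_plane12 (q + s v *: r) + z v *: e3) ->
  let c : chart := (U, fun v => proj h (insubd x0 (big_cell B v))) in
  atlas h c /\ forall v, U v -> val (insubd x0 (big_cell B v)) = big_cell B v.
Proof.
move=> uB oU Us c.
have L v : U v -> val (insubd x0 (big_cell B v)) = big_cell B v.
  move=> /Us[sv c0]; rewrite val_insubd mem_set// big_cellE.
  by apply: (cone_hatOmega (rank_cell v uB) sv (z := z v)); rewrite col_mulmx.
split=> //; split=> //; last first.
  by exists B => // v Uv; exists (insubd x0 (big_cell B v)) => //; exact: L.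
move=> v w /set_mem Uv /set_mem Uw /proj_eqP[A GA]; rewrite !L// => E.
have [sv c0] := Us v Uv; have [sw c0'] := Us w Uw.
apply/esym/(big_cell_inj uB); rewrite big_cellE [RHS]big_cellE.
apply: (cone_free (rank_cell v uB) (rank_cell w uB) sv sw (z := z v) (z' := z w) _ _ GA) => //.
  by rewrite col_mulmx.
by rewrite col_mulmx.
Qed.

Definition vec3 (a b c : R) : R3 := \row_(i < 3) [:: a; b; c]`_i.

(** The columns are q, e3 and r: this cell is centred at the flag (q, [q,e3]). *)
Definition basis_mx' : 'M[R]_3 := xcol 1 2 (basis_mx q r).

Lemma basis_mx'_mul n (C : 'M[R]_(3, n)) : basis_mx' *m C = basis_mx q r *m xrow 1 2 C.
Proof. by rewrite /basis_mx' xcolE xrowE mulmxA. Qed.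

Lemma basis_mx'_unit : basis_mx' \in unitmx.
Proof. by rewrite /basis_mx' xcolE unitmx_mul basis_mx_unit// unitmx_perm. Qed.

Lemma xrowE3 n (C : 'M[R]_(3, n)) j :
  [/\ (xrow 1 2 C) 0 j = C 0 j, (xrow 1 2 C) 1 j = C 2 j & (xrow 1 2 C) 2 j = C 1 j].
Proof. by rewrite !mxE tpermL tpermR tpermD. Qed.

Lemma psi_basis_mx t : psi t *m basis_mx q r = basis_mx q r *m psi t.
Proof. by rewrite psi_j_mx -!j_mxM -scalemxAl -scalemxAr mul1mx mulmx1. Qed.

Lemma psi_mulE t n (C : 'M[R]_(3, n)) j :
  [/\ (psi t *m C) 0 j = expR t * C 0 j, (psi t *m C) 1 j = expR t * C 1 j &
      (psi t *m C) 2 j = C 2 j].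
Proof. by rewrite /psi /diag3 !mul_diag_mx !mxE /= mul1r. Qed.

Lemma ord3P (P : 'I_3 -> Prop) : P 0 -> P 1 -> P 2 -> forall i, P i.
Proof.
move=> P0 P1 P2 [[|[|[|//]]] i3].
- by rewrite (_ : Ordinal i3 = 0)//; exact: val_inj.
- by rewrite (_ : Ordinal i3 = 1)//; exact: val_inj.
- by rewrite (_ : Ordinal i3 = 2)//; exact: val_inj.
Qed.

Lemma rank_psi_mul t C : \rank (psi t *m C) = \rank C.
Proof. exact: rank_unit_mul (psi_unit t). Qed.

Lemma expRNK (t : R) : expR t * expR (- t) = 1.
Proof. by rewrite expRN mulfV// gt_eqF// expR_gt0. Qed.

(** Each coordinate is scaled by a ratio of eigenvalues of [psi], which are e^t on q and r and 1 on
    e3. The same rule gives the weights in the second cell. *)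
Lemma psi_big_cell t v : act (psi t) (big_cell (basis_mx q r) v) =
  big_cell (basis_mx q r) (vec3 (v 0 0) (expR (- t) * v 0 1) (expR (- t) * v 0 2)).
Proof.
have uB := basis_mx_unit b0; have tt := expRNK t.
rewrite act_big_cell ?psi_unit// !big_cellE psi_basis_mx -mulmxA; apply/esym/oflag_of_eqP.
- exact: rank_cell.
- by rewrite rank_unit_mul// rank_psi_mul in_cell_rank//; exact: cell_mx_in.
apply: oriented_equiv_mul; apply/oriented_equivP; exists (expR t), (expR t), 0.
split; rewrite ?expR_gt0//.
  have [p0 p1 p2] := psi_mulE t (cell_mx v) 0.
  by apply: ord3P; rewrite ?p0 ?p1 ?p2 !mxE /= ?mxE /= // mulrA tt mul1r.
have [p0 p1 p2] := psi_mulE t (cell_mx v) 1.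
by apply: ord3P; rewrite ?p0 ?p1 ?p2 !mxE /= ?mxE /= ?mul0r ?addr0// mulrA tt mul1r.
Qed.

Lemma psi_big_cell' t v : act (psi t) (big_cell basis_mx' v) =
  big_cell basis_mx' (vec3 (expR (- t) * v 0 0) (expR t * v 0 1) (v 0 2)).
Proof.
have uB := basis_mx_unit b0; have uB' := basis_mx'_unit; have tt := expRNK t.
rewrite act_big_cell ?psi_unit// !big_cellE -[_ *m cell_mx v]mulmxA !basis_mx'_mul.
rewrite mulmxA psi_basis_mx -mulmxA; apply/esym/oflag_of_eqP.
- by rewrite -basis_mx'_mul rank_cell.
- rewrite rank_unit_mul// rank_psi_mul xrowE rank_unit_mul ?unitmx_perm// in_cell_rank//.
  exact: cell_mx_in.
apply: oriented_equiv_mul; apply/oriented_equivP; exists (expR t), 1, 0.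
split; rewrite ?expR_gt0//.
  have [p0 p1 p2] := psi_mulE t (xrow 1 2 (cell_mx v)) 0.
  have [x0 x1 x2] := xrowE3 (cell_mx v) 0.
  set v' := vec3 _ _ _; have [y0 y1 y2] := xrowE3 (cell_mx v') 0.
  apply: ord3P; rewrite ?p0 ?p1 ?p2 ?x0 ?x1 ?x2 ?y0 ?y1 ?y2 !mxE /= ?mxE /= //.
  by rewrite mulrA tt mul1r.
have [p0 p1 p2] := psi_mulE t (xrow 1 2 (cell_mx v)) 1.
have [x0 x1 x2] := xrowE3 (cell_mx v) 1.
set v' := vec3 _ _ _; have [y0 y1 y2] := xrowE3 (cell_mx v') 1.
by apply: ord3P; rewrite ?p0 ?p1 ?p2 ?x0 ?x1 ?x2 ?y0 ?y1 ?y2 !mxE /= ?mxE /=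
  ?mulr0 ?mul0r ?mul1r ?addr0.
Qed.

(** The second vector r + y e3 is divided by y to become e3 + r / y, which respects orientations
    only for y > 0. *)
Lemma big_cell_transition v : 0 < v 0 1 ->
  big_cell (basis_mx q r) v = big_cell basis_mx' (vec3 (v 0 2) (v 0 1)^-1 (v 0 0)).
Proof.
move=> v1; have uB := basis_mx_unit b0; have uB' := basis_mx'_unit.
rewrite !big_cellE basis_mx'_mul; apply/oflag_of_eqP; rewrite -?basis_mx'_mul ?rank_cell//.
rewrite basis_mx'_mul; apply: oriented_equiv_mul; apply/oriented_equivP.
exists 1, (v 0 1)^-1, 0; split; rewrite ?invr_gt0//.
  set v' := vec3 _ _ _; have [y0 y1 y2] := xrowE3 (cell_mx v') 0.
  by apply: ord3P; rewrite ?y0 ?y1 ?y2 !mxE /= ?mxE /= ?mul1r ?addr0.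
set v' := vec3 _ _ _; have [y0 y1 y2] := xrowE3 (cell_mx v') 1.
apply: ord3P; rewrite ?y0 ?y1 ?y2 !mxE /= ?mxE /= ?mul0r ?mulr0 ?mulr1 ?addr0//.
by rewrite mulVf// gt_eqF.
Qed.

End ModelCharts.

Section Model.
Context {R : realType} (d : nat) (h : 'I_d -> @SL2 R).
Local Notation M := (compactification h).
Local Notation X := (set_type (hatOmega h)).
Local Notation proj := Defs.proj.
Local Notation R3 := 'rV[R]_3.

(** What the dynamical arguments retain from the choice of [q]: two slabs on which the flow is
    linear, and the change of charts between them. *)
Record model_charts (q r : 'cV[R]_2) (e : R) (c0 c1 : @chart R M) : Prop := ModelCharts {
  model_gt0 : 0 < e;
  model_bracket : bracket q r != 0;
  model_limit_set : ~ limit_set h q;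
  model_dom0 : c0.1 = [set v | `|v 0 0| < e];
  model_dom1 : c1.1 = [set v | `|v 0 2| < e];
  model_atlas0 : atlas h c0;
  model_atlas1 : atlas h c1;
  model_lift0 : forall v, c0.1 v ->
    exists2 x, val x = big_cell (basis_mx q r) v & c0.2 v = proj h x;
  model_flow0 : forall t v, c0.1 v -> flow h t (c0.2 v) =
    c0.2 (vec3 (v 0 0) (expR (- (t / 2)) * v 0 1) (expR (- (t / 2)) * v 0 2));
  model_flow1 : forall t v, c1.1 v -> flow h t (c1.2 v) =
    c1.2 (vec3 (expR (- (t / 2)) * v 0 0) (expR (t / 2) * v 0 1) (v 0 2));
  model_transition : forall v, c0.1 v -> 0 < v 0 1 ->
    c0.2 v = c1.2 (vec3 (v 0 2) (v 0 1)^-1 (v 0 0)) }.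

Lemma open_slab (i : 'I_3) (e : R) : open [set v : R3 | `|v 0 i| < e].
Proof.
apply: (@open_comp _ _ (fun v : R3 => `|v 0 i|) [set x | x < e]) => [v _|]; last exact: open_lt.
apply: (@continuous_comp _ _ _ (fun v : R3 => v 0 i) (fun x : R => `|x|)).
  exact: coord_continuous.
exact: norm_continuous.
Qed.

Lemma model_charts_ex : (0 < d)%N -> positive_hyperbolic h -> schottky (gen h) ->
  exists q r e c0 c1, model_charts q r e c0 c1.
Proof.
move=> d0 hyp sch; have [q [r [e [e0 b0 free]]]] := free_cone d0 hyp sch.
have uB := basis_mx_unit b0; have uB' := basis_mx'_unit b0.
have E0 (v : R3) : `|v 0 0| < e -> `|v 0 0| < e /\ basis_mx q r *m col 0 (cell_mx v) =
    in_plane12 (q + v 0 0 *: r) + v 0 2 *: e3.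
  by move=> ve; split=> //; have [-> _] := basis_mx_col q r v.
have E1 (v : R3) : `|v 0 2| < e -> `|v 0 2| < e /\ basis_mx' q r *m col 0 (cell_mx v) =
    in_plane12 (q + v 0 2 *: r) + v 0 0 *: e3.
  move=> ve; split=> //; rewrite basis_mx'_mul basis_mxE.
  have [-> -> ->] := xrowE3 (col 0 (cell_mx v)) 0.
  by rewrite !mxE /= scale1r.
have n0 : `|(0 : R3) 0 0| < e by rewrite mxE normr0.
have in0 : oflag_of (basis_mx q r *m cell_mx 0) \in hatOmega h.
  have [_ E00] := E0 _ n0.
  by rewrite inE; apply: (cone_hatOmega e0 b0 free (rank_cell 0 uB) n0); rewrite col_mulmx; exact: E00.
pose x0 : X := SigSub in0.
have [A0 L0] := cone_chart e0 b0 free x0 uB (@open_slab 0 e) E0.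
have [A1 L1] := cone_chart e0 b0 free x0 uB' (@open_slab 2 e) E1.
set c0 : chart := (_, _) in A0; set c1 : chart := (_, _) in A1.
exists q, r, e, c0, c1; split=> //.
- apply: (cone_notin_limit_set e0 b0 free (oner_neq0 _) (s := 0)); rewrite ?normr0//.
  by rewrite scale0r addr0 scale1r.
- by move=> v cv; exists (insubd x0 (big_cell (basis_mx q r) v)) => //; exact: L0.
- move=> t v cv; rewrite flow_proj; congr (proj h _); apply: val_inj => /=.
  by rewrite !L0//= ?mxE// psi_big_cell.
- move=> t v cv; rewrite flow_proj; congr (proj h _); apply: val_inj => /=.
  by rewrite !L1//= ?mxE// psi_big_cell'.
- move=> v cv v1; congr (proj h _); apply: val_inj => /=.
  by rewrite L0// L1//= ?mxE// -big_cell_transition.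
Qed.

End Model.

(** * The four dynamical properties *)

Section Scaling.
Context {R : realType} (d : nat) (h : 'I_d -> @SL2 R).
Local Notation M := (compactification h).
Local Notation R3 := 'rV[R]_3.
Context (q r : 'cV[R]_2) (e : R) (c0 c1 : @chart R M).
Hypothesis mod : model_charts q r e c0 c1.

Definition scale3 (a b c : R) (v : R3) : R3 := vec3 (a * v 0 0) (b * v 0 1) (c * v 0 2).

Lemma scale3_continuous {T : topologicalType} (g : T -> R3) a b k :
  continuous g -> continuous (fun x => scale3 a b k (g x)).
Proof.
move=> cg x; apply: cvg_mx => i j; rewrite mxE; under eq_fun do rewrite mxE.
have cc l : g y 0 l @[y --> x] --> g x 0 l by exact: (cvg_coord 0 l (cg x)).
by case: j => -[|[|[|//]]] j3 /=; apply: cvgM => //; exact: cvg_cst.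
Qed.

Lemma tangent_scale3 (f : M -> M) c a b k x v :
  at_chart (atlas h) c x ->
  (forall z, c.1 z -> c.1 (scale3 a b k z) /\ c.2 (scale3 a b k z) = f (c.2 z)) ->
  tangent_map (atlas h) f c x v c (scale3 a b k x) (scale3 a b k v).
Proof.
move=> cx fc.
have lL : linear (scale3 a b k).
  by move=> m y z; apply: row3P; rewrite !mxE /= ?mxE; lra.
pose L : {linear R3 -> R3} := HB.pack (scale3 a b k) (GRing.isLinear.Build _ _ _ _ _ lL).
have cL : continuous L.
  by apply: scale3_continuous => z; exact: cvg_id.
have dL : differentiable L x by exact: linear_differentiable.
have -> : scale3 a b k v = 'd L x v by rewrite diff_lin.
exists L; split=> //; split=> //; first by split; [case: cx|have [] := fc _ cx.2].
by apply: filterS (chart_nbhs cx.1 cx.2) => z /fc.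
Qed.

Lemma at_chart0 (x : R3) : `|x 0 0| < e -> at_chart (atlas h) c0 x.
Proof. by move=> xe; split; [exact: model_atlas0 mod|rewrite (model_dom0 mod)]. Qed.

Lemma at_chart1 (x : R3) : `|x 0 2| < e -> at_chart (atlas h) c1 x.
Proof. by move=> xe; split; [exact: model_atlas1 mod|rewrite (model_dom1 mod)]. Qed.

Lemma tangent_flow0 t (x v : R3) : `|x 0 0| < e ->
  tangent_map (atlas h) (flow h t) c0 x v c0
    (scale3 1 (expR (- (t / 2))) (expR (- (t / 2))) x)
    (scale3 1 (expR (- (t / 2))) (expR (- (t / 2))) v).
Proof.
move=> xe; apply: tangent_scale3; first exact: at_chart0.
move=> z c0z; rewrite /scale3 mul1r; split; last by rewrite (model_flow0 mod).
by move: c0z; rewrite (model_dom0 mod) /= !mxE.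
Qed.

Lemma tangent_flow1 t (x v : R3) : `|x 0 2| < e ->
  tangent_map (atlas h) (flow h t) c1 x v c1
    (scale3 (expR (- (t / 2))) (expR (t / 2)) 1 x)
    (scale3 (expR (- (t / 2))) (expR (t / 2)) 1 v).
Proof.
move=> xe; apply: tangent_scale3; first exact: at_chart1.
move=> z c1z; rewrite /scale3 mul1r; split; last by rewrite (model_flow1 mod).
by move: c1z; rewrite (model_dom1 mod) /= !mxE.
Qed.

Lemma independent_neq0 k (Y : 'I_k -> R3) i : independent Y -> Y i != 0.
Proof.
move=> iY; apply/eqP => Yi.
have s0 : \sum_j (j == i)%:R *: Y j = 0.
  by apply: big1 => j _; case: eqVneq => [->|]; rewrite ?Yi ?scaler0 ?scale0r.
by have /eqP := iY _ s0 i; rewrite eqxx oner_eq0.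
Qed.

Lemma span_ofB k (Y : 'I_k -> R3) v w : span_of Y v -> span_of Y w -> span_of Y (v - w).
Proof.
move=> [a ->] [b ->]; exists (fun i => a i - b i).
by rewrite -sumrB; apply: eq_bigr => i _; rewrite scalerBl.
Qed.

(** At the fixed point the differential is diag(1, l, l) with l != 1. A vector of the subspace
    either is fixed, or differs from its image by a nonzero vector of the subspace lying in the
    l-eigenspace. *)
Lemma invariant_eigenvector k (E : @tfield R M) (t : R) :
  (0 < k)%N -> t != 0 -> continuous_distribution (atlas h) k E ->
  preserves (atlas h) (flow h t) E ->
  exists v : R3, [/\ v != 0, E c0 0 v &
    (v 0 1 = 0 /\ v 0 2 = 0) \/ v 0 0 = 0].
Proof.
move=> k0 t0 [_ cE] pE.
have n0 : `|(0 : R3) 0 0| < e by rewrite mxE normr0 (model_gt0 mod).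
have [Y lY _] := cE c0 0 (at_chart0 n0).
have [iY spY] := nbhs_singleton lY.
pose v := Y (Ordinal k0) 0.
have Ev : E c0 0 v.
  rewrite spY; exists (fun j => (j == Ordinal k0)%:R).
  rewrite (bigD1 (Ordinal k0))// eqxx scale1r big1 /= ?addr0// => j /negPf ->.
  by rewrite scale0r.
have v0 : v != 0 by exact: (independent_neq0 _ iY).
set l := expR (- (t / 2)).
have s0 : scale3 1 l l 0 = 0 by apply: row3P; rewrite !mxE /= ?mxE mulr0.
have Ew : E c0 0 (scale3 1 l l v).
  have := tangent_flow0 t v n0; rewrite -/l s0 => /pE <-.
  exact: Ev.
have [/andP[/eqP v1 /eqP v2]|nv] := boolP ((v 0 1 == 0) && (v 0 2 == 0)).
  by exists v; split=> //; left.
have l1 : l - 1 != 0.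
  rewrite subr_eq0 /l -expR0 (inj_eq (@expR_inj R)) oppr_eq0 mulf_neq0//.
exists (scale3 1 l l v - v); split.
- apply: contra nv => /eqP/rowP E0; have := E0 1; have := E0 2.
  rewrite !mxE /= => e2 e1.
  have z x : l * x - x = 0 -> x == 0.
    move=> ex; have /eqP : (l - 1) * x = 0 by rewrite mulrBl mul1r.
    by rewrite mulf_eq0 (negPf l1).
  by rewrite !z.
- by rewrite spY; apply: span_ofB; rewrite -spY.
- by right; rewrite !mxE /= mul1r subrr.
Qed.

Lemma geometric_unbounded (C k : R) : 0 < k -> k < 1 -> ~ (forall n, 1 <= C * k ^+ n).
Proof.
move=> k0 k1 H.
have ck : C * k ^+ n @[n --> \oo] --> C * 0.
  by apply: cvgM; [exact: cvg_cst|apply: cvg_expr; rewrite gtr0_norm].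
rewrite mulr0 in ck.
have : \forall n \near \oo, C * k ^+ n < 1 by exact: cvgr_lt ck _ ltr01.
by move=> /filter_ex[n]; rewrite ltNge H.
Qed.

Lemma quadZ (G : 'M[R]_3) (k : R) v : quad G (k *: v) = k ^+ 2 * quad G v.
Proof. by rewrite /quad linearZ /= -!scalemxAl -scalemxAr !mxE mulrA -expr2. Qed.

Lemma not_partially_hyperbolic (t : R) : t != 0 -> ~ partially_hyperbolic (atlas h) (flow h t).
Proof.
move=> t0 [G [[Gpos _ _] [Es [Ec [Eu [ks [kc [ku]]]]]]]].
move=> [[ks0 _ ku0] [cs _ cu] _ [ps _ pu] [contr expand _ _]].
have n0 : `|(0 : R3) 0 0| < e by rewrite mxE normr0 (model_gt0 mod).
have at0 := at_chart0 n0.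
have [_ Gp] := Gpos _ _ at0.
have tZ (k : R) (v : R3) : tnorm G c0 0 (k *: v) = `|k| * tnorm G c0 0 v.
  by rewrite /tnorm quadZ sqrtrM ?sqr_ge0// sqrtr_sqr.
have tp (v : R3) : v != 0 -> 0 < tnorm G c0 0 v by move=> /Gp; rewrite /tnorm sqrtr_gt0.
have iterE n (v : R3) : (v 0 1 = 0 /\ v 0 2 = 0) \/ v 0 0 = 0 ->
    exists2 k : R, k = 1 \/ k = expR (- (n%:R * t / 2)) &
    tangent_map (atlas h) (iter n (flow h t)) c0 0 v c0 0 (k *: v).
  move=> vE; have := tangent_flow0 (n%:R * t) v n0; rewrite -iter_flow.
  have -> a : scale3 1 a a 0 = 0 :> R3 by apply: row3P; rewrite !mxE /= ?mxE mulr0.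
  case: vE => [[v1 v2]|v0] tm; [exists 1; [by left|]|exists (expR (- (n%:R * t / 2))); [by right|]].
    move: tm; rewrite scale1r; set a := expR _.
    have -> : scale3 1 a a v = v by apply: row3P; rewrite !mxE /= ?v1 ?v2 ?mulr0 ?mul1r.
    by [].
  move: tm; set a := expR _.
  have -> : scale3 1 a a v = a *: v by apply: row3P; rewrite !mxE /= ?v0 ?mulr0.
  by [].
(* For positive t the eigenvalues of all iterates are at most 1, against expansion; for negative t
   they are at least 1, against contraction. *)
have [tpos|tneg] := ltP 0 t.
  have [u [u0 Eu0 uE]] := invariant_eigenvector ku0 t0 cu pu.
  have [C [k [C0 k0 k1 H]]] := expand.
  apply: (@geometric_unbounded C k k0 k1) => n.
  have [m mE tm] := iterE n u uE; have := H n _ _ _ _ _ _ tm Eu0; rewrite tZ.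
  have m01 : 0 <= m <= 1.
    case: mE => ->; rewrite ?ler01 ?lexx// expR_ge0/= -expR0 ler_expR oppr_le0.
    by rewrite divr_ge0// mulr_ge0// ltW.
  move: m01 => /andP[m0 m1]; rewrite (ger0_norm m0) mulrA -ler_pdivrMr ?tp// divff ?gt_eqF ?tp//.
  move=> /le_trans; apply; rewrite ler_piMr// mulr_ge0 ?exprn_ge0// ltW//.
have [u [u0 Eu0 uE]] := invariant_eigenvector ks0 t0 cs ps.
have [C [k [C0 k0 k1 H]]] := contr.
apply: (@geometric_unbounded C k k0 k1) => n.
have [m mE tm] := iterE n u uE; have := H n _ _ _ _ _ _ tm Eu0; rewrite tZ ler_pM2r ?tp//.
apply: le_trans; case: mE => ->; first by rewrite normr1.
rewrite ger0_norm ?expR_ge0// -[X in X <= _]expR0 ler_expR oppr_ge0 mulr_le0_ge0// ?invr_ge0//.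
by rewrite mulr_ge0_le0.
Qed.

End Scaling.

(** * Strong essentiality *)

Section StronglyEssential.
Context {R : realType} (d : nat) (h : 'I_d -> @SL2 R).
Local Notation M := (compactification h).
Local Notation R3 := 'rV[R]_3.
Context (q r : 'cV[R]_2) (e : R) (c0 c1 : @chart R M).
Hypothesis mod : model_charts q r e c0 c1.

(** Transported from (0, s, 0) to (0, k s, 0), the direction of v has first and third components in
    the ratio v0 : k v2. As k tends to 0 it must approach the line at 0, whose third component is
    nonzero by transversality, so v0 = 0. The factor [a] covers the different scalings in the two
    charts: 1 in the first, 1/k in the second. *)
Lemma transverse_contracted (T : @tfield R M) c :
  continuous_distribution (atlas h) 1 T ->
  transverse (atlas h) T (sum_field (E_alpha h) (E_beta h)) ->
  at_chart (atlas h) c 0 ->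
  (forall (k s : R) (v : R3), 0 < k -> T c (vec3 0 s 0) v ->
     exists (w : R3) (a : R), [/\ T c (vec3 0 (k * s) 0) w, 0 < a,
       w 0 0 = a * v 0 0 & w 0 2 = a * (k * v 0 2)]) ->
  forall (s : R) (v : R3), T c (vec3 0 s 0) v -> v 0 0 = 0.
Proof.
move=> [_ cT] trT c0' inv s v Tv.
have [Y lY cY] := cT c 0 c0'.
pose y z := Y 0 z.
have lY' : \forall z \near (0 : R3), T c z = [set w | exists a : R, w = a *: y z].
  apply: filterS lY => z [_ ->]; rewrite -span_of1; congr span_of.
  by apply/funext => i; rewrite ord1.
(* At the centre of the chart the contact plane is the kernel of the third coordinate. *)
have y2 : y 0 0 2 != 0.
  apply/eqP => y20; have := trT c 0 c0' => /seteqP[_ /(_ (vec3 0 0 1) I)].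
  move=> [a [b [Ta]]]; rewrite (sum_fieldE c0') /= mxE mul0r => b2 /rowP/(_ 2).
  move: Ta; rewrite (nbhs_singleton lY') => -[k ->].
  by rewrite !mxE /= y20 b2 mulr0 addr0 => /eqP; rewrite oner_eq0.
have cv : (fun k : R => vec3 0 (k * s) 0) @ 0^'+ --> (0 : R3).
  apply: cvg_mx => i j; rewrite mxE; under eq_fun do rewrite mxE.
  case: j => -[|[|[|//]]] j3 /=; [exact: cvg_cst| |exact: cvg_cst].
  have : k * s @[k --> 0^'+] --> 0 * s.
    by apply: cvgM; [exact: cvg_at_right_filter cvg_id|exact: cvg_cst].
  by rewrite mul0r.
have cy : y (vec3 0 (k * s) 0) @[k --> 0^'+] --> y 0.
  by apply: (cvg_comp _ _ cv); exact: nbhs_singleton (cY 0).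
have near_eq : \forall k \near 0^'+,
    v 0 0 * y (vec3 0 (k * s) 0) 0 2 = k * v 0 2 * y (vec3 0 (k * s) 0) 0 0.
  have nl : \forall k \near (0 : R)^'+, T c (vec3 0 (k * s) 0) =
      [set w | exists a : R, w = a *: y (vec3 0 (k * s) 0)] by exact: cv lY'.
  apply: filterS2 nl (nbhs_right_gt 0) => k lk k0.
  have [w [a [Tw a0 w0 w2]]] := inv k s v k0 Tv.
  move: Tw; rewrite lk => -[m ew].
  have e0 : m * y (vec3 0 (k * s) 0) 0 0 = a * v 0 0 by rewrite -w0 ew mxE.
  have e2 : m * y (vec3 0 (k * s) 0) 0 2 = a * (k * v 0 2) by rewrite -w2 ew mxE.
  have a0' : a != 0 by rewrite gt_eqF.
  by apply: (mulfI a0'); rewrite !mulrA -e0 -(mulrA a k) -e2; lra.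
have c2 : v 0 0 * y (vec3 0 (k * s) 0) 0 2 @[k --> 0^'+] --> v 0 0 * y 0 0 2.
  by apply: cvgM; [exact: cvg_cst|exact: (cvg_coord 0 2 cy)].
have c00 : k * v 0 2 * y (vec3 0 (k * s) 0) 0 0 @[k --> 0^'+] --> 0 * v 0 2 * y 0 0 0.
  apply: cvgM; last exact: (cvg_coord 0 0 cy).
  apply: cvgM; last exact: cvg_cst.
  exact: cvg_at_right_filter cvg_id.
have : v 0 0 * y 0 0 2 = 0 * v 0 2 * y 0 0 0.
  apply: (cvg_unique _ c2); first exact: norm_hausdorff.
  apply: cvg_trans c00; apply: near_eq_cvg.
  by apply: filterS near_eq => k ->.
by rewrite !mul0r => /eqP; rewrite mulf_eq0 (negPf y2) orbF => /eqP.
Qed.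

Lemma near_pos {T : topologicalType} (f : T -> R) (x : T) :
  {for x, continuous f} -> 0 < f x -> \forall z \near x, 0 < f z.
Proof. by move=> cf fx; exact: cvgr_gt cf _ fx. Qed.

Lemma strongly_essential_flow :
  strongly_essential (atlas h) (E_alpha h) (E_beta h) (flow h).
Proof.
move=> [T [cT trT pT]]; have e0 := model_gt0 mod.
have n0 (a b : R) : `|(vec3 0 a b) 0 0| < e by rewrite mxE normr0.
have n1 (a b : R) : `|(vec3 a b 0) 0 2| < e by rewrite mxE normr0.
have vec30 : vec3 0 0 0 = 0 :> R3 by apply: row3P; rewrite !mxE.
have expE (k : R) : 0 < k -> exists t, expR (- (t / 2)) = k /\ expR (t / 2) = k^-1.
  move=> k0; exists (- (2 * ln k)); rewrite mulNr opprK mulrAC mulfV ?pnatr_eq0// mul1r.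
  by rewrite expRN !lnK.
have H0 : forall (s : R) (v : R3), T c0 (vec3 0 s 0) v -> v 0 0 = 0.
  apply: transverse_contracted => //; first by rewrite -vec30; exact: (at_chart0 mod).
  move=> k s v k0 Tv; have [t [tk _]] := expE k k0.
  have tm := tangent_flow0 mod t v (n0 s 0); rewrite tk in tm.
  exists (scale3 1 k k v), 1; split=> //; last 2 first.
  - by rewrite mxE.
  - by rewrite mxE /= mul1r.
  have -> : vec3 0 (k * s) 0 = scale3 1 k k (vec3 0 s 0).
    by apply: row3P; rewrite !mxE /= ?mxE /= ?mulr0.
  exact/(pT t _ _ _ _ _ _ tm).
have H1 : forall (s : R) (v : R3), T c1 (vec3 0 s 0) v -> v 0 0 = 0.
  apply: transverse_contracted => //; first by rewrite -vec30; exact: (at_chart1 mod).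
  (* In the second chart the leaf coordinate is multiplied by e^(t/2), so time is reversed in order
     to approach the centre. *)
  move=> k s v k0 Tv; have [|t [tk tV]] := expE k^-1; first by rewrite invr_gt0.
  have tm := tangent_flow1 mod t v (n1 0 s); rewrite tk tV invrK in tm.
  exists (scale3 k^-1 k 1 v), k^-1; split=> //; rewrite ?invr_gt0//; last 2 first.
  - by rewrite mxE.
  - by rewrite mxE /= mul1r mulKf// gt_eqF.
  have -> : vec3 0 (k * s) 0 = scale3 k^-1 k 1 (vec3 0 s 0).
    by apply: row3P; rewrite !mxE /= ?mxE /= ?mulr0.
  exact/(pT t _ _ _ _ _ _ tm).
(* The leaf point with y = 1 is fixed by y -> 1/y, so it has the same coordinates in both charts. *)
pose x : R3 := vec3 0 1 0.
have x0 : at_chart (atlas h) c0 x by apply: (at_chart0 mod); exact: n0.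
have x1 : at_chart (atlas h) c1 x by apply: (at_chart1 mod); exact: n1.
have ex : c0.2 x = c1.2 x.
  rewrite (model_transition mod) ?mxE//=; last exact: x0.2.
  by congr c1.2; apply: row3P; rewrite !mxE /= ?mxE /= ?invr1.
have [|F lF sF] := @flow_local_expr _ _ h 0 c0 x c1 x x0 x1.
  by rewrite flow0 ex.
rewrite flow0 in lF.
have dF := smooth_near_differentiable sF.
(* The change of charts exchanges the first and third coordinates, so the constraint from the second
   chart becomes v2 = 0 in the first. Together with v0 = 0 it puts the line field inside the contact
   plane. *)
have F0 : \forall z \near x, F z 0 0 = (z : R3) 0 2.
  have [_ _ _ nF] := lF.
  have n01 : \forall z \near x, 0 < (z : R3) 0 1.
    by apply: (near_pos (f := fun z : R3 => z 0 1)); [exact: coord_continuous|rewrite mxE].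
  apply: filterS3 nF n01 (chart_nbhs x0.1 x0.2) => z [cF eF] z1 cz.
  have c1v : c1.1 (vec3 (z 0 2) (z 0 1)^-1 (z 0 0)).
    by move: cz; rewrite (model_dom1 mod) (model_dom0 mod) /= mxE.
  rewrite (chart_inj x1.1 cF c1v); first by rewrite mxE.
  by rewrite eF -(model_transition mod).
have T02 (v : R3) : T c0 x v -> v 0 2 = 0.
  move=> Tv; have tm : tangent_map (atlas h) id c0 x v c1 x ('d F x v) by exists F.
  have /H1 : T c1 x ('d F x v) by have [comp _] := cT; exact/(comp _ _ _ _ _ _ tm).
  rewrite diff_coord//.
  by rewrite (near_eq_derive v F0) derive_coord.
have := trT c0 x x0 => /seteqP[_ /(_ (vec3 0 0 1) I)].
move=> [a [b [Ta]]]; rewrite (sum_fieldE x0) /= => b2 /rowP E.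
have := E 0; have := E 2; rewrite !mxE /= (H0 _ _ Ta) (T02 _ Ta) !add0r b2 => e2 e0'.
by move: e2; rewrite -e0' mulr0 => /eqP; rewrite oner_eq0.
Qed.

End StronglyEssential.

(** * Absence of invariant absolutely continuous measures *)

Section NullSets.
Context {R : realType}.
Local Notation R3 := 'rV[R]_3.

Lemma lebesgue_null_slice (k : R) (A : set R3) :
  (forall v, A v -> v 0 1 = k) -> lebesgue_null A.
Proof.
move=> Ak; rewrite /lebesgue_null.
exists (([set: R] `*` [set k]) `*` [set: R]); split.
- by apply: measurableX => //; apply: measurableX.
- rewrite product_measure1E//; last by apply: measurableX.
  have z : (@lebesgue_measure R \x @lebesgue_measure R)%E ([set: R] `*` [set k]) = 0%E.
    rewrite product_measure1E// [X in (_ * X)%E](_ : _ = 0%E) ?mule0//.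
    exact: lebesgue_measure_set1.
  by rewrite [X in (X * _)%E](_ : _ = 0%E) ?mul0e.
- by move=> p /= /Ak; rewrite mxE /=.
Qed.

End NullSets.

Section Conservative.
Context {R : realType} (d : nat) (h : 'I_d -> @SL2 R).
Local Notation M := (compactification h).
Local Notation X := (set_type (hatOmega h)).
Local Notation proj := Defs.proj.
Local Notation R3 := 'rV[R]_3.
Context (q r : 'cV[R]_2) (e : R) (c0 c1 : @chart R M).
Hypothesis mod : model_charts q r e c0 c1.

(** The third entry [B 2 1 + y * B 2 2] of the second vector must vanish, which fixes y; if [B 2 2]
    were 0, the whole third row of [B] would be. *)
Lemma big_cell_plane12_slice (B : 'M[R]_3) : B \in unitmx ->
  exists k, forall v, (val (forget (big_cell B v))).2 = plane12 -> v 0 1 = k.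
Proof.
move=> uB; exists (- (B 2 1 / B 2 2)) => v.
rewrite big_cellE val_forget ?rank_cell//= => E.
have H (j : 'I_2) : (B *m cell_mx v) 2 j = 0.
  have : col j (B *m cell_mx v) \in plane12.
    rewrite -E; have [->|->] := ord2P j.
      exact: subvP (addvSl _ _) _ (memv_line _).
    exact: subvP (addvSr _ _) _ (memv_line _).
  by rewrite mem_plane12 mxE => /eqP.
have := H 0; have := H 1; rewrite !mxE !sum3E !mxE /= => h1 h0.
have b2 : B 2 2 != 0.
  apply/eqP => b2; have b1 : B 2 1 = 0 by move: h1; rewrite b2; lra.
  have b00 : B 2 0 = 0 by move: h0; rewrite b2 b1; lra.
  have : row 2 B *m invmx B = 0.
    rewrite (_ : row 2 B = 0) ?mul0mx//.
    by apply: row3P; rewrite !mxE.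
  rewrite -row_mul mulmxV// => /rowP/(_ 2); rewrite !mxE eqxx => /eqP.
  by rewrite oner_eq0.
apply: (mulfI b2); rewrite mulrN [B 2 2 * (_ / _)]mulrC divfK//; lra.
Qed.

Definition boundary_part : set M :=
  [set m | exists2 x : X, (val (forget (val x))).2 = plane12 & m = proj h x].

(** The group preserves [e1,e2], so the chart's own lift also has this plane and lies in one slice
    of the cell. *)
Lemma null_boundary_part (A : set M) : A `<=` boundary_part -> Defs.null_set (atlas h) A.
Proof.
move=> AS c [_ _ [B uB cB]]; have [k Hk] := big_cell_plane12_slice uB.
apply: (@lebesgue_null_slice _ k) => v [cv /AS [x xS ex]]; apply: Hk.
have [y ey cy] := cB v cv; rewrite cy in ex.
have /proj_eqP[D GD eD] := esym ex; rewrite -ey eD.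
have [A' [s [GA s1 ED]]] := (hatGammaP _ _).1 GD.
rewrite (forget_act _ (hatGamma_unit GD)).
rewrite -[LHS]/(linfun (mulmx D) @: (val (forget (val x))).2)%VS xS ED limg_j_mx_plane12//.
have uA' := Gamma0_unit GA.
have us : s \is a GRing.unit by case: s1 => ->; rewrite ?unitrN unitr1.
by rewrite unitmxZ.
Qed.

(** With k the contraction factor, the sides k^n make the flow map each tube exactly onto the next
    one. *)
Definition box (k : R) (n : nat) : set R3 :=
  [set v | [/\ `|v 0 0| < e, `|v 0 1| < k ^+ n & `|v 0 2| < k ^+ n]].

Definition tube (k : R) (n : nat) : set M := [set c0.2 v | v in box k n].

Lemma box_dom k n v : box k n v -> c0.1 v.
Proof. by move=> [v0 _ _]; rewrite (model_dom0 mod). Qed.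

Lemma tube_open k n : open (tube k n).
Proof.
have -> : tube k n = [set m | exists2 x, (big_cell (basis_mx q r) @` box k n) (val x) & m = proj h x].
  apply/seteqP; split=> m.
    move=> [v bv <-]; have [x ex cx] := model_lift0 mod (box_dom bv).
    by exists x => //; exists v.
  move=> [x [v bv ev] ->]; exists v => //.
  have [y ey ->] := model_lift0 mod (box_dom bv).
  by congr (proj h _); apply: val_inj; rewrite ey ev.
apply: proj_open; apply: big_cell_open; first exact: basis_mx_unit (model_bracket mod).
have -> : box k n = [set v | `|v 0 0| < e] `&`
    ([set v | `|v 0 1| < k ^+ n] `&` [set v | `|v 0 2| < k ^+ n]).
  by apply/seteqP; split=> v /=; [move=> [a b c]; split|move=> [a [b c]]; split].
by apply: openI; [exact: open_slab|apply: openI; exact: open_slab].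
Qed.

Lemma tube_flow (t : R) n m : expR (- (t / 2)) < 1 ->
  tube (expR (- (t / 2))) n m -> tube (expR (- (t / 2))) n.+1 (flow h t m).
Proof.
set k := expR _ => k1 [v bv <-].
rewrite (model_flow0 mod) ?(box_dom bv)//; last exact: box_dom bv.
have [v0 v1 v2] := bv; exists (vec3 (v 0 0) (k * v 0 1) (k * v 0 2)) => //.
have k0 : 0 < k by exact: expR_gt0.
by split; rewrite !mxE /= ?normrM ?(gtr0_norm k0) ?exprS ?ltr_pM2l.
Qed.

Lemma tube_flowN (t : R) n m :
  tube (expR (- (t / 2))) n.+1 m -> tube (expR (- (t / 2))) n (flow h (- t) m).
Proof.
set k := expR _ => -[v bv <-].
rewrite (model_flow0 mod); last exact: box_dom bv.
have k0 : 0 < k by exact: expR_gt0.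
have -> : expR (- (- t / 2)) = k^-1 by rewrite /k -expRN mulNr opprK.
have [v0 v1 v2] := bv; exists (vec3 (v 0 0) (k^-1 * v 0 1) (k^-1 * v 0 2)) => //.
move: v1 v2; rewrite exprS => v1 v2; split; rewrite !mxE //= normrM normfV (gtr0_norm k0);
  by rewrite mulrC ltr_pdivrMr// mulrC.
Qed.

(** Injectivity of the chart puts a single coordinate vector into all the boxes; only the flags (q +
    x r, [e1,e2]) remain. *)
Lemma tube_bigcap (k : R) : 0 < k -> k < 1 -> \bigcap_n tube k n `<=` boundary_part.
Proof.
move=> k0 k1 m Tm; have [v bv cv] := Tm 0%N I.
have Bv n : box k n v.
  have [w bw cw] := Tm n I; suff -> : v = w by [].
  apply: (chart_inj (model_atlas0 mod)); [exact: box_dom bv|exact: box_dom bw|].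
  by rewrite cv cw.
have z (x : R) : (forall n, `|x| < k ^+ n) -> x = 0.
  move=> xk; apply/eqP; rewrite -normr_eq0 -[_ == 0]negbK; apply/negP => x0.
  have := @geometric_unbounded R `|x|^-1 k k0 k1; apply=> n.
  by rewrite mulrC ler_pdivlMr ?lt_neqAle 1?eq_sym ?x0 ?normr_ge0// mul1r ltW.
have v1 : v 0 1 = 0 by apply: z => n; have [] := Bv n.
have v2 : v 0 2 = 0 by apply: z => n; have [] := Bv n.
have [x ex cx] := model_lift0 mod (box_dom bv).
exists x; last by rewrite -cx cv.
have uB := basis_mx_unit (model_bracket mod).
rewrite ex big_cellE val_forget ?rank_cell//= !col_mulmx.
have [-> ->] := basis_mx_col q r v; rewrite v1 v2 !scale0r !addr0.
apply: dim2_plane12.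
  have [_] := flag_dim (forget (big_cell (basis_mx q r) v)).
  rewrite big_cellE val_forget ?rank_cell//= !col_mulmx.
  by have [-> ->] := basis_mx_col q r v; rewrite v1 v2 !scale0r !addr0.
move=> _ /memv_addP[_ /vlineP[a ->] [_ /vlineP[b ->] ->]]; rewrite lincombE.
have [_ _ ->] := in_plane12E (q + v 0 0 *: r); have [_ _ ->] := in_plane12E r.
by rewrite !mulr0 addr0.
Qed.

Lemma not_conservative t : t != 0 -> ~ conservative (atlas h) (flow h t).
Proof.
move=> t0 [p [mu [ac pos inv]]].
(* Tubes shrink under the flow at the positive time |t|; invariance under time t is then used
   directly or through the inverse. *)
pose s := `|t|; pose k := expR (- (s / 2)).
have s0 : 0 < s by rewrite normr_gt0.
have k0 : 0 < k by exact: expR_gt0.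
have k1 : k < 1 by rewrite -expR0 ltr_expR oppr_lt0 divr_gt0.
pose T n : set (borel p) := tube k n.
have mT n : measurable (T n) by apply: sub_sigma_algebra; exact: tube_open.
have preS n : flow h s @^-1` (T n.+1) = T n.
  apply/seteqP; split=> m /=; last exact: tube_flow.
  by move=> /tube_flowN; rewrite flowNK.
have preN n : flow h (- s) @^-1` (T n) = T n.+1.
  apply/seteqP; split=> m /=; last exact: tube_flowN.
  by move=> /(tube_flow k1); rewrite flowKN.
have muS n : mu (T n.+1) = mu (T n).
  have [tp|tn] := ltP 0 t.
    have ts : t = s by rewrite /s gtr0_norm.
    by rewrite -(preS n) -ts inv.
  have ts : t = - s by rewrite /s ler0_norm// opprK.
  by rewrite -(preN n) -ts inv.
have muT n : mu (T n) = mu (T 0%N) by elim: n => // n <-.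
have mcap : measurable (\bigcap_n T n) by exact: bigcapT_measurable.
have cap0 : mu (\bigcap_n T n) = 0%E.
  by apply: ac => //; apply: null_boundary_part; exact: tube_bigcap.
have T0 : (0 < mu (T 0%N))%E.
  apply: pos; first exact: tube_open.
  exists (c0.2 0); exists 0 => //.
  by split; rewrite mxE normr0 ?expr0 ?ltr01// (model_gt0 mod).
have ndT : nonincreasing_seq T.
  move=> n m nm; apply/subsetPset => _ [v [v0 v1 v2] <-]; exists v => //.
  have le : k ^+ m <= k ^+ n by rewrite ler_wiXn2l// ltW.
  by split=> //; exact: lt_le_trans le.
pose nu : {measure set (borel p) -> \bar R} := mu.
have nuE A : nu A = mu A by [].
have nuT n : nu (T n) = nu (T 0%N) by rewrite !nuE muT.
have Tfin : (nu (T 0%N) < +oo)%E by rewrite nuE ltey_eq fin_num_measure.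
(* All tubes have the positive mass of the first one, while continuity from above, for a finite
   measure, gives them the mass 0 of their intersection as limit. *)
have cvgT := @nonincreasing_cvg_mu _ (borel p) R nu T Tfin mT mcap ndT.
have := cvg_lim (@ereal_hausdorff R) cvgT.
rewrite (_ : nu \o T = cst (nu (T 0%N))); last exact/funext.
rewrite lim_cst; last exact: ereal_hausdorff.
by rewrite !nuE cap0 => E0; move: T0; rewrite E0 ltxx.
Qed.

End Conservative.

(** * Failure of equicontinuity *)

Section SmallOrbit.
Context {R : realType} (d : nat) (h : 'I_d -> @SL2 R).
Implicit Types (A : 'M[R]_2) (q : 'cV[R]_2).

Lemma invmx2E A : \det A = 1 ->
  [/\ invmx A 0 0 = A 1 1, invmx A 0 1 = - A 0 1, invmx A 1 0 = - A 1 0 & invmx A 1 1 = A 0 0].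
Proof.
move=> dA; have uA : A \in unitmx by rewrite unitmxE dA unitr1.
pose B : 'M[R]_2 := \matrix_(i, j) (if i == 0 then (if j == 0 then A 1 1 else - A 0 1)
  else (if j == 0 then - A 1 0 else A 0 0)).
have -> : invmx A = B.
  rewrite -[RHS](mulKmx uA) (_ : A *m B = 1%:M) ?mulmx1//.
  by move: dA; rewrite det2E => dA; apply: mx22P; rewrite !mxE sum2E !mxE /=; lra.
by rewrite !mxE.
Qed.

(* The i-th entry of [(A^T A) q / tr (A A^T)]. *)
Let gram_error A q i : R := (A 0 i * (A *m q) 0 0 + A 1 i * (A *m q) 1 0) / \tr (A *m A^T).

(** By Cauchy-Schwarz the numerator is at most sqrt(tr) |A q|, and the trace exceeds 1. *)
Lemma gram_error_le A q i (e : R) : 0 < e -> 2 <= \tr (A *m A^T) ->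
  (A *m q) 0 0 ^+ 2 + (A *m q) 1 0 ^+ 2 < e ^+ 2 -> `|gram_error A q i| < e.
Proof.
move=> e0; rewrite /gram_error mxtrace_mul_tr_mx.
set y0 := (A *m q) 0 0; set y1 := (A *m q) 1 0; set t := (_ + _) => t2 ye.
rewrite normrM normfV (@gtr0_norm _ t) ?(lt_le_trans _ t2)//.
rewrite ltr_pdivrMr ?(lt_le_trans _ t2)//.
rewrite -(@ltr_pXn2r _ 2) ?nnegrE ?mulr_ge0// ?(ltW e0)// ?(le_trans _ t2)//.
rewrite real_normK ?num_real//.
have Ai : A 0 i ^+ 2 + A 1 i ^+ 2 <= t.
  rewrite /t; have [->|->] := ord2P i;
  have := sqr_ge0 (A 0 0); have := sqr_ge0 (A 1 0);
  have := sqr_ge0 (A 0 1); have := sqr_ge0 (A 1 1); lra.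
have cs : (A 0 i * y0 + A 1 i * y1) ^+ 2 <= t * (y0 ^+ 2 + y1 ^+ 2).
  have := sqr_ge0 (A 0 i * y1 - A 1 i * y0).
  have y2 : 0 <= y0 ^+ 2 + y1 ^+ 2 by rewrite addr_ge0 ?sqr_ge0.
  have := ler_wpM2r y2 Ai; nra.
apply: le_lt_trans cs _.
have t0 : 0 < t by exact: lt_le_trans t2.
have : t * (y0 ^+ 2 + y1 ^+ 2) < t * e ^+ 2 by rewrite ltr_pM2l.
move=> /lt_le_trans; apply; rewrite exprMn mulrC ler_wpM2l ?sqr_ge0//.
rewrite expr2 ler_peMr ?(ltW t0)//; lra.
Qed.

(** If A q is small, the inverse of [A] moves the base point close to q: with G = A^T A of
    determinant 1, the matrix A^-1 A^-T is tr(G) - G, and G q / tr(G) tends to 0. *)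
Lemma small_orbit_limit_set q : q != 0 ->
  (forall e : R, 0 < e -> exists2 A, Gamma0 h A & (A *m q) 0 0 ^+ 2 + (A *m q) 1 0 ^+ 2 < e) ->
  limit_set h q.
Proof.
move=> q0 small; split=> //.
have /choice[A HA] : forall n : nat, exists A, Gamma0 h A /\
    (A *m q) 0 0 ^+ 2 + (A *m q) 1 0 ^+ 2 < (n.+1%:R^-1) ^+ 2.
  by move=> n; have [|A GA Aq] := small (n.+1%:R^-1 ^+ 2); [rewrite exprn_gt0|exists A].
exists (fun n => invmx (A n)); split; first by move=> n; apply: Gamma0V; have [] := HA n.
pose Q := q 0 0 ^+ 2 + q 1 0 ^+ 2.
have Q0 : 0 < Q by have := mxtrace_mul_tr_gt0 q0; rewrite mxtrace_mul_tr.
pose er n i := gram_error (A n) q i.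
have er0 i : er n i @[n --> \oo] --> (0 : R).
  apply/cvgrPdist_lt => e e0.
  apply: filterS (near_infty_natSinv_lt (PosNum e0)) => n /= ne.
  rewrite sub0r normrN; apply: le_lt_trans ne; apply: ltW.
  by have [GA Aq] := HA n; apply: gram_error_le => //; exact: Gamma0_trace GA.
(* A symmetric 2x2 matrix S of trace 1 is determined by S q. Here S q is q minus the error vector,
   and these entries solve the linear system. *)
pose T n : 'M[R]_2 := \matrix_(i, j)
  (if i == 0 then (if j == 0 then (q 0 0 ^+ 2 - (q 0 0 * er n 0 - q 1 0 * er n 1)) / Q
                   else (q 0 0 * q 1 0 - (q 1 0 * er n 0 + q 0 0 * er n 1)) / Q)
   else (if j == 0 then (q 0 0 * q 1 0 - (q 1 0 * er n 0 + q 0 0 * er n 1)) / Q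
         else (q 1 0 ^+ 2 + (q 0 0 * er n 0 - q 1 0 * er n 1)) / Q)).
have TE : (fun n => trace_one (invmx (A n) *m (invmx (A n))^T)) = T.
  apply/funext => n; have [GA _] := HA n; have dA := Gamma0_det GA.
  have [i00 i01 i10 i11] := invmx2E dA.
  have t2 := Gamma0_trace GA.
  have ti : \tr (invmx (A n) *m (invmx (A n))^T) = \tr (A n *m (A n)^T).
    by rewrite !mxtrace_mul_tr_mx i00 i01 i10 i11 !sqrrN; lra.
  have t0 : \tr (A n *m (A n)^T) != 0 by rewrite gt_eqF// (lt_le_trans _ t2).
  have Qn0 : Q != 0 by rewrite gt_eqF.
  have SE i j : trace_one (invmx (A n) *m (invmx (A n))^T) i j =
      (invmx (A n) i 0 * invmx (A n) j 0 + invmx (A n) i 1 * invmx (A n) j 1) / \tr (A n *m (A n)^T).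
    rewrite -ti /trace_one [LHS]mxE mulrC; congr (_ / _).
    by rewrite mxE sum2E; congr (_ * _ + _ * _); rewrite mxE.
  have eE i : \tr (A n *m (A n)^T) * er n i = A n 0 i * (A n 0 0 * q 0 0 + A n 0 1 * q 1 0) +
      A n 1 i * (A n 1 0 * q 0 0 + A n 1 1 * q 1 0).
    by rewrite /er /gram_error mulrC divfK// !mulmx2E.
  have := eE 0; have := eE 1; have := mxtrace_mul_tr_mx (A n) => tE.
  move=> eE1 eE0.
  have div (x y : R) : x * Q = y * \tr (A n *m (A n)^T) -> x / \tr (A n *m (A n)^T) = y / Q.
    by move=> xy; apply/eqP; rewrite eqr_div//; exact/eqP.
  rewrite tE in eE0 eE1.
  have h00 := congr1 (fun x => q 0 0 * x) eE0; have h10 := congr1 (fun x => q 1 0 * x) eE0.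
  have h01 := congr1 (fun x => q 0 0 * x) eE1; have h11 := congr1 (fun x => q 1 0 * x) eE1.
  move: h00 h10 h01 h11 => /= h00 h10 h01 h11.
  by apply: mx22P; rewrite SE [RHS]mxE /=; apply: div; rewrite ?i00 ?i01 ?i10 ?i11 /Q tE; lra.
rewrite TE; have -> : trace_one (q *m q^T) = \matrix_(i, j) (q i 0 * q j 0 / Q).
  by apply/matrixP => i j; rewrite !mxE big_ord1 mxE mxtrace_mul_tr mulrC.
have cD : q 1 0 * er n 0 + q 0 0 * er n 1 @[n --> \oo] --> q 1 0 * 0 + q 0 0 * (0 : R).
  by apply: cvgD; apply: cvgM (er0 _); exact: cvg_cst.
have cB : q 0 0 * er n 0 - q 1 0 * er n 1 @[n --> \oo] --> q 0 0 * 0 - q 1 0 * (0 : R).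
  by apply: cvgB; apply: cvgM (er0 _); exact: cvg_cst.
rewrite !mulr0 addr0 in cD; rewrite !mulr0 subr0 in cB.
have cQ (f : nat -> R) (a : R) : f n @[n --> \oo] --> (0 : R) ->
    (a - f n) / Q @[n --> \oo] --> a / Q /\ (a + f n) / Q @[n --> \oo] --> a / Q.
  move=> f0; split; apply: cvgM; try exact: cvg_cst.
    by rewrite -[X in _ --> X]subr0; apply: cvgB => //; exact: cvg_cst.
  by rewrite -[X in _ --> X]addr0; apply: cvgD => //; exact: cvg_cst.
apply: cvg_mx => i j; rewrite [X in _ --> X]mxE; under eq_fun do rewrite mxE.
have [->|->] := ord2P i; have [->|->] := ord2P j; rewrite /= -?expr2.
- exact: (cQ _ _ cB).1.
- exact: (cQ _ _ cD).1.
- by rewrite [q 1 0 * _]mulrC; exact: (cQ _ _ cD).1.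
- exact: (cQ _ _ cB).2.
Qed.

End SmallOrbit.

Section BoundaryNeighbourhoods.
Context {R : realType}.
Implicit Types (C : 'M[R]_(3, 2)).

(* The cross product of the columns of [C]. *)
Definition normal C : 'rV[R]_3 := \row_(i < 3)
  [:: C 1 0 * C 2 1 - C 2 0 * C 1 1; C 2 0 * C 0 1 - C 0 0 * C 2 1; minor C]`_i.

Lemma rank_frame (F : @frame R) : \rank (val F) = 2%N.
Proof. exact: set_mem (valP F). Qed.

Lemma normalE C : [/\ normal C 0 0 = C 1 0 * C 2 1 - C 2 0 * C 1 1,
  normal C 0 1 = C 2 0 * C 0 1 - C 0 0 * C 2 1 & normal C 0 2 = C 0 0 * C 1 1 - C 0 1 * C 1 0].
Proof. by rewrite !mxE. Qed.

Lemma normal_equiv C C' : oriented_equiv C C' ->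
  exists2 k : R, 0 < k & normal C' = k *: normal C.
Proof.
move=> /oriented_equivP[a [b [c [a0 b0 e0 e1]]]]; exists (a * b); first exact: mulr_gt0.
by apply: row3P; rewrite !mxE /= /minor !e0 !e1; lra.
Qed.

Lemma normal_cvg {T : Type} {F : set_system T} {FF : Filter F} (f : T -> 'M[R]_(3, 2)) C :
  f @ F --> C -> normal (f x) @[x --> F] --> normal C.
Proof.
move=> fC; have cc i j : f x i j @[x --> F] --> C i j by exact: (cvg_coord i j fC).
apply: cvg_mx => i j; rewrite mxE; under eq_fun do rewrite mxE.
case: j => -[|[|[|//]]] j3 /=; last exact: minor_cvg.
  by apply: cvgB; exact: cvgM.
by apply: cvgB; exact: cvgM.
Qed.

Lemma normal_continuous {T : topologicalType} (f : T -> 'M[R]_(3, 2)) :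
  continuous f -> continuous (fun x => normal (f x)).
Proof. by move=> cf x; exact: normal_cvg (cf x). Qed.

Let gap (e : R) (v : 'rV[R]_3) : R := e * v 0 2 ^+ 2 - (v 0 0 ^+ 2 + v 0 1 ^+ 2).

Let gap_continuous {T : topologicalType} (e : R) (v : T -> 'rV[R]_3) :
  continuous v -> continuous (fun x => gap e (v x)).
Proof.
move=> cv x; have cc i : v y 0 i ^+ 2 @[y --> x] --> v x 0 i ^+ 2.
  by under eq_fun do rewrite expr2; rewrite expr2; apply: cvgM; exact: (cvg_coord 0 i (cv x)).
apply: cvgB; last exact: cvgD.
by apply: cvgM => //; exact: cvg_cst.
Qed.

(* The plane spanned by the columns of [C] is close to the plane [e1,e2]. *)
Definition near_boundary (e : R) C : Prop :=
  normal C 0 0 ^+ 2 + normal C 0 1 ^+ 2 < e * normal C 0 2 ^+ 2.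

Lemma near_boundary_equiv e C C' : oriented_equiv C C' -> near_boundary e C -> near_boundary e C'.
Proof.
move=> /normal_equiv[k k0 E]; rewrite /near_boundary E.
have kE i : (k *: normal C) 0 i = k * normal C 0 i by rewrite mxE.
move=> H; rewrite !kE !exprMn -mulrDr [e * _]mulrCA.
by rewrite ltr_pM2l ?exprn_gt0.
Qed.

(** Invariance under equivalent frames makes the choice of [repr] harmless; on frames the condition
    is a strict inequality between continuous functions. *)
Lemma near_boundary_open e :
  open [set x : @oflag R | near_boundary e (val (repr x))].
Proof.
rewrite /open /= /quotient_open.
have -> : \pi_oflag @^-1` [set x : @oflag R | near_boundary e (val (repr x))] =
    [set F : frame | near_boundary e (val F)].
  have E F : oflag_of (val (repr (\pi_oflag F))) = oflag_of (val F) by rewrite !oflag_ofE reprK.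
  apply/seteqP; split=> F /=; apply: near_boundary_equiv; apply/oflag_of_eqP;
    by rewrite ?rank_frame ?E.
pose g (F : @frame R) : R := gap e (normal (val F)).
have cg : continuous g.
  by apply: gap_continuous; apply: normal_continuous; exact: val_frame_continuous.
have -> : [set F : frame | near_boundary e (val F)] = g @^-1` [set x | 0 < x].
  by apply/seteqP; split=> F; rewrite /g /gap /near_boundary /= subr_gt0.
by apply: open_comp => [F _|]; [exact: cg|exact: open_gt].
Qed.

Lemma near_boundary_plane12 (e : R) (x : @oflag R) : 0 < e ->
  (val (forget x)).2 = plane12 -> near_boundary e (val (repr x)).
Proof.
move=> e0; rewrite /forget; set F := repr x => E.
have z (j : 'I_2) : (val F : 'M[R]_(3, 2)) 2 j = 0.
  have : col j (val F) \in plane12.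
    rewrite -E; have [->|->] := ord2P j.
      exact: subvP (addvSl _ _) _ (memv_line _).
    exact: subvP (addvSr _ _) _ (memv_line _).
  by rewrite mem_plane12 mxE => /eqP.
rewrite /near_boundary !mxE /= !z !mulr0 !mul0r subrr expr0n /= addr0.
rewrite mulr_gt0// exprn_even_gt0//=; apply/eqP => m0.
(* The third row being zero, a vanishing minor turns each of the other rows into coefficients of a
   linear relation between the columns. All entries are then 0, which contradicts independence. *)
have comb (a b : R) : a *: vec1 F + b *: vec2 F = 0 -> a = 0 /\ b = 0 by exact: frame_indep.
have [e11 e10] : (val F : 'M[R]_(3, 2)) 1 1 = 0 /\ - (val F : 'M[R]_(3, 2)) 1 0 = 0.
  apply: comb; apply: cV3P; rewrite lincombE !mxE ?z; move: m0; rewrite /minor; lra.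
have [e01 e00] : (val F : 'M[R]_(3, 2)) 0 1 = 0 /\ - (val F : 'M[R]_(3, 2)) 0 0 = 0.
  apply: comb; apply: cV3P; rewrite lincombE !mxE ?z; move: m0; rewrite /minor; lra.
have [/eqP] : 1 = 0 :> R /\ 0 = 0 :> R; last by rewrite oner_eq0.
by apply: comb; apply: cV3P; rewrite lincombE !mxE ?z; lra.
Qed.

Lemma forget_continuous : continuous (@forget R).
Proof.
apply/quotient_continuous.
have -> : forget \o \pi_oflag = @flag_of_frame R.
  apply/funext => F; apply: val_inj; have := val_forget (rank_frame F).
  by rewrite oflag_ofE.
exact: flag_of_frame_continuous.
Qed.

End BoundaryNeighbourhoods.

Section Equicontinuity.
Context {R : realType} (d : nat) (h : 'I_d -> @SL2 R).
Local Notation M := (compactification h).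
Local Notation X := (set_type (hatOmega h)).
Local Notation proj := Defs.proj.
Local Notation R3 := 'rV[R]_3.
Context (q r : 'cV[R]_2) (e : R) (c0 c1 : @chart R M).
Hypothesis mod : model_charts q r e c0 c1.

(** An arc of C_alpha(q): the plane is spanned by q and r + s e3, so it starts at [e1,e2] and turns
    towards [q,e3]. *)
Definition leaf (s : R) : M := c0.2 (vec3 0 s 0).

Lemma leaf_dom s : c0.1 (vec3 0 s 0).
Proof. by rewrite (model_dom0 mod) /= mxE normr0 (model_gt0 mod). Qed.

Lemma leaf_continuous : continuous leaf.
Proof.
have uB := basis_mx_unit (model_bracket mod).
have /choice[w Hw] : forall s, exists x : X, val x = big_cell (basis_mx q r) (vec3 0 s 0) /\
    leaf s = proj h x.
  by move=> s; have [x] := model_lift0 mod (leaf_dom s); exists x.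
have -> : leaf = proj h \o w by apply/funext => s; have [] := Hw s.
have cw : continuous w.
  move=> s; apply: continuous_hatOmega.
  have -> : (fun s => val (w s) : @oflag R) = big_cell (basis_mx q r) \o (fun s => vec3 0 s 0).
    by apply/funext => s'; have [] := Hw s'.
  apply: continuous_comp; last exact: big_cell_continuous.
  apply: cvg_mx => i j; rewrite mxE; under eq_fun do rewrite mxE.
  by case: j => -[|[|[|//]]] j3 /=; by [exact: cvg_cst|exact: cvg_id].
by move=> s; apply: continuous_comp; [exact: cw|exact: pi_continuous].
Qed.

Lemma leaf_flow (t s : R) : flow h t (leaf s) = leaf (expR (- (t / 2)) * s).
Proof.
rewrite /leaf (model_flow0 mod _ (leaf_dom s)); congr c0.2.
by apply: row3P; rewrite !mxE /= ?mxE /= ?mulr0.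
Qed.

Lemma plane12_act (B : 'M[R]_3) (x : @oflag R) : hatGamma h B ->
  (val (forget x)).2 = plane12 -> (val (forget (act B x))).2 = plane12.
Proof.
move=> hB xS; have [A [s [GA s1 EB]]] := (hatGammaP _ _).1 hB.
rewrite (forget_act _ (hatGamma_unit hB)).
rewrite -[LHS]/(linfun (mulmx B) @: (val (forget x)).2)%VS xS EB limg_j_mx_plane12//.
have uA := Gamma0_unit GA.
have us : s \is a GRing.unit by case: s1 => ->; rewrite ?unitrN unitr1.
by rewrite unitmxZ.
Qed.

Lemma leaf_lift s : exists2 x : X, val x = big_cell (basis_mx q r) (vec3 0 s 0) &
  leaf s = proj h x.
Proof. exact: (model_lift0 mod (leaf_dom s)). Qed.

(* The lifts of [leaf 0] all have plane [e1,e2], hence so does [y]; lifts of [leaf 1] close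
   to [y] have their plane close to [e1,e2], which bounds [A q] for some [A] in [Gamma_0]. *)
Lemma inseparable_leaf_false (y : M) :
  (forall U : set M, open U -> U y -> U (leaf 0) /\ U (leaf 1)) -> False.
Proof.
move=> Hy; have [x ex] := proj_surj y.
have uB := basis_mx_unit (model_bracket mod).
have lift_nbhs (W : set (@oflag R)) s : open W -> W (val x) -> s = 0 \/ s = 1 ->
    exists2 z : X, W (val z) & leaf s = proj h z.
  move=> oW Wx s01.
  have [|H0 H1] := Hy _ (proj_open h oW); first by exists x.
  by case: s01 => ->.
have xS : (val (forget (val x))).2 = plane12.
  apply: contrapT => nS.
  have oW : open (~` (forget @^-1` [set z : @flag R | (val z).2 = plane12])).
    rewrite openC; apply: closed_comp; last exact: closed_boundary.
    by move=> z _; exact: forget_continuous.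
  have [|z nz ez] := lift_nbhs _ 0 oW nS; first by left.
  have [w ew cw] := leaf_lift 0.
  have /proj_eqP[B GB eB] : proj h w = proj h z by rewrite -cw ez.
  apply: nz; rewrite /= eB; apply: (plane12_act GB).
  rewrite ew big_cellE val_forget ?rank_cell//=.
  have := @boundary_flag_frame _ q r (model_bracket mod) (vec3 0 0 0).
  by rewrite !mxE /= => /(_ erefl erefl)[_].
apply: (model_limit_set mod); apply: small_orbit_limit_set.
  by have := line_neq0 0 (model_bracket mod); rewrite scale0r addr0.
move=> k k0; have b0 := model_bracket mod.
have b2 : 0 < bracket q r ^+ 2 by rewrite exprn_even_gt0.
(* The translated frame has columns A q and A r + e3, up to signs on the first summands. Its normal
   has two entries of norm |A q| and the third is [A q, A r] = [q, r], whence the division by this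
   square. *)
pose k' := k / bracket q r ^+ 2.
have k'0 : 0 < k' by rewrite divr_gt0.
have [|z nz ez] := lift_nbhs _ 1 (near_boundary_open k') (near_boundary_plane12 k'0 xS).
  by right.
have [w ew cw] := leaf_lift 1.
have /proj_eqP[B GB eB] : proj h w = proj h z by rewrite -cw ez.
have [A [s [GA s1 EB]]] := (hatGammaP _ _).1 GB.
exists A => //.
have uBB := hatGamma_unit GB.
have eq : oriented_equiv (val (repr (val z))) (B *m (basis_mx q r *m cell_mx (vec3 0 1 0))).
  have rB : \rank (B *m (basis_mx q r *m cell_mx (vec3 0 1 0))) = 2%N.
    by rewrite rank_unit_mul// rank_cell.
  apply/(oflag_of_eqP (rank_frame _) rB).
  by rewrite oflag_ofE reprK eB ew big_cellE act_oflag_of ?rank_cell.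
have := near_boundary_equiv eq nz; rewrite /near_boundary.
set C := B *m _; have ss : s * s = 1 by case: s1 => ->; rewrite ?mulrNN mulr1.
have [c0E c1E] := basis_mx_col q r (vec3 0 1 0).
have C0 : col 0 C = in_plane12 (s *: (A *m q)).
  rewrite /C col_mulmx col_mulmx c0E !mxE /= !scale0r !addr0 EB j_mx_in_plane12.
  by rewrite -scalemxAl.
have C1 : col 1 C = in_plane12 (s *: (A *m r)) + e3.
  rewrite /C col_mulmx col_mulmx c1E !mxE /= scale1r mulmxDr EB j_mx_in_plane12 j_mx_e3.
  by rewrite -scalemxAl.
have E0 i : C i 0 = in_plane12 (s *: (A *m q)) i 0 by rewrite -C0 [RHS]mxE.
have E1 i : C i 1 = in_plane12 (s *: (A *m r)) i 0 + 1 * e3 i 0.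
  by rewrite -addscaleE scale1r -C1 [RHS]mxE.
have [q0 q1 q2] := in_plane12E (s *: (A *m q)).
have [r0 r1 r2] := in_plane12E (s *: (A *m r)).
have [f0 f1 f2] := @e3E R.
have [-> -> ->] := normalE C.
rewrite !E0 !E1 q0 q1 q2 r0 r1 r2 f0 f1 f2.
have sE (u : 'cV[R]_2) i : (s *: u) i 0 = s * u i 0 by rewrite mxE.
have D : (A *m q) 0 0 * (A *m r) 1 0 - (A *m r) 0 0 * (A *m q) 1 0 = bracket q r.
  have := Gamma0_det GA; rewrite det2E !mulmx2E /bracket => dA.
  rewrite -[RHS]mul1r -dA; lra.
rewrite !sE; set u0 := (A *m q) 0 0 in D *; set u1 := (A *m q) 1 0 in D *.
set v0 := (A *m r) 0 0 in D *; set v1 := (A *m r) 1 0 in D *.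
move=> lt; have : (s * s) * (u0 ^+ 2 + u1 ^+ 2) < k' * ((s * s) * (u0 * v1 - v0 * u1)) ^+ 2.
  by move: lt; lra.
by rewrite ss D !mul1r /k' divfK// gt_eqF.
Qed.

Lemma not_equicontinuous (t : R) : t != 0 -> ~ equicontinuous_map (flow h t).
Proof.
move=> t0 [K [cK KG Kc]]; pose s : R := `|t|.
have s0 : 0 < s by rewrite normr_gt0.
(* In backward time the leaf is stretched away from its fixed point [leaf 0]. *)
pose g (n : nat) : {compact-open, M -> M} := flow h (- (n%:R * s)).
have Kg n : K (g n).
  apply: KG; exists n; rewrite iter_flow /g; have [tp|tn] := ltP 0 t.
    right; rewrite /s gtr0_norm//; split; [exact: flowKN|exact: flowNK].
  by left; rewrite /s ler0_norm// mulrN opprK.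
have FK : (g @ \oo) K by exists 0%N => // n _; exact: Kg.
have [k [Kk clk]] := cK _ _ FK.
have ck : continuous (k : M -> M) by exact: Kc.
apply: (@inseparable_leaf_false (k (leaf 0))) => U oU Uk.
have [e' /= e'0 He] : \forall x \near (0 : R), U (k (leaf x)).
  have cl : {for 0, continuous ((k : M -> M) \o leaf)}.
    by apply: continuous_comp; [exact: leaf_continuous|exact: ck].
  by apply: cl; exact: open_nbhs_nbhs.
pose I := `[- (e' / 2), e' / 2]%classic : set R.
have cI : compact (leaf @` I).
  apply: continuous_compact; last exact: segment_compact.
  by apply: continuous_subspaceT; exact: leaf_continuous.
(* The neighbourhood of [k] in the compact-open topology attached to a compact arc of the leaf
   around [leaf 0]. *)
have nk : nbhs k ([set f | f @` (leaf @` I) `<=` U] : set {compact-open, M -> M}).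
  apply: open_nbhs_nbhs; split; first exact: compact_open_open.
  move=> _ [_ [x xI <-] <-]; apply: He; rewrite /= sub0r normrN.
  move: xI; rewrite /I /= in_itv /= => /andP[x1 x2].
  by rewrite ltr_norml; apply/andP; split; lra.
pose kp := expR (- (s / 2)).
have kp0 : 0 < kp by exact: expR_gt0.
have kp1 : kp < 1 by rewrite -expR0 ltr_expR oppr_lt0 divr_gt0.
(* From this rank on the arc contains [leaf (kp ^+ n)], which [g n] sends to [leaf 1], besides the
   fixed point [leaf 0]. *)
have [N _ HN] : \forall n \near \oo, kp ^+ n < e' / 2.
  have ckp : kp ^+ n @[n --> \oo] --> (0 : R) by apply: cvg_expr; rewrite gtr0_norm.
  by apply: (cvgr_lt _ ckp); rewrite divr_gt0.
have FN : (g @ \oo) [set f | exists2 n, (N <= n)%N & f = g n].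
  by exists N => // n Nn; exists n.
have [_ [[n Nn ->] Ug]] := clk _ _ FN nk.
have gE x : g n (leaf x) = leaf (kp ^- n * x).
  rewrite /g leaf_flow; congr (leaf (_ * _)).
  by rewrite mulNr opprK -expRM_natl -expRN; congr expR; lra.
have inI x : `|x| <= e' / 2 -> U (g n (leaf x)).
  move=> xe; apply: Ug; exists (leaf x) => //; exists x => //.
  by rewrite /I /= in_itv /= -ler_norml.
have kn0 : 0 < kp ^+ n by rewrite exprn_gt0.
split.
  have e20 : `|(0 : R)| <= e' / 2 by rewrite normr0 divr_ge0// ltW.
  by have := inI _ e20; rewrite gE mulr0.
have kne : `|kp ^+ n| <= e' / 2 by rewrite gtr0_norm// ltW// HN.
by have := inI _ kne; rewrite gE mulVf// gt_eqF.
Qed.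

End Equicontinuity.

Theorem theorem2 (R : realType) (d : nat) (h : 'I_d -> @SL2 R)
    (d_gt0 : (0 < d)%N)
    (h_hyperbolic : positive_hyperbolic h)
    (h_fixed : distinct_fixed_points h)
    (h_schottky : schottky (gen h)) :
  (forall t : R, t != 0 ->
     [/\ ~ equicontinuous_map (flow h t),
         ~ conservative (atlas h) (flow h t) &
         ~ partially_hyperbolic (atlas h) (flow h t)]) /\
  [/\ path_structure (atlas h) (E_alpha h) (E_beta h),
      automorphism_flow (atlas h) (E_alpha h) (E_beta h) (flow h) &
      strongly_essential (atlas h) (E_alpha h) (E_beta h) (flow h)].
Proof.
have [q [r [e [c0 [c1 mod]]]]] := model_charts_ex d_gt0 h_hyperbolic h_schottky.
split=> [t t0|]; split.
- exact: not_equicontinuous mod _ t0.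
- exact: not_conservative mod _ t0.
- exact: not_partially_hyperbolic mod _ t0.
- exact: path_structure_charts.
- exact: automorphism_flow_flow.
- exact: strongly_essential_flow mod.
Qed.
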